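(* Consider problem $(P^{y_0}_\beta)$ with $Q=I_n$. Let $f\in C^1(\mathbb R^n;\mathbb R^n)$ with $f(0)=0$ and $Df$ Lipschitz on compact sets, set $A=Df(0)$, and assume there is $\hat F\in\mathbb R^{m\times n}$ such that $A+B\hat F$ is exponentially stable. Assume further that the Nemytskii operator $y\mapsto f(y(\cdot))$ is of class $C^{k+1}$ from $W_\infty$ to $L^2(I;\mathbb R^n)$ for some $k\ge1$. Then there exists $\delta>0$ such that for every $y_0$ with $|y_0|<\delta$ problem $(P^{y_0}_\beta)$ admits a minimizer, and the value function $V$ (the minimal value of $(P^{y_0}_\beta)$) is of class $C^k$ on the open ball $B_\delta(0)$.
   Context: $I=[0,\infty)$, $W_\infty=\{y\in L^2(I;\mathbb R^n):\dot y\in L^2(I;\mathbb R^n)\}$ (distributional derivative) with norm $\|y\|_{W_\infty}=(\|y\|_{L^2}^2+\|\dot y\|_{L^2}^2)^{1/2}$. Given $f:\mathbb R^n\to\mathbb R^n$, $B\in\mathbb R^{n\times m}$, a positive semidefinite $Q\in\mathbb R^{n\times n}$ and $\beta>0$, for $y_0\in\mathbb R^n$ problem $(P^{y_0}_\beta)$ is: minimize $J(y,u)=\frac12\int_0^\infty(|Qy(t)|^2+\beta|u(t)|^2)\,dt$ over $(y,u)\in W_\infty\times L^2(I;\mathbb R^m)$ subject to $\dot y=f(y)+Bu$ a.e. on $I$, $y(0)=y_0$. A matrix $E$ is exponentially stable if $e^{Et}\to0$ exponentially, i.e. all eigenvalues have negative real part. *)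

(* Defs.v *)
From mathcomp Require Import all_boot all_algebra.
From mathcomp Require Import all_classical all_reals all_analysis.
From mathcomp Require complex.
Import complex.ComplexField.

Set Implicit Arguments.
Unset Strict Implicit.
Unset Printing Implicit Defensive.
Import GRing.Theory Num.Theory.
Import numFieldNormedType.Exports.
Local Open Scope classical_set_scope.
Local Open Scope ring_scope.

Definition Iset (R : realType) : set R := `[0%R, +oo[.

Definition sqnorm (R : realType) (p : nat) (v : 'cV[R]_p) : R :=
  \sum_(i < p) (v i 0) ^+ 2.
Definition enorm (R : realType) (p : nat) (v : 'cV[R]_p) : R :=
  Num.sqrt (sqnorm v).

Fixpoint CkOn (R : realType) (p : nat) (V : normedModType R) (k : nat)
    (g : 'cV[R]_p -> V) (U : set 'cV[R]_p) : Prop :=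
  match k with
  | 0 => forall x, U x -> {for x, continuous g}
  | k'.+1 => (forall x, U x -> differentiable g x) /\
             forall v : 'cV[R]_p, CkOn k' (fun x => 'D_v g x) U
  end.

Definition DLipschitzOnCompacts (R : realType) (p : nat)
    (f : 'cV[R]_p -> 'cV[R]_p) : Prop :=
  forall K : set 'cV[R]_p, compact K ->
    exists L : R, forall x y, K x -> K y -> forall v : 'cV[R]_p,
      `|'d f x v - 'd f y v| <= L * `|x - y| * `|v|.

Definition jacobian0 (R : realType) (p : nat) (f : 'cV[R]_p -> 'cV[R]_p)
  : 'M[R]_p :=
  \matrix_(i < p, j < p) ('d f 0 (delta_mx j 0)) i 0.

Definition exp_stable (R : realType) (p : nat) (E : 'M[R]_p) : Prop :=
  forall z : complex.complex R,
    root (map_poly (complex.real_complex R) (char_poly E)) z ->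
    complex.Re z < 0.

Definition L2sq (R : realType) (p : nat) (g : R -> 'cV[R]_p) : \bar R :=
  (\int[lebesgue_measure]_(t in (@Iset R)) (sqnorm (g t))%:E)%E.

Definition isL2 (R : realType) (p : nat) (g : R -> 'cV[R]_p) : Prop :=
  (forall i : 'I_p, measurable_fun ((@Iset R)) (fun t => g t i 0)) /\
  (L2sq g < +oo)%E.

Definition L2norm (R : realType) (p : nat) (g : R -> 'cV[R]_p) : R :=
  Num.sqrt (fine (L2sq g)).

Definition vint (R : realType) (p : nat) (g : R -> 'cV[R]_p) (t : R)
  : 'cV[R]_p :=
  \col_(i < p) (\int[lebesgue_measure]_(s in `[0%R, t]) g s i 0).

(* yd is the (distributional) derivative of y on I, y in L^2, yd in L^2;
   y is taken as its (absolutely) continuous representative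
   y(t) = y(0) + int_0^t yd. *)
Definition isWderiv (R : realType) (p : nat) (y yd : R -> 'cV[R]_p) : Prop :=
  isL2 y /\ isL2 yd /\ forall t, 0 <= t -> y t = y 0 + vint yd t.

Definition inW (R : realType) (p : nat) (y : R -> 'cV[R]_p) : Prop :=
  exists yd, isWderiv y yd.

(* ||y||_W = (||y||^2 + ||dy/dt||^2)^(1/2) (the derivative is unique a.e.,
   so the set below is a singleton for y in W_infty) *)
Definition Wnorm (R : realType) (p : nat) (y : R -> 'cV[R]_p) : R :=
  inf [set r : R | exists yd, isWderiv y yd /\
                      r = Num.sqrt (fine (L2sq y) + fine (L2sq yd))].

Definition consv (T : Type) (h : T) (v : nat -> T) : nat -> T :=
  fun i => if i is i'.+1 then v i' else h.
Definition setv (T : Type) (v : nat -> T) (i : nat) (w : T) : nat -> T :=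
  fun j => if j == i then w else v j.

(* N : X -> Y is of class C^m (Fréchet) on X, where X (resp. Y) is the set of
   functions R -> R^p (resp. R -> R^q) satisfying memX (resp. memY) with
   seminorm normX (resp. normY).  D j y is the j-th derivative at y, a bounded
   j-linear map X^j -> Y (acting on the first j entries of v); D (j+1) is the
   Fréchet derivative of D j in the operator norm of j-linear maps, and D m is
   continuous in that norm.  Identities in Y are understood modulo
   normY-null functions (i.e. a.e. for L^2). *)
Definition FrechetCk (R : realType) (p q : nat)
    (memX : (R -> 'cV[R]_p) -> Prop) (normX : (R -> 'cV[R]_p) -> R)
    (memY : (R -> 'cV[R]_q) -> Prop) (normY : (R -> 'cV[R]_q) -> R)
    (m : nat) (N : (R -> 'cV[R]_p) -> (R -> 'cV[R]_q)) : Prop :=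
  (forall y, memX y -> memY (N y)) /\
  exists D : nat -> (R -> 'cV[R]_p) -> (nat -> (R -> 'cV[R]_p)) ->
             (R -> 'cV[R]_q),
    (forall y v, memX y -> D 0%N y v = N y) /\
    (forall j, (j <= m)%N -> forall y, memX y ->
       (forall v v', (forall i, (i < j)%N -> v i = v' i) ->
          D j y v = D j y v') /\
       (forall v, (forall i, (i < j)%N -> memX (v i)) -> memY (D j y v)) /\
       (forall v, (forall i, (i < j)%N -> memX (v i)) ->
          forall i, (i < j)%N -> forall (a : R) w, memX w ->
            normY (fun t => D j y (setv v i (fun s => a *: v i s + w s)) t
                            - (a *: D j y v t + D j y (setv v i w) t)) = 0) /\
       (exists C : R, forall v, (forall i, (i < j)%N -> memX (v i)) ->
          normY (D j y v) <= C * \prod_(i < j) normX (v i))) /\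
    (forall j, (j < m)%N -> forall y, memX y ->
       forall eps : R, 0 < eps -> exists delta : R, 0 < delta /\
         forall h, memX h -> normX h < delta ->
         forall v, (forall i, (i < j)%N -> memX (v i)) ->
           normY (fun t => D j (fun s => y s + h s) v t - D j y v t
                           - D j.+1 y (consv h v) t)
             <= eps * normX h * \prod_(i < j) normX (v i)) /\
    (forall y, memX y ->
       forall eps : R, 0 < eps -> exists delta : R, 0 < delta /\
         forall h, memX h -> normX h < delta ->
         forall v, (forall i, (i < m)%N -> memX (v i)) ->
           normY (fun t => D m (fun s => y s + h s) v t - D m y v t)
             <= eps * \prod_(i < m) normX (v i)).

Definition nemytskii (R : realType) (p : nat) (f : 'cV[R]_p -> 'cV[R]_p)
    (y : R -> 'cV[R]_p) : R -> 'cV[R]_p :=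
  fun t => f (y t).

Definition admissible (R : realType) (n m : nat) (f : 'cV[R]_n -> 'cV[R]_n)
    (B : 'M[R]_(n, m)) (y0 : 'cV[R]_n)
    (y : R -> 'cV[R]_n) (u : R -> 'cV[R]_m) : Prop :=
  inW y /\ isL2 u /\ y 0 = y0 /\
  exists yd, isWderiv y yd /\
    {ae lebesgue_measure, forall t, (@Iset R) t -> yd t = f (y t) + B *m u t}.

Definition costJ (R : realType) (n m : nat) (beta : R)
    (y : R -> 'cV[R]_n) (u : R -> 'cV[R]_m) : R :=
  2^-1 * (fine (L2sq y) + beta * fine (L2sq u)).

Definition isMinimizer (R : realType) (n m : nat) (f : 'cV[R]_n -> 'cV[R]_n)
    (B : 'M[R]_(n, m)) (beta : R) (y0 : 'cV[R]_n)
    (y : R -> 'cV[R]_n) (u : R -> 'cV[R]_m) : Prop :=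
  admissible f B y0 y u /\
  forall y' u', admissible f B y0 y' u' -> costJ beta y u <= costJ beta y' u'.

Definition valueFun (R : realType) (n m : nat) (f : 'cV[R]_n -> 'cV[R]_n)
    (B : 'M[R]_(n, m)) (beta : R) (y0 : 'cV[R]_n) : R :=
  inf [set r : R | exists y u, admissible f B y0 y u /\ r = costJ beta y u].

(* Main.v *)
Require Import Defs.
From HB Require Import structures.
From mathcomp Require Import all_boot all_order all_algebra.
From mathcomp Require Import all_classical all_reals all_analysis.
From mathcomp Require Import measurable_realfun.
From mathcomp Require Import ring lra.
From mathcomp Require complex.

(* Testing the Nemytskii operator on functions that equal a constant x on [0, 1]
   shows that f itself is of class C^(k+1).  The stabilizing solution P of the
   Riccati equation then splits the linearized Hamiltonian system into a stable
   and an antistable part, so that for small y0 the full Hamiltonian system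
   y' = f(y) - S p, p' = - y - Df(y)^T p, with S = B B^T / beta, has a unique
   small exponentially decaying solution with y(0) = y0 (Perron's fixed point),
   and y0 |-> p(0) =: psi(y0) is of class C^(k-1).  Let W(y0) be the cost of this
   solution.  The costate equation gives
   |W(y0 + v) - W(y0) - psi(y0).v| <= C |v|^2, hence DW = psi and W is of class
   C^k, and since the Hamiltonian is constant along the solution and tends to 0,
   W satisfies the Hamilton-Jacobi-Bellman equation.  A trajectory of small cost
   stays in a small ball, where this equation shows that W(y(t)) decreases no
   faster than the running cost; as y(t) is arbitrarily small at suitable times,
   W(y0) bounds the cost from below, and W is the value function. *)

Set Implicit Arguments.
Unset Strict Implicit.
Unset Printing Implicit Defensive.
Import Order.TTheory GRing.Theory Num.Theory.
Import numFieldNormedType.Exports.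
Local Open Scope classical_set_scope.
Local Open Scope ring_scope.

(** * Finite-dimensional calculus *)

(** Two derivatives are spent and one is recovered: the costate equation contains [Df], the
    tangent-system argument rests on Lipschitz bounds and stops one order short of its nonlinearity,
    and [DW = psi] gives one order back. This is the passage from [C^(k+1)] to [C^k]. The fixed
    point is sought among continuous functions with an exponential weight rather than in [W_infty]:
    there the nonlinearity contracts by pointwise estimates alone, and the decay removes all
    boundary terms at infinity and makes the cost finite. Competitors, by contrast, are only
    absolutely continuous, satisfy the equation almost everywhere, and come with no decay rate. Two
    devices handle them. An inequality along trajectories uses only a quadratic expansion of the
    test function and repeated bisection of arc length in place of a chain rule. A bootstrap shows
    that the cost, which contains [|y|^2] because [Q = I_n], bounds the growth of [|y|^2] and so
    confines the trajectory to the ball where [W] is known. The minimizer is thus exhibited and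
    compared, not obtained as a limit. *)

Section FiniteDimNorm.
Context {R : realType}.

Lemma mx_coord_le m n (x : 'M[R]_(m, n)) i j : `|x i j| <= `|x|.
Proof.
rewrite [leRHS]/Num.Def.normr/= mx_normrE.
by apply: le_trans (le_bigmax _ _ (i, j)).
Qed.

Lemma mx_norm_le m n (x : 'M[R]_(m, n)) a :
  0 <= a -> (forall i j, `|x i j| <= a) -> `|x| <= a.
Proof.
move=> a0 xa; rewrite [leLHS]/Num.Def.normr/= mx_normrE.
by apply: bigmax_le => // -[i j] _ /=; exact: xa.
Qed.

Lemma cV_norm_le p (x : 'cV[R]_p) a :
  0 <= a -> (forall i, `|x i 0| <= a) -> `|x| <= a.
Proof. by move=> a0 xa; apply: mx_norm_le => // i j; rewrite (ord1 j). Qed.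

Lemma norm_mulmx m n p (A : 'M[R]_(m, n)) (B : 'M[R]_(n, p)) :
  `|A *m B| <= n%:R * `|A| * `|B|.
Proof.
apply: mx_norm_le => [|i j]; first by rewrite !mulr_ge0.
rewrite mxE; apply: le_trans (ler_norm_sum _ _ _) _.
have -> : n%:R * `|A| * `|B| = \sum_(k < n) `|A| * `|B|.
  by rewrite sumr_const card_ord -mulrA mulr_natl.
by apply: ler_sum => k _; rewrite normrM ler_pM// mx_coord_le.
Qed.

Lemma norm_col_mx m n (u : 'cV[R]_m) (v : 'cV[R]_n) a :
  `|u| <= a -> `|v| <= a -> `|col_mx u v| <= a.
Proof.
move=> ua va; apply: cV_norm_le => [|i]; first exact: le_trans ua.
rewrite mxE; case: splitP => j _.
  exact: le_trans (mx_coord_le u j 0) ua.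
exact: le_trans (mx_coord_le v j 0) va.
Qed.

Lemma norm_col_mx_lt m n (u : 'cV[R]_m) (v : 'cV[R]_n) a :
  `|u| < a -> `|v| < a -> `|col_mx u v| < a.
Proof.
move=> ua va; apply: (@le_lt_trans _ _ (Num.max `|u| `|v|)).
  by apply: norm_col_mx; rewrite le_max lexx ?orbT.
by rewrite gt_max ua.
Qed.

Lemma norm_usubmx m n (u : 'cV[R]_(m + n)) : `|usubmx u| <= `|u|.
Proof. by apply: cV_norm_le => // i; rewrite mxE mx_coord_le. Qed.

Lemma norm_dsubmx m n (u : 'cV[R]_(m + n)) : `|dsubmx u| <= `|u|.
Proof. by apply: cV_norm_le => // i; rewrite mxE mx_coord_le. Qed.

Lemma cV_delta_sum p (v : 'cV[R]_p) : v = \sum_j v j 0 *: delta_mx j 0.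
Proof.
apply/colP => i; rewrite summxE (bigD1 i)//= !mxE !eqxx mulr1 big1 ?addr0// => j ji.
by rewrite !mxE eqxx andbT eq_sym (negPf ji) mulr0.
Qed.

Lemma cV_linear_sum p (W : lmodType R) (L : 'cV[R]_p -> W) v :
  linear L -> L v = \sum_j v j 0 *: L (delta_mx j 0).
Proof.
move=> lin; pose LL := HB.pack_for {linear 'cV[R]_p -> W} L (GRing.isLinear.Build _ _ _ _ _ lin).
rewrite -[L]/(LL : _ -> _) {1}(cV_delta_sum v) linear_sum.
by apply: eq_bigr => j _; rewrite linearZ.
Qed.

Lemma cV_linear_bound p (W : normedModType R) (L : 'cV[R]_p -> W) :
  linear L -> exists2 C, 0 <= C & forall v, `|L v| <= C * `|v|.
Proof.
move=> lin; exists (\sum_j `|L (delta_mx j 0)|).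
  by apply: sumr_ge0.
move=> v; rewrite (cV_linear_sum v lin) mulr_suml.
apply: le_trans (ler_norm_sum _ _ _) _; apply: ler_sum => j _.
by rewrite normrZ mulrC ler_wpM2l// mx_coord_le.
Qed.

Lemma diff_lin_eps (V W : normedModType R) (f : V -> W) (L : {linear V -> W}) (x : V) :
  continuous L ->
  (forall e : R, 0 < e -> exists2 d : R, 0 < d & forall h : V, `|h| < d ->
     `|f (x + h) - f x - L h| <= e * `|h|) ->
  differentiable f x /\ forall v, 'D_v f x = L v.
Proof.
move=> cL Hf; have E : f \o shift x = cst (f x) + L +o_ 0 id.
  apply/eqaddoP => e e0; have [d d0 Hd] := Hf e e0.
  near=> h; rewrite !fctE /= opprD addrA (addrC h); apply: Hd.
  by near: h; apply/nbhs_ballP; exists d => //= h; rewrite -ball_normE/= sub0r normrN.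
have dE := diff_unique cL E.
have df : differentiable f x by apply/diff_locallyP; rewrite dE.
by split=> // v; rewrite deriveE// dE.
Unshelve. all: by end_near. Qed.

(** A linear map out of a finite-dimensional space is bounded, so an unbundled [L] and the
    epsilon-delta estimate suffice. The explicit derivatives in finite dimension are computed
    through this lemma. *)
Lemma diff_cV p (W : normedModType R) (f L : 'cV[R]_p -> W) (x : 'cV[R]_p) :
  linear L ->
  (forall e : R, 0 < e -> exists2 d : R, 0 < d & forall h : 'cV[R]_p, `|h| < d ->
     `|f (x + h) - f x - L h| <= e * `|h|) ->
  differentiable f x /\ forall v, 'D_v f x = L v.
Proof.
move=> lin; pose LL := HB.pack_for {linear 'cV[R]_p -> W} L (GRing.isLinear.Build _ _ _ _ _ lin).
apply: (@diff_lin_eps _ _ f LL).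
have [C C0 HC] := cV_linear_bound lin.
apply: bounded_linear_continuous; apply/linear_boundedP.
near=> r => v; apply: le_trans (HC v) _.
by rewrite ler_wpM2r//; near: r; exact: nbhs_pinfty_ge.
Unshelve. all: by end_near. Qed.

Lemma diff_eps (V W : normedModType R) (f : V -> W) (x : V) :
  differentiable f x ->
  forall e : R, 0 < e -> exists2 d : R, 0 < d & forall h, `|h| < d ->
     `|f (x + h) - f x - 'D_h f x| <= e * `|h|.
Proof.
move=> df e e0; have /diff_locally/eqaddoP/(_ e e0) := df.
move/nbhs_ballP => [d d0 Hd]; exists d => // h hd.
have := Hd h; rewrite -ball_normE /= sub0r normrN => /(_ hd).
by rewrite !fctE/= opprD addrA (addrC h) deriveE.
Qed.

Lemma diff_linear (V W : normedModType R) (f : V -> W) (x : V) :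
  differentiable f x -> linear (fun v => 'D_v f x).
Proof. by move=> df a u v; rewrite !deriveE// linearP. Qed.

Lemma continuous_atP (V W : normedModType R) (f : V -> W) (x : V) :
  {for x, continuous f} <->
  forall e : R, 0 < e -> exists2 d : R, 0 < d & forall h, `|h - x| < d -> `|f h - f x| < e.
Proof.
split=> [cf e e0|H].
  have /cvgrPdist_lt/(_ e e0)/nbhs_ballP[d d0 Hd] := cf.
  exists d => // h hd; rewrite distrC; apply: Hd.
  by rewrite -ball_normE/= distrC.
apply/cvgrPdist_lt => e e0; have [d d0 Hd] := H e e0.
apply/nbhs_ballP; exists d => //= h; rewrite -ball_normE/= distrC => hd.
by rewrite distrC; exact: Hd.
Qed.

Lemma open_norm (V : normedModType R) (U : set V) (x : V) :
  open U -> U x -> exists2 d : R, 0 < d & forall y, `|y - x| < d -> U y.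
Proof.
move=> oU Ux; have /nbhs_ballP[d d0 Hd] := open_nbhs_nbhs (conj oU Ux).
by exists d => // y yd; apply: Hd; rewrite -ball_normE/= distrC.
Qed.
End FiniteDimNorm.

(** * Closure properties of the classes C^k on open sets *)

Section CkCalculus.
Context {R : realType}.
Implicit Types (p q k : nat).

(** A ball of the maximum norm, the norm of all estimates; the Euclidean ball of the theorem enters
    only at the end, by inclusion. *)
Definition openball p (d : R) : set 'cV[R]_p := [set x | `|x| < d].

Lemma open_openball p d : open (@openball p d).
Proof.
apply: (@open_comp _ _ (fun x : 'cV[R]_p => `|x|) [set r | r < d]); last exact: open_lt.
by move=> x _; exact: norm_continuous.
Qed.

Lemma CkOn_sub p (V : normedModType R) k (g : 'cV[R]_p -> V) (U U' : set 'cV[R]_p) :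
  U' `<=` U -> CkOn k g U -> CkOn k g U'.
Proof.
move=> UU; elim: k g => [|k IH] g /=; first by move=> H x /UU/H.
by move=> [dg H]; split=> [x /UU/dg//|v]; exact: IH.
Qed.

Lemma CkOn_pred p (V : normedModType R) k (g : 'cV[R]_p -> V) (U : set 'cV[R]_p) :
  CkOn k.+1 g U -> CkOn k g U.
Proof.
elim: k g => [|k IH] g.
  by move=> [dg _] x /dg; exact: differentiable_continuous.
by move=> [dg H]; split=> // v; apply: IH; exact: H.
Qed.

Lemma CkOn_le p (V : normedModType R) k l (g : 'cV[R]_p -> V) (U : set 'cV[R]_p) :
  (k <= l)%N -> CkOn l g U -> CkOn k g U.
Proof.
elim: l => [|l IH]; first by rewrite leqn0 => /eqP->.
by rewrite leq_eqVlt => /predU1P[->//|kl] /CkOn_pred; exact: IH.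
Qed.

Lemma CkOn_cont p (V : normedModType R) k (g : 'cV[R]_p -> V) U x :
  CkOn k g U -> U x -> {for x, continuous g}.
Proof. by move=> /(CkOn_le (leq0n k)); exact. Qed.

(** Openness makes equality on [U] an equality near each point of [U], so the directional
    derivatives agree on [U] again and the induction proceeds. *)
Lemma CkOn_eq p (V : normedModType R) k (g h : 'cV[R]_p -> V) (U : set 'cV[R]_p) :
  open U -> (forall x, U x -> g x = h x) -> CkOn k g U -> CkOn k h U.
Proof.
move=> oU; elim: k g h => [|k IH] g h gh /=.
  move=> H x Ux; apply/continuous_atP => e e0.
  have [d d0 Hd] := (continuous_atP _ _).1 (H x Ux) e e0.
  have [d' d'0 Hd'] := open_norm oU Ux.
  exists (Num.min d d') => [|y]; first by rewrite lt_min d0.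
  by rewrite lt_min => /andP[yd yd']; rewrite -!gh ?Hd//; exact: Hd'.
move=> [dg H]; have nE (x : 'cV[R]_p) : U x -> {near x, g =1 h}.
  move=> Ux; have [d' d'0 Hd'] := open_norm oU Ux.
  by apply/nbhs_ballP; exists d' => // y; rewrite -ball_normE/= distrC => /Hd'/gh.
split=> [x Ux|v].
  have [||//] := @diff_cV _ _ _ h (fun v => 'D_v g x) x.
    by apply: diff_linear; exact: dg.
  move=> e e0; have [d d0 Hd] := diff_eps (dg x Ux) e0.
  have [d' d'0 Hd'] := open_norm oU Ux.
  exists (Num.min d d') => [|v]; first by rewrite lt_min d0.
  rewrite lt_min => /andP[vd vd'].
  by rewrite -!gh ?Hd//; apply: Hd'; rewrite addrAC subrr add0r.
by apply: IH (H v) => x Ux; apply: near_eq_derive; exact: nE.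
Qed.

Lemma CkOn_cst p (V : normedModType R) k (c : V) (U : set 'cV[R]_p) :
  CkOn k (fun _ : 'cV[R]_p => c) U.
Proof.
elim: k c => [|k IH] c /=; first by move=> x _; exact: cst_continuous.
split=> [x _|v]; first exact: differentiable_cst.
have -> : 'D_v (fun _ : 'cV[R]_p => c) = fun=> 0 by apply/funext => x; exact: derive_cst.
exact: IH.
Qed.

Lemma CkOnD p (V : normedModType R) k (g h : 'cV[R]_p -> V) (U : set 'cV[R]_p) :
  open U -> CkOn k g U -> CkOn k h U -> CkOn k (fun x => g x + h x) U.
Proof.
move=> oU; elim: k g h => [|k IH] g h /=.
  by move=> gU hU x Ux; apply: continuousD; [exact: gU|exact: hU].
move=> [dg Hg] [dh Hh]; split=> [x Ux|v].
  by apply: differentiableD; [exact: dg|exact: dh].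
apply: CkOn_eq (IH _ _ (Hg v) (Hh v)) => // x Ux.
by rewrite deriveD//; apply: diff_derivable; [exact: dg|exact: dh].
Qed.

Lemma CkOn_sum p (V : normedModType R) k q (g : 'I_q -> 'cV[R]_p -> V) (U : set 'cV[R]_p) :
  open U -> (forall i, CkOn k (g i) U) -> CkOn k (fun x => \sum_i g i x) U.
Proof.
move=> oU; elim: q g => [|q IH] g H.
  by rewrite (_ : (fun x => _) = fun=> 0);
    [exact: CkOn_cst|apply/funext => x; rewrite big_ord0].
rewrite (_ : (fun x => _) = fun x => (\sum_i g (widen_ord (leqnSn q) i) x) + g ord_max x).
  by apply: CkOnD => //; exact: IH.
by apply/funext => x; rewrite big_ord_recr.
Qed.

Lemma diffZ_fun p (V : normedModType R) (a : 'cV[R]_p -> R) (g : 'cV[R]_p -> V) (x : 'cV[R]_p) :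
  differentiable a x -> differentiable g x ->
  differentiable (fun y => a y *: g y) x /\
  forall v, 'D_v (fun y => a y *: g y) x = 'D_v a x *: g x + a x *: 'D_v g x.
Proof.
move=> da dg; apply: diff_cV.
  move=> c u v /=; rewrite (diff_linear da) (diff_linear dg).
  rewrite !scalerDl !scalerDr !scalerA addrACA.
  by congr (_ + _ + _); rewrite mulrC.
have cg := differentiable_continuous dg.
have [Ca Ca0 HCa] := cV_linear_bound (diff_linear da).
have [Cg Cg0 HCg] := cV_linear_bound (diff_linear dg).
move=> e e0.
(* [M] dominates [|g x| + 1], [|a x|] and [Ca], the factors of the three remainder terms below; each
   of these then costs at most [e / 4]. *)
pose M := 1 + `|a x| + `|g x| + Ca + Cg.
have M0 : 0 < M by rewrite /M; have := normr_ge0 (a x); have := normr_ge0 (g x); lra.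
pose e1 := e / (4 * M); have e10 : 0 < e1 by rewrite divr_gt0// mulr_gt0.
have [d1 d10 Hd1] := diff_eps da e10.
have [d2 d20 Hd2] := diff_eps dg e10.
have [d3 d30 Hd3] := (continuous_atP _ _).1 cg (Num.min 1 e1) ltac:(by rewrite lt_min ltr01).
exists (Num.min d1 (Num.min d2 d3)) => [|h]; first by rewrite !lt_min d10 d20.
rewrite !lt_min => /and3P[h1 h2 h3].
have H1 := Hd1 _ h1; have H2 := Hd2 _ h2.
have := Hd3 (x + h); rewrite addrAC subrr add0r => /(_ h3).
rewrite lt_min => /andP[H3 H4].
have -> : a (x + h) *: g (x + h) - a x *: g x - ('D_h a x *: g x + a x *: 'D_h g x)
   = (a (x + h) - a x - 'D_h a x) *: g (x + h) + a x *: (g (x + h) - g x - 'D_h g x)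
     + 'D_h a x *: (g (x + h) - g x).
  rewrite !scalerBl !scalerBr !opprD.
  set A := a (x + h) *: _; set B := a x *: g (x + h); set C := a x *: g x.
  set D := 'D_h a x *: g (x + h); set E := 'D_h a x *: g x; set F := a x *: _.
  rewrite -[A - B - D + _ + _]addrA [B - C - F + _]addrAC.
  rewrite -!addrA; congr (_ + _).
  rewrite [RHS]addrC -!addrA; rewrite [- D + _]addrC.
  rewrite !addrA.
  by rewrite [RHS](ACl ((1*6)*(3*7)*2*4*5)%AC)/= !subrr !add0r.
have gxh : `|g (x + h)| <= `|g x| + 1.
  have -> : g (x + h) = g x + (g (x + h) - g x) by rewrite [RHS]addrC subrK.
  by apply: le_trans (ler_normD _ _) _; rewrite lerD2l ltW.
apply: le_trans (ler_normD _ _) _.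
apply: le_trans (lerD (ler_normD _ _) (lexx _)) _; rewrite !normrZ.
have eM : e1 * M = e / 4 by rewrite /e1; field; lra.
have T1 : `|a (x + h) - a x - 'D_h a x| * `|g (x + h)| <= e / 4 * `|h|.
  apply: le_trans (ler_pM _ _ H1 gxh) _ => //.
  rewrite -eM mulrAC ler_wpM2r// ler_wpM2l ?(ltW e10)//.
  by rewrite /M; have := normr_ge0 (a x); lra.
have T2 : `|a x| * `|g (x + h) - g x - 'D_h g x| <= e / 4 * `|h|.
  apply: le_trans (ler_wpM2l (normr_ge0 _) H2) _.
  rewrite -eM mulrCA mulrA ler_wpM2r// ler_wpM2l ?(ltW e10)//.
  by rewrite /M; have := normr_ge0 (g x); lra.
have T3 : `|'D_h a x| * `|g (x + h) - g x| <= e / 4 * `|h|.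
  apply: le_trans (ler_pM _ _ (HCa h) (ltW H4)) _ => //.
  rewrite mulrAC -eM [e1 * M]mulrC ler_wpM2r// ler_wpM2r ?(ltW e10)//.
  by rewrite /M; have := normr_ge0 (a x); have := normr_ge0 (g x); lra.
have := normr_ge0 h; nra.
Qed.

Lemma CkOnZ p (V : normedModType R) k (a : 'cV[R]_p -> R) (g : 'cV[R]_p -> V) (U : set 'cV[R]_p) :
  open U -> CkOn k a U -> CkOn k g U -> CkOn k (fun x => a x *: g x) U.
Proof.
move=> oU; elim: k a g => [|k IH] a g.
  by move=> aU gU x Ux; apply: continuousZ; [exact: aU|exact: gU].
move=> aU gU; have [da Ha] := aU; have [dg Hg] := gU; split=> [x Ux|v].
  by have [] := diffZ_fun (da x Ux) (dg x Ux).
have H1 := IH _ _ (Ha v) (CkOn_pred gU); have H2 := IH _ _ (CkOn_pred aU) (Hg v).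
apply: CkOn_eq (CkOnD oU H1 H2) => // x Ux.
by have [_ ->] := diffZ_fun (da x Ux) (dg x Ux).
Qed.

Lemma diff_coord p q (g : 'cV[R]_p -> 'cV[R]_q) (x : 'cV[R]_p) i :
  differentiable g x ->
  differentiable (fun y => g y i 0) x /\
  forall v, 'D_v (fun y => g y i 0) x = ('D_v g x) i 0.
Proof.
move=> dg; apply: diff_cV; first by move=> c u v; rewrite (diff_linear dg) !mxE.
move=> e e0; have [d d0 Hd] := diff_eps dg e0; exists d => // h /Hd.
by apply: le_trans; apply: le_trans (mx_coord_le _ i 0); rewrite !mxE.
Qed.

Lemma CkOn_coord p q k (g : 'cV[R]_p -> 'cV[R]_q) (U : set 'cV[R]_p) i :
  open U -> CkOn k g U -> CkOn k (fun x => g x i 0) U.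
Proof.
move=> oU; elim: k g => [|k IH] g.
  move=> gU x Ux; apply/continuous_atP => e e0.
  have [d d0 Hd] := (continuous_atP _ _).1 (gU x Ux) e e0.
  exists d => // h /Hd; apply: le_lt_trans.
  by apply: le_trans (mx_coord_le _ i 0); rewrite !mxE.
move=> [dg Hg]; split=> [x Ux|v]; first by have [] := diff_coord i (dg x Ux).
apply: CkOn_eq (IH _ (Hg v)) => // x Ux.
by have [_ ->] := diff_coord i (dg x Ux).
Qed.

Lemma CkOn_coords p q k (g : 'cV[R]_p -> 'cV[R]_q) (U : set 'cV[R]_p) :
  open U -> (forall i, CkOn k (fun x => g x i 0) U) -> CkOn k g U.
Proof.
move=> oU H.
rewrite (_ : g = fun x => \sum_i g x i 0 *: delta_mx i 0).
  by apply: CkOn_sum => // i; apply: CkOnZ => //; exact: CkOn_cst.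
by apply/funext => x; exact: cV_delta_sum.
Qed.

Lemma diff_comp_affine p q (V : normedModType R) (g : 'cV[R]_q -> V)
    (M : 'M[R]_(q, p)) b (x : 'cV[R]_p) :
  differentiable g (M *m x + b) ->
  differentiable (fun y => g (M *m y + b)) x /\
  forall v, 'D_v (fun y => g (M *m y + b)) x = 'D_(M *m v) g (M *m x + b).
Proof.
move=> dg; apply: diff_cV.
  by move=> c u v; rewrite mulmxDr -scalemxAr (diff_linear dg).
move=> e e0; pose C := 1 + p%:R * `|M|.
have C0 : 0 < C by rewrite ltr_wpDr// mulr_ge0.
have [d d0 Hd] := diff_eps dg (divr_gt0 e0 C0).
have MC (h : 'cV[R]_p) : `|M *m h| <= C * `|h|.
  apply: le_trans (norm_mulmx _ _) _; rewrite ler_wpM2r//; rewrite /C; lra.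
exists (d / C) => [|h]; first exact: divr_gt0.
rewrite ltr_pdivlMr// mulrC => hd.
have -> : M *m (x + h) + b = M *m x + b + M *m h by rewrite mulmxDr addrAC.
apply: le_trans (Hd (M *m h) (le_lt_trans (MC h) hd)) _.
by rewrite -mulrA ler_wpM2l ?(ltW e0)// ler_pdivrMl.
Qed.

Lemma CkOn_comp_affine p q (V : normedModType R) k (g : 'cV[R]_q -> V)
    (M : 'M[R]_(q, p)) b (U : set 'cV[R]_q) (U' : set 'cV[R]_p) :
  open U' -> (forall x, U' x -> U (M *m x + b)) ->
  CkOn k g U -> CkOn k (fun x => g (M *m x + b)) U'.
Proof.
move=> oU UU; elim: k g => [|k IH] g.
  move=> gU x Ux; apply/continuous_atP => e e0.
  have [d d0 Hd] := (continuous_atP _ _).1 (gU _ (UU _ Ux)) e e0.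
  pose C := 1 + p%:R * `|M|.
  have C0 : 0 < C by rewrite ltr_wpDr// mulr_ge0.
  have MC (h : 'cV[R]_p) : `|M *m h| <= C * `|h|.
    by apply: le_trans (norm_mulmx _ _) _; rewrite ler_wpM2r//; rewrite /C; lra.
  exists (d / C) => [|h]; first exact: divr_gt0.
  rewrite ltr_pdivlMr// mulrC => hd; apply: Hd.
  rewrite opprD addrACA subrr addr0 -mulmxBr.
  exact: le_lt_trans (MC _) hd.
move=> [dg Hg]; split=> [x Ux|v].
  by have [] := diff_comp_affine (dg _ (UU _ Ux)).
apply: CkOn_eq (IH _ (Hg (M *m v))) => // x Ux.
by have [_ ->] := diff_comp_affine (dg _ (UU _ Ux)).
Qed.

Lemma CkOn_lin p k (M : 'M[R]_(1, p)) (U : set 'cV[R]_p) :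
  open U -> CkOn k (fun x : 'cV[R]_p => (M *m x) 0 0) U.
Proof.
move=> oU; case: k => [|k].
  move=> x _; apply/continuous_atP => e e0.
  pose C := 1 + p%:R * `|M|.
  have C0 : 0 < C by rewrite ltr_wpDr// mulr_ge0.
  exists (e / C) => [|h]; first exact: divr_gt0.
  rewrite ltr_pdivlMr// mulrC => hd.
  apply: le_lt_trans hd; apply: (@le_trans _ _ `|M *m (h - x)|).
    by apply: le_trans (mx_coord_le _ 0 0); rewrite mulmxBr !mxE.
  by apply: le_trans (norm_mulmx _ _) _; rewrite ler_wpM2r//; rewrite /C; lra.
have H x : differentiable (fun x : 'cV[R]_p => (M *m x) 0 0) x /\
   forall v, 'D_v (fun x : 'cV[R]_p => (M *m x) 0 0) x = (M *m v) 0 0.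
  apply: diff_cV.
    by move=> c u v; rewrite mulmxDr -scalemxAr 2!mxE.
  move=> e e0; exists 1 => // h _; rewrite mulmxDr mxE -addrA -opprD subrr normr0.
  by rewrite mulr_ge0// ltW.
split=> [x _|v]; first by have [] := H x.
have -> : 'D_v (fun x : 'cV[R]_p => (M *m x) 0 0) = fun=> (M *m v) 0 0.
  by apply/funext => x; have [_ ->] := H x.
exact: CkOn_cst.
Qed.

Lemma CkOn_proj p k (i : 'I_p) (U : set 'cV[R]_p) :
  open U -> CkOn k (fun x : 'cV[R]_p => x i 0) U.
Proof.
move=> oU; rewrite (_ : (fun x => _) = fun x : 'cV_p => ((delta_mx 0 i : 'M[R]_(1, p)) *m x) 0 0).
  exact: CkOn_lin.
by apply/funext => x; rewrite -rowE mxE.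
Qed.

End CkCalculus.

(** * Matrix-valued functions and the matrix exponential *)

Section RealCalculus.
Context {R : realType}.

Lemma derive_nonincr (f df : R -> R) (a b : R) : a <= b -> continuous f ->
  (forall x, a < x < b -> is_derive x 1 f (df x)) ->
  (forall x, a < x < b -> df x <= 0) -> f b <= f a.
Proof.
rewrite le_eqVlt => /predU1P[->//|ab] cf Df df0.
have D x : x \in `]a, b[ -> is_derive x 1 f (df x) by rewrite in_itv/=; exact: Df.
have wf : {within `[a, b], continuous f} by exact: continuous_subspaceT.
have [c cab E] := MVT ab D wf.
rewrite -subr_le0 E mulr_le0_ge0// ?subr_ge0 ?(ltW ab)//.
by apply: df0; rewrite in_itv/= in cab.
Qed.

Lemma derive_le_diff (f df g dg : R -> R) (a b : R) : a <= b ->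
  continuous f -> continuous g ->
  (forall x, a < x < b -> is_derive x 1 f (df x)) ->
  (forall x, a < x < b -> is_derive x 1 g (dg x)) ->
  (forall x, a < x < b -> `|df x| <= dg x) -> `|f b - f a| <= g b - g a.
Proof.
move=> ab cf cg Df Dg dfg.
have H1 : (f \- g) b <= (f \- g) a.
  apply: (@derive_nonincr _ (fun x => df x - dg x)) => //.
  - by move=> x; apply: continuousB; [exact: cf|exact: cg].
  - by move=> x xab; apply: is_deriveB; [exact: Df|exact: Dg].
  - by move=> x /dfg; rewrite ler_norml => /andP[]; lra.
have H2 : (- f \- g) b <= (- f \- g) a.
  apply: (@derive_nonincr _ (fun x => - df x - dg x)) => //.
  - by move=> x; apply: continuousB; [apply: continuousN; exact: cf|exact: cg].
  - by move=> x xab; apply: is_deriveB; [apply: is_deriveN; exact: Df|exact: Dg].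
  - by move=> x /dfg; rewrite ler_norml => /andP[]; lra.
by move: H1 H2 => /=; rewrite !fctE ler_norml => H1 H2; apply/andP; split; lra.
Qed.

Lemma derive0_cst (f : R -> R) (a b : R) : a <= b -> continuous f ->
  (forall x, a < x < b -> is_derive x 1 f 0) -> f b = f a.
Proof.
move=> ab cf Df; apply/eqP; rewrite -subr_eq0 -normr_le0.
have := @derive_le_diff f (cst 0) (cst 0) (cst 0) a b ab cf.
rewrite /cst subrr; apply => //.
  by move=> x; exact: cst_continuous.
by move=> x _; rewrite normr0.
Qed.

(** Integrating from [-1] makes the primitive differentiable, hence continuous, at time 0, where
    trajectories start. *)
Lemma primitive_exists (h : R -> R) : continuous h ->
  exists H : R -> R, forall t : R, - 1 < t -> is_derive t 1 H (h t).
Proof.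
move=> ch; exists (fun x => \int[lebesgue_measure]_(t in `[(- 1 : R)%R, x]) h t)%R => t t1.
have ih : lebesgue_measure.-integrable `[- 1, t + 1] (EFin \o h).
  apply: continuous_compact_integrable; first exact: segment_compact.
  exact: continuous_subspaceT.
have tt : t < t + 1 by rewrite ltrDl.
have [D E] := continuous_FTC1_closed tt ih t1 (ch t).
by split=> //; rewrite -derive1E.
Qed.

End RealCalculus.

Section MatrixFunctions.
Context {R : realType}.

(** Taken entry by entry, so that products of matrices of any shapes are differentiated by the
    scalar product rule. *)
Definition dmx m n (M : R -> 'M[R]_(m, n)) (M' : 'M[R]_(m, n)) (t : R) :=
  forall i j, is_derive t 1 (fun s => M s i j) (M' i j).

Lemma dmx_eq m n (M : R -> 'M[R]_(m, n)) M' N' (t : R) :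
  dmx M M' t -> M' = N' -> dmx M N' t.
Proof. by move=> ? <-. Qed.

Lemma dmx_cst m n (M : 'M[R]_(m, n)) t : dmx (fun=> M) 0 t.
Proof. by move=> i j; rewrite mxE; exact: is_derive_cst. Qed.

Lemma dmxD m n (M N : R -> 'M[R]_(m, n)) M' N' (t : R) :
  dmx M M' t -> dmx N N' t -> dmx (fun s => M s + N s) (M' + N') t.
Proof.
move=> dM dN i j; rewrite mxE.
rewrite (_ : (fun s => _) = (fun s => M s i j) + (fun s => N s i j)).
  by apply: is_deriveD; [exact: dM|exact: dN].
by apply/funext => s; rewrite mxE.
Qed.

Lemma dmxN m n (M : R -> 'M[R]_(m, n)) M' (t : R) :
  dmx M M' t -> dmx (fun s => - M s) (- M') t.
Proof.
move=> dM i j; rewrite mxE.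
rewrite (_ : (fun s => _) = - (fun s => M s i j)); first exact: is_deriveN.
by apply/funext => s; rewrite mxE.
Qed.

Lemma dmxB m n (M N : R -> 'M[R]_(m, n)) M' N' (t : R) :
  dmx M M' t -> dmx N N' t -> dmx (fun s => M s - N s) (M' - N') t.
Proof. by move=> dM dN; apply: dmxD => //; exact: dmxN. Qed.

Lemma is_derive_sumf k (h : 'I_k -> R -> R) (dh : 'I_k -> R) (t : R) :
  (forall i, is_derive t 1 (h i) (dh i)) ->
  is_derive t 1 (fun s => \sum_i h i s) (\sum_i dh i).
Proof.
move=> H; rewrite (_ : (fun s => _) = \sum_i h i); first exact: is_derive_sum.
by apply/funext => s; rewrite fct_sumE.
Qed.

Lemma is_derive_mulf (g h : R -> R) dg dh (t : R) :
  is_derive t 1 g dg -> is_derive t 1 h dh ->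
  is_derive t 1 (fun s => g s * h s) (dg * h t + g t * dh).
Proof.
move=> Dg Dh; rewrite (_ : (fun s => _) = g * h)//.
by apply: is_derive_eq (is_deriveM _ _) _; rewrite /GRing.scale/=; ring.
Qed.

Lemma dmxM m n p (M : R -> 'M[R]_(m, n)) (N : R -> 'M[R]_(n, p)) M' N' (t : R) :
  dmx M M' t -> dmx N N' t -> dmx (fun s => M s *m N s) (M' *m N t + M t *m N') t.
Proof.
move=> dM dN i j; rewrite !mxE -big_split/=.
rewrite (_ : (fun s => _) = fun s => \sum_k M s i k * N s k j).
  by apply: is_derive_sumf => k; exact: is_derive_mulf.
by apply/funext => s; rewrite mxE.
Qed.

Lemma dmxMl m n p (M : 'M[R]_(m, n)) (N : R -> 'M[R]_(n, p)) N' (t : R) :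
  dmx N N' t -> dmx (fun s => M *m N s) (M *m N') t.
Proof.
move=> dN; apply: dmx_eq (dmxM (dmx_cst M t) dN) _.
by rewrite mul0mx add0r.
Qed.

Lemma dmxMr m n p (M : R -> 'M[R]_(m, n)) (N : 'M[R]_(n, p)) M' (t : R) :
  dmx M M' t -> dmx (fun s => M s *m N) (M' *m N) t.
Proof.
move=> dM; apply: dmx_eq (dmxM dM (dmx_cst N t)) _.
by rewrite mulmx0 addr0.
Qed.

Lemma dmx_tr m n (M : R -> 'M[R]_(m, n)) M' (t : R) :
  dmx M M' t -> dmx (fun s => (M s)^T) M'^T t.
Proof.
move=> dM i j; rewrite mxE (_ : (fun s => _) = fun s => M s j i)//.
by apply/funext => s; rewrite mxE.
Qed.

Lemma dmx_col m n p (M : R -> 'M[R]_(m, p)) (N : R -> 'M[R]_(n, p)) M' N' (t : R) :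
  dmx M M' t -> dmx N N' t -> dmx (fun s => col_mx (M s) (N s)) (col_mx M' N') t.
Proof.
move=> dM dN i j; rewrite mxE; case: split_ordP => k ->.
  rewrite (_ : (fun s => _) = fun s => M s k j)//.
  by apply/funext => s; rewrite col_mxEu.
rewrite (_ : (fun s => _) = fun s => N s k j)//.
by apply/funext => s; rewrite col_mxEd.
Qed.

(** Functions truncated at time 0 are differentiated at positive times by passing to the untruncated
    formula. *)
Lemma dmx_near m n (M N : R -> 'M[R]_(m, n)) M' (t a : R) :
  a < t -> (forall s : R, a < s -> M s = N s) -> dmx M M' t -> dmx N M' t.
Proof.
move=> at0 MN dM i j; apply: near_eq_is_derive (dM i j).
by near=> s; rewrite MN//; near: s; exact: lt_nbhsr.
Unshelve. all: by end_near. Qed.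

Lemma dmx_comp_opp m n (M : R -> 'M[R]_(m, n)) M' (t : R) :
  dmx M M' (- t) -> dmx (fun s => M (- s)) (- M') t.
Proof.
move=> dM i j; rewrite mxE -mulN1r.
apply: is_derive_eq; last by rewrite mulrC.
have D := dM i j.
have := @is_derive1_comp _ (fun s => M s i j) (-%R) t (M' i j) (-1) D.
by apply; exact: is_deriveNid.
Qed.

Lemma dmx_comp_shift m n (M : R -> 'M[R]_(m, n)) M' (t a : R) :
  dmx M M' (t + a) -> dmx (fun s => M (s + a)) M' t.
Proof.
move=> dM i j; have D := dM i j.
have H : is_derive t 1 (fun s : R => s + a) 1.
  by apply: is_derive_eq (is_deriveD _ _) _; rewrite addr0.
have := @is_derive1_comp _ (fun s => M s i j) (fun s => s + a) t (M' i j) 1 D H.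
by rewrite mulr1.
Qed.

Definition cmx m n (M : R -> 'M[R]_(m, n)) :=
  forall i j, continuous (fun s => M s i j).

Lemma dmx_cmx m n (M : R -> 'M[R]_(m, n)) M' :
  (forall t, dmx M (M' t) t) -> cmx M.
Proof.
move=> H i j t; have [D _] := H t i j.
by apply: differentiable_continuous; apply/derivable1_diffP.
Qed.

Lemma cmx_cst m n (M : 'M[R]_(m, n)) : cmx (fun=> M).
Proof. by move=> i j; exact: cst_continuous. Qed.

Lemma cmxD m n (M N : R -> 'M[R]_(m, n)) :
  cmx M -> cmx N -> cmx (fun s => M s + N s).
Proof.
move=> cM cN i j t.
rewrite (_ : (fun s => _) = (fun s => M s i j) \+ (fun s => N s i j)).
  by apply: continuousD; [exact: cM|exact: cN].
by apply/funext => s; rewrite mxE.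
Qed.

Lemma cmxN m n (M : R -> 'M[R]_(m, n)) : cmx M -> cmx (fun s => - M s).
Proof.
move=> cM i j t.
rewrite (_ : (fun s => _) = - (fun s => M s i j)).
  by apply: continuousN; exact: cM.
by apply/funext => s; rewrite mxE.
Qed.

Lemma cmxB m n (M N : R -> 'M[R]_(m, n)) :
  cmx M -> cmx N -> cmx (fun s => M s - N s).
Proof. by move=> cM cN; apply: cmxD => //; exact: cmxN. Qed.

Lemma cvg_sumf (T : Type) (F : set_system T) (FF : Filter F) k
    (h : 'I_k -> T -> R) (l : 'I_k -> R) :
  (forall i, h i x @[x --> F] --> l i) ->
  \sum_i h i x @[x --> F] --> \sum_i l i.
Proof.
elim: k h l => [|k IH] h l H.
  rewrite big_ord0 (_ : (fun x => _) = fun=> 0); first exact: cvg_cst.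
  by apply/funext => x; rewrite big_ord0.
rewrite big_ord_recr (_ : (fun x => _) = fun x =>
  (\sum_i h (widen_ord (leqnSn k) i) x) + h ord_max x).
  by apply: cvgD => //; apply: (IH (fun i => h (widen_ord (leqnSn k) i))).
by apply/funext => x; rewrite big_ord_recr.
Qed.

Lemma continuous_sumf k (h : 'I_k -> R -> R) :
  (forall i, continuous (h i)) -> continuous (fun s => \sum_i h i s).
Proof. by move=> H t; apply: cvg_sumf => i; exact: H. Qed.

Lemma cmxM m n p (M : R -> 'M[R]_(m, n)) (N : R -> 'M[R]_(n, p)) :
  cmx M -> cmx N -> cmx (fun s => M s *m N s).
Proof.
move=> cM cN i j.
rewrite (_ : (fun s => _) = fun s => \sum_k M s i k * N s k j).
  by apply: continuous_sumf => k t; apply: continuousM; [exact: cM|exact: cN].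
by apply/funext => s; rewrite mxE.
Qed.

Lemma cmx_tr m n (M : R -> 'M[R]_(m, n)) : cmx M -> cmx (fun s => (M s)^T).
Proof.
move=> cM i j; rewrite (_ : (fun s => _) = fun s => M s j i)//.
by apply/funext => s; rewrite mxE.
Qed.

Lemma cmx_col m n p (M : R -> 'M[R]_(m, p)) (N : R -> 'M[R]_(n, p)) :
  cmx M -> cmx N -> cmx (fun s => col_mx (M s) (N s)).
Proof.
move=> cM cN i j; case: (split_ordP i) => k ->.
  rewrite (_ : (fun s => _) = fun s => M s k j)//.
  by apply/funext => s; rewrite col_mxEu.
rewrite (_ : (fun s => _) = fun s => N s k j)//.
by apply/funext => s; rewrite col_mxEd.
Qed.

Lemma cmx_usub m n p (M : R -> 'M[R]_(m + n, p)) : cmx M -> cmx (fun s => usubmx (M s)).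
Proof.
move=> cM i j; rewrite (_ : (fun s => _) = fun s => M s (lshift n i) j)//.
by apply/funext => s; rewrite mxE.
Qed.

Lemma cmx_dsub m n p (M : R -> 'M[R]_(m + n, p)) : cmx M -> cmx (fun s => dsubmx (M s)).
Proof.
move=> cM i j; rewrite (_ : (fun s => _) = fun s => M s (rshift m i) j)//.
by apply/funext => s; rewrite mxE.
Qed.

Lemma cmx_comp m n (M : R -> 'M[R]_(m, n)) (g : R -> R) :
  continuous g -> cmx M -> cmx (fun s => M (g s)).
Proof.
by move=> cg cM i j t; apply: (@continuous_comp _ _ _ g (fun s => M s i j)); [exact: cg|exact: cM].
Qed.

Lemma primitive_mx n (h : R -> 'cV[R]_n) : cmx h ->
  exists H : R -> 'cV[R]_n, forall t : R, - 1 < t -> dmx H (h t) t.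
Proof.
move=> ch; pose P i := cid (primitive_exists (ch i 0)).
exists (fun t => \col_i (projT1 (P i)) t) => t t1 i j.
rewrite (ord1 j) (_ : (fun s => _) = projT1 (P i)); first exact: projT2 (P i) t t1.
by apply/funext => s; rewrite mxE.
Qed.

End MatrixFunctions.

Section MatrixExponential.
Context {R : realType}.
Variables (n : nat) (A : 'M[R]_n).

Let mp k := iter k (mulmx A) (1%:M : 'M[R]_n).

Let mpSr k : mp k.+1 = mp k *m A.
Proof.
elim: k => [|k IH]; first by rewrite /mp/= mulmx1 mul1mx.
by rewrite -[LHS]/(A *m mp k.+1) [in LHS]IH mulmxA.
Qed.

Let a := n%:R * `|A|.

Let mp_bound k i j : `|mp k i j| <= a ^+ k.
Proof.
apply: le_trans (mx_coord_le _ _ _) _; elim: k => [|k IH].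
  apply: mx_norm_le => // i' j'; rewrite expr0 mxE.
  by case: (_ == _); rewrite ?mulr1n ?mulr0n ?normr1 ?normr0.
rewrite -[mp _]/(A *m mp k) exprS; apply: le_trans (norm_mulmx _ _) _.
by rewrite ler_wpM2l// mulr_ge0.
Qed.

Let cvg_coeff (x : nat -> R) (C K : R) : (forall k, `|x k| <= C * a ^+ k) ->
  cvgn (pseries (fun k => x k / k`!%:R) K).
Proof.
move=> xC; have C0 : 0 <= C by have := xC 0%N; rewrite expr0 mulr1; exact: le_trans.
have a0 : 0 <= a by rewrite mulr_ge0.
apply: normed_cvg.
apply: (@series_le_cvg _ _ (fun k => C * exp_coeff (a * `|K|) k)) => [k|k|k|].
- exact: normr_ge0.
- by rewrite mulr_ge0// exp_coeff_ge0// mulr_ge0.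
- rewrite /= /exp_coeff/= normrM normrM normfV normrX (@ger0_norm _ k`!%:R)//.
  by rewrite exprMn mulrAC [leRHS]mulrA ler_wpM2r ?invr_ge0// mulrA ler_wpM2r// exprn_ge0.
rewrite (_ : series _ = C *: series (exp_coeff (a * `|K|))).
  by apply: is_cvgZl_tmp; exact: is_cvg_series_exp_coeff.
by apply/funext => k; rewrite /series/= fctE/= -mulr_sumr.
Qed.

Let diffsE (x : nat -> R) :
  pseries_diffs (fun k => x k / k`!%:R) = fun k => x k.+1 / k`!%:R.
Proof.
apply/funext => k; rewrite /pseries_diffs factS natrM invfM mulrCA [X in _ * X]mulrA.
by rewrite mulfV ?mul1r// pnatr_eq0.
Qed.

Definition mexp (t : R) : 'M[R]_n :=
  \matrix_(i, j) limn (pseries (fun k => mp k i j / k`!%:R) t).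

Let mexp_cvg i j t : pseries (fun k => mp k i j / k`!%:R) t @ \oo --> mexp t i j.
Proof. by rewrite mxE; apply: (@cvg_coeff _ 1) => k; rewrite mul1r. Qed.

Let mexp_deriv i j (t : R) : is_derive t 1 (fun s => mexp s i j)
  (limn (pseries (fun k => mp k.+1 i j / k`!%:R) t)).
Proof.
rewrite (_ : (fun s => _) = fun s => limn (pseries (fun k => mp k i j / k`!%:R) s)); last first.
  by apply/funext => s; rewrite mxE.
rewrite -(diffsE (fun k => mp k i j)).
(* Termwise differentiation requires the twice differentiated series to converge at a point beyond
   [t]; its coefficients satisfy the same bound up to a factor [a * a]. *)
apply: (@pseries_snd_diffs _ _ (`|t| + 1)).
- by apply: (@cvg_coeff _ 1) => k; rewrite mul1r.
- by rewrite diffsE; apply: (@cvg_coeff _ a) => k; rewrite -exprS.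
- by rewrite diffsE diffsE; apply: (@cvg_coeff _ (a * a)) => k; rewrite -mulrA -!exprS.
- by rewrite [ltRHS]ger0_norm// ltrDl.
Qed.

Lemma dmx_mexp (t : R) : dmx mexp (A *m mexp t) t.
Proof.
move=> i j; apply: is_derive_eq (mexp_deriv i j t) _; apply/cvg_lim => //.
rewrite mxE (_ : pseries _ t =
  fun N => \sum_l A i l * pseries (fun k => mp k l j / k`!%:R) t N).
  by apply: cvg_sumf => l; apply: cvgMl_tmp; exact: mexp_cvg.
apply/funext => N; rewrite /pseries/series/=.
under [RHS]eq_bigr do rewrite mulr_sumr.
rewrite exchange_big/=; apply: eq_bigr => k _.
by rewrite mxE !mulr_suml; apply: eq_bigr => l _; rewrite !mulrA.
Qed.

(** A power of [A] can be split with [A] on either side, so the differentiated series sums both to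
    [A *m mexp t] and to [mexp t *m A]. *)
Lemma mexp_comm t : A *m mexp t = mexp t *m A.
Proof.
apply/matrixP => i j; have D := dmx_mexp t i j.
have -> : (A *m mexp t) i j = limn (pseries (fun k => mp k.+1 i j / k`!%:R) t).
  have [_ <-] := D; by have [_ ->] := mexp_deriv i j t.
apply/cvg_lim => //.
rewrite mxE (_ : pseries _ t =
  fun N => \sum_l pseries (fun k => mp k i l / k`!%:R) t N * A l j).
  by apply: cvg_sumf => l; apply: cvgMr_tmp; exact: mexp_cvg.
apply/funext => N; rewrite /pseries/series/=.
under [RHS]eq_bigr do rewrite mulr_suml.
rewrite exchange_big/=; apply: eq_bigr => k _.
rewrite (_ : A *m mp k = mp k *m A) ?mxE; last exact: mpSr.
rewrite !mulr_suml; apply: eq_bigr => l _.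
by ring.
Qed.

Lemma mexp0 : mexp 0 = 1%:M.
Proof.
apply/matrixP => i j; rewrite [LHS]mxE; apply: lim_near_cst => //.
near=> N; rewrite /pseries/series/= -[N]prednK; last by near: N; exists 1%N.
rewrite big_nat_recl//= big1 ?addr0 => [|k _]; last by rewrite exprS mul0r mulr0.
by rewrite expr0 mulr1 fact0 divr1.
Unshelve. all: by end_near. Qed.

Lemma cmx_mexp : cmx mexp.
Proof. exact: dmx_cmx dmx_mexp. Qed.

Lemma dmx_mexpN (t : R) : dmx (fun s => mexp (- s)) (- (A *m mexp (- t))) t.
Proof. by apply: dmx_comp_opp; exact: dmx_mexp. Qed.

Lemma dmx0_cst m p (M : R -> 'M[R]_(m, p)) (a' b : R) :
  a' <= b -> cmx M -> (forall t : R, a' < t < b -> dmx M 0 t) -> M b = M a'.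
Proof.
move=> ab cM DM; apply/matrixP => i j; apply: (@derive0_cst _ (fun s => M s i j)) => //.
by move=> x /DM /(_ i j); rewrite mxE.
Qed.

(** For fixed [t] the left side has zero derivative in [s], because [A] commutes with its
    exponential. Inverses and the addition law are both read off from this identity. *)
Lemma mexpDN s t : mexp (s + t) *m mexp (- s) = mexp t.
Proof.
pose F r := mexp (r + t) *m mexp (- r).
have DF r : dmx F 0 r.
  apply: dmx_eq (dmxM (dmx_comp_shift (dmx_mexp _)) (dmx_mexpN r)) _.
  by rewrite mulmxN mulmxA mexp_comm subrr.
have F0 : F 0 = mexp t by rewrite /F oppr0 add0r mexp0 mulmx1.
have cF := dmx_cmx DF.
rewrite -F0 -/(F s); case: (leP 0 s) => s0; first exact: dmx0_cst.
by apply/esym/dmx0_cst => //; exact: ltW.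
Qed.

Lemma mexpN s : mexp s *m mexp (- s) = 1%:M.
Proof. by rewrite -[in mexp s](addr0 s) mexpDN mexp0. Qed.

Lemma mexpD s t : mexp (s + t) = mexp t *m mexp s.
Proof.
rewrite -(mexpDN s t) -mulmxA.
by have := mexpN (- s); rewrite opprK => ->; rewrite mulmx1.
Qed.

End MatrixExponential.

(** * Stability and Lyapunov equations *)

Section DotProduct.
Context {R : realType}.
Implicit Types n : nat.

Definition dotv n (u v : 'cV[R]_n) : R := (u^T *m v) 0 0.

Lemma dotvE n (u v : 'cV[R]_n) : dotv u v = \sum_i u i 0 * v i 0.
Proof. by rewrite /dotv mxE; apply: eq_bigr => i _; rewrite mxE. Qed.

Lemma dotvC n (u v : 'cV[R]_n) : dotv u v = dotv v u.
Proof. by rewrite !dotvE; apply: eq_bigr => i _; rewrite mulrC. Qed.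

Lemma dotvDr n (u v w : 'cV[R]_n) : dotv u (v + w) = dotv u v + dotv u w.
Proof. by rewrite /dotv mulmxDr mxE. Qed.

Lemma dotvDl n (u v w : 'cV[R]_n) : dotv (v + w) u = dotv v u + dotv w u.
Proof. by rewrite !(dotvC _ u) dotvDr. Qed.

Lemma dotvNr n (u v : 'cV[R]_n) : dotv u (- v) = - dotv u v.
Proof. by rewrite /dotv mulmxN mxE. Qed.

Lemma dotvNl n (u v : 'cV[R]_n) : dotv (- v) u = - dotv v u.
Proof. by rewrite !(dotvC _ u) dotvNr. Qed.

Lemma dotvZr n (u v : 'cV[R]_n) a : dotv u (a *: v) = a * dotv u v.
Proof. by rewrite /dotv -scalemxAr mxE. Qed.

Lemma dotvZl n (u v : 'cV[R]_n) a : dotv (a *: v) u = a * dotv v u.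
Proof. by rewrite !(dotvC _ u) dotvZr. Qed.

Lemma dotv0r n (u : 'cV[R]_n) : dotv u 0 = 0.
Proof. by rewrite /dotv mulmx0 mxE. Qed.

Lemma dotv0l n (u : 'cV[R]_n) : dotv 0 u = 0.
Proof. by rewrite dotvC dotv0r. Qed.

Lemma dotv_mull m n (A : 'M[R]_(m, n)) u v : dotv (A *m u) v = dotv u (A^T *m v).
Proof. by rewrite /dotv trmx_mul mulmxA. Qed.

Definition dotvL := (dotvDl, dotvDr, dotvNl, dotvNr, dotvZl, dotvZr).

Lemma dotv_sqnorm n (u : 'cV[R]_n) : dotv u u = sqnorm u.
Proof. by rewrite dotvE; apply: eq_bigr => i _; rewrite expr2. Qed.

Lemma sqnorm_ge0 n (u : 'cV[R]_n) : 0 <= sqnorm u.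
Proof. by apply: sumr_ge0 => i _; rewrite sqr_ge0. Qed.

Lemma sqcoord_le n (u : 'cV[R]_n) i : (u i 0) ^+ 2 <= sqnorm u.
Proof. by rewrite /sqnorm (bigD1 i)//= lerDl sumr_ge0// => j _; rewrite sqr_ge0. Qed.

Lemma norm_sqnorm n (u : 'cV[R]_n) : `|u| ^+ 2 <= sqnorm u.
Proof.
rewrite -(sqr_sqrtr (sqnorm_ge0 u)) ler_sqr ?nnegrE ?sqrtr_ge0//.
apply: cV_norm_le => [|i]; first exact: sqrtr_ge0.
by rewrite -sqrtr_sqr ler_wsqrtr// sqcoord_le.
Qed.

Lemma sqnorm_norm n (u : 'cV[R]_n) : sqnorm u <= n%:R * `|u| ^+ 2.
Proof.
rewrite -[n in n%:R]card_ord mulr_natl -sumr_const; apply: ler_sum => i _.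
by rewrite -real_normK ?num_real// lerXn2r ?nnegrE// mx_coord_le.
Qed.

Lemma dotv_norm n (u v : 'cV[R]_n) : `|dotv u v| <= n%:R * `|u| * `|v|.
Proof.
apply: le_trans (mx_coord_le (u^T *m v) 0 0) _.
apply: le_trans (norm_mulmx _ _) _; rewrite ler_wpM2r// ler_wpM2l//.
by apply: mx_norm_le => // i j; rewrite mxE mx_coord_le.
Qed.

Lemma quad_bound n (P : 'M[R]_n) :
  exists2 c, 0 < c & forall x, `|dotv x (P *m x)| <= c * sqnorm x.
Proof.
exists (1 + n%:R * (n%:R * `|P|)); first by rewrite ltr_wpDr// !mulr_ge0.
move=> x; apply: le_trans (dotv_norm _ _) _.
apply: le_trans (ler_wpM2l _ (norm_mulmx P x)) _; first by rewrite mulr_ge0.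
have -> : n%:R * `|x| * (n%:R * `|P| * `|x|) = n%:R * (n%:R * `|P|) * `|x| ^+ 2 by ring.
apply: ler_pM; rewrite ?mulr_ge0 ?sqr_ge0 ?norm_sqnorm//; lra.
Qed.

Lemma exp_small (C k e : R) : 0 < k -> 0 < e ->
  exists2 t, 0 <= t & C * expR (- (k * t)) < e.
Proof.
move=> k0 e0; exists (`|C| / (e * k)); first by rewrite divr_ge0// mulr_ge0// ltW.
apply: le_lt_trans (_ : `|C| * expR (- (k * (`|C| / (e * k)))) < _).
  by rewrite ler_wpM2r ?expR_ge0// ler_norm.
have -> : k * (`|C| / (e * k)) = `|C| / e by field; rewrite !gt_eqF.
have E0 := expR_gt0 (`|C| / e); rewrite expRN ltr_pdivrMr// mulrC -ltr_pdivrMr//.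
by apply: lt_le_trans (expR_ge1Dx _); rewrite ltrDr.
Qed.

(** The passage to infinite time: an argument on [[0, t]] leaves an exponentially small boundary
    term, and this lemma discards it. *)
Lemma ge0_exp (a C k : R) : 0 < k ->
  (forall t, 0 <= t -> - (C * expR (- (k * t))) <= a) -> 0 <= a.
Proof.
move=> k0 H; rewrite leNgt; apply/negP => a0.
have [|t t0 Ht] := @exp_small C k (- a) k0; first by rewrite oppr_gt0.
by have := H t t0; rewrite leNgt; rewrite ltrNr Ht.
Qed.

End DotProduct.

Section Hurwitz.
Context {R : realType}.
Implicit Types n : nat.

Definition psd n (P : 'M[R]_n) := P^T = P /\ forall x, 0 <= dotv x (P *m x).

(* Lyapunov's characterisation of stability, which avoids complex eigenvalues. *)
Definition hurwitz n (A : 'M[R]_n) :=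
  exists2 P, psd P & forall x, dotv x (P *m (A *m x)) <= - sqnorm x.

Definition decays n (A : 'M[R]_n) M w :=
  forall t : R, 0 <= t -> `|mexp A t| <= M * expR (- (w * t)).

Lemma is_derive_dotv n (u v : R -> 'cV[R]_n) u' v' (t : R) :
  dmx u u' t -> dmx v v' t ->
  is_derive t 1 (fun s => dotv (u s) (v s)) (dotv u' (v t) + dotv (u t) v').
Proof.
move=> du dv; apply: is_derive_eq (dmxM (dmx_tr du) dv 0 0) _.
by rewrite mxE.
Qed.

Lemma is_derive_expl (k t : R) : is_derive t 1 (fun s => expR (k * s)) (k * expR (k * t)).
Proof.
have H : is_derive t 1 (fun s : R => k * s) k.
  by apply: is_derive_eq (is_derive_mulf (is_derive_cst k t 1) (is_derive_id t 1)) _; rewrite mul0r add0r mulr1.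
apply: is_derive_eq (is_derive1_comp (is_derive_expR (k * t)) H) _.
by rewrite mulrC.
Qed.

Lemma continuous_derive (f df : R -> R) :
  (forall t : R, is_derive t 1 f (df t)) -> continuous f.
Proof.
move=> H t; have [D _] := H t.
by apply: differentiable_continuous; apply/derivable1_diffP.
Qed.

(** Along the flow the quadratic form [N] of [P] satisfies [N' <= - 2 N / c], where [c] bounds the
    form from above; a lower bound of the form transfers the decay to the norm. *)
Lemma hurwitz_decays n (A : 'M[R]_n) : hurwitz A ->
  exists M w, [/\ 0 < M, 0 < w & decays A M w].
Proof.
move=> [P [Ps P0] PA].
have [c c0 Hc] := quad_bound P.
(* [P] is given only as semidefinite. Definiteness comes from expanding the form at [x + s A x] with
   [s = 1 / d]: the cross term is at most [- 2 s |x|^2] and the last term at most [s |x|^2], so the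
   form at [x] is at least [s |x|^2]. *)
have [c' c'0 Hc'] : exists2 c', 0 < c' & forall x, sqnorm x <= c' * dotv x (P *m x).
  have [d d0 Hd] := quad_bound (A^T *m P *m A).
  exists d => // x; have s0 : 0 < d^-1 by rewrite invr_gt0.
  have := P0 (x + d^-1 *: (A *m x)); have := PA x; have := Hd x.
  rewrite ler_norml => /andP[_] H1 H2.
  rewrite mulmxDr -scalemxAr !dotvL.
  have -> : dotv (A *m x) (P *m x) = dotv x (P *m (A *m x)).
    by rewrite [LHS]dotvC dotv_mull Ps.
  have -> : dotv (A *m x) (P *m (A *m x)) = dotv x (A^T *m P *m A *m x).
    by rewrite dotv_mull !mulmxA.
  set q := dotv x (P *m x); set r := dotv x _; set s := dotv x _ in H1 *.
  rewrite mulrA -expr2 => H3.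
  have H4 : d^-1 ^+ 2 * s <= d^-1 * sqnorm x.
    by rewrite expr2 -mulrA ler_wpM2l ?(ltW s0)// ler_pdivrMl.
  have H5 : d^-1 * r <= d^-1 * - sqnorm x by rewrite ler_wpM2l// ltW.
  rewrite -ler_pdivrMl//; lra.
(* The squared norm decays with constant [c' * c]; [1 + c' * c] dominates its square root and is
   positive. *)
exists (1 + c' * c), c^-1; split; rewrite ?invr_gt0//.
  by rewrite addr_gt0// mulr_gt0.
have key (x : 'cV[R]_n) (t : R) : 0 <= t ->
    sqnorm (mexp A t *m x) <= c' * c * sqnorm x * expR (- (c^-1 * t)) ^+ 2.
  move=> t0; pose y (s : R) := mexp A s *m x.
  have dy s : dmx y (A *m y s) s.
    by apply: dmx_eq (dmxMr x (dmx_mexp A s)) _; rewrite mulmxA.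
  pose N s := dotv (y s) (P *m y s).
  pose N' s := dotv (A *m y s) (P *m y s) + dotv (y s) (P *m (A *m y s)).
  have dN (s : R) : is_derive s 1 N (N' s).
    by apply: is_derive_dotv; [exact: dy|apply: dmxMl; exact: dy].
  have N'le s : N' s <= - (2 * c^-1 * N s).
    rewrite /N' [X in X + _]dotvC dotv_mull Ps.
    have := PA (y s); have := Hc (y s); rewrite ler_norml => /andP[_] H1 H2.
    have : c^-1 * N s <= sqnorm (y s) by rewrite ler_pdivrMl.
    lra.
  have dG (s : R) : is_derive s 1 (fun s => expR (2 * c^-1 * s) * N s)
     (2 * c^-1 * expR (2 * c^-1 * s) * N s + expR (2 * c^-1 * s) * N' s).
    exact: (is_derive_mulf (is_derive_expl _ _) (dN s)).
  have := derive_nonincr t0 (continuous_derive dG) (fun s _ => dG s).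
  rewrite mulr0 expR0 mul1r => H.
  have {}H : expR (2 * c^-1 * t) * N t <= N 0.
    apply: H => s _; have := N'le s; have := expR_gt0 (2 * c^-1 * s).
    by set e := expR _ => e0 H; have := ler_wpM2l (ltW e0) H; lra.
  have NT : N t <= N 0 * expR (- (c^-1 * t)) ^+ 2.
    rewrite expRN exprVn -expRM_natl mulrA ler_pdivlMr ?expR_gt0//.
    by rewrite mulrC.
  have N0 : N 0 <= c * sqnorm x.
    by rewrite /N /y mexp0 mul1mx; have := Hc x; rewrite ler_norml => /andP[].
  apply: le_trans (Hc' _) _; rewrite -!mulrA ler_wpM2l ?(ltW c'0)//.
  by apply: le_trans NT _; rewrite [leRHS]mulrA ler_wpM2r// sqr_ge0.
move=> t t0; have E0 := expR_gt0 (- (c^-1 * t)).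
have K0 : 0 <= c' * c by rewrite mulr_ge0// ltW.
apply: mx_norm_le => [|i j]; first by rewrite mulr_ge0 ?(ltW E0)//; lra.
rewrite -(@ler_pXn2r _ 2)// ?nnegrE//; last by rewrite mulr_ge0 ?(ltW E0)//; lra.
rewrite real_normK ?num_real//.
have := key (delta_mx j 0) t t0.
rewrite -colE => H; apply: le_trans (_ : sqnorm (col j (mexp A t)) <= _).
  by have := sqcoord_le (col j (mexp A t)) i; rewrite [col _ _ _ _]mxE.
apply: le_trans H _; rewrite [leRHS]exprMn ler_wpM2r ?sqr_ge0//.
have -> : sqnorm (delta_mx j 0 : 'cV[R]_n) = 1.
  rewrite /sqnorm (bigD1 j)//= mxE !eqxx/= expr1n big1 ?addr0// => l lj.
  by rewrite mxE (negPf lj) expr0n.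
nra.
Qed.

Lemma mulmx_normx m n p (A : 'M[R]_(m, n)) (B : 'M[R]_(n, p)) a b :
  `|A| <= a -> `|B| <= b -> `|A *m B| <= n%:R * a * b.
Proof.
move=> Aa Bb; apply: le_trans (norm_mulmx _ _) _.
by rewrite ler_pM ?mulr_ge0// ler_wpM2l.
Qed.

Lemma trmx_norm m n (A : 'M[R]_(m, n)) : `|A^T| = `|A|.
Proof.
by apply/le_anti/andP; split; apply: mx_norm_le => // i j;
  [rewrite mxE mx_coord_le|have := mx_coord_le A^T j i; rewrite mxE].
Qed.

Lemma quad_flow_bound n (A X : 'M[R]_n) M w : 0 < w -> decays A M w ->
  forall t : R, 0 <= t ->
  `|(mexp A t)^T *m X *m mexp A t| <=
  n%:R * (n%:R * M * `|X|) * M * expR (- (w * t)).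
Proof.
move=> w0 AM t t0; have E := AM t t0; have e0 := expR_gt0 (- (w * t)).
have e1 : expR (- (w * t)) <= 1 by rewrite expR_le1 oppr_le0 mulr_ge0// ltW.
have M0 : 0 <= M by rewrite -(pmulr_lge0 _ e0); exact: le_trans E.
rewrite -mulrA; apply: mulmx_normx => //; rewrite -mulrA.
rewrite mulrA; apply: mulmx_normx => //; rewrite trmx_norm.
by apply: le_trans E _; rewrite ler_piMr.
Qed.

Lemma dmx_quad_flow n (A X : 'M[R]_n) (t : R) :
  dmx (fun s => (mexp A s)^T *m X *m mexp A s)
      ((mexp A t)^T *m (A^T *m X + X *m A) *m mexp A t) t.
Proof.
apply: dmx_eq (dmxM (dmxMr X (dmx_tr (dmx_mexp A t))) (dmx_mexp A t)) _.
by rewrite trmx_mul mulmxDr mulmxDl !mulmxA.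
Qed.

(** Conjugating [X] by the flow gives a constant function when [X] solves the homogeneous equation,
    and this function tends to 0. *)
Lemma lyap_inj n (A X : 'M[R]_n) : hurwitz A -> A^T *m X + X *m A = 0 -> X = 0.
Proof.
move=> /hurwitz_decays[M [w [M0 w0 AM]]] XA.
pose F s := (mexp A s)^T *m X *m mexp A s.
have dF s : dmx F 0 s.
  by apply: dmx_eq (dmx_quad_flow A X s) _; rewrite XA mulmx0 mul0mx.
have F0 : F 0 = X by rewrite /F mexp0 trmx1 mul1mx mulmx1.
suff : 0 <= - `|X| by rewrite oppr_ge0 normr_le0 => /eqP.
apply: (@ge0_exp _ _ (n%:R * (n%:R * M * `|X|) * M) w) => // t t0.
rewrite lerN2 -{1}F0 -(dmx0_cst t0 (dmx_cmx dF) (fun s _ => dF s)).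
exact: quad_flow_bound.
Qed.

(** The conjugate of [X] by the flow now decreases as a quadratic form and still tends to 0, so it
    starts from a nonnegative value. *)
Lemma lyap_pos n (A X : 'M[R]_n) : hurwitz A ->
  (forall x, dotv x ((A^T *m X + X *m A) *m x) <= 0) ->
  forall x, 0 <= dotv x (X *m x).
Proof.
move=> /hurwitz_decays[M [w [M0 w0 AM]]] XA x.
pose F s := (mexp A s)^T *m X *m mexp A s.
have dF s : dmx (fun s => F s *m x) ((mexp A s)^T *m (A^T *m X + X *m A) *m mexp A s *m x) s.
  by apply: dmxMr; exact: dmx_quad_flow.
have dq s := is_derive_dotv (dmx_cst x s) (dF s).
have F0 : F 0 = X by rewrite /F mexp0 trmx1 mul1mx mulmx1.
apply: (@ge0_exp _ _ (n%:R * `|x| * (n%:R * (n%:R * (n%:R * M * `|X|) * M) * `|x|)) w) => // t t0.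
apply: (@le_trans _ _ (dotv x (F t *m x))).
  rewrite lerNl; apply: le_trans (_ : `|dotv x (F t *m x)| <= _).
    by rewrite -normrN ler_norm.
  apply: le_trans (dotv_norm _ _) _; rewrite -!mulrA !ler_wpM2l//.
  apply: le_trans (norm_mulmx _ _) _.
  rewrite -!mulrA ler_wpM2l// !mulrA [leRHS]mulrAC ler_wpM2r//.
  by have := quad_flow_bound X w0 AM t0; rewrite !mulrA.
rewrite -[in leRHS]F0.
apply: derive_nonincr t0 (continuous_derive dq) (fun s _ => dq s) _ => s _.
rewrite dotv0l add0r -!mulmxA -{1}[x]mul1mx.
have := XA (mexp A s *m x); rewrite dotv_mull mul1mx.
by rewrite !mulmxA.
Qed.

(** An injective endomorphism of the finite-dimensional space of matrices is onto; injectivity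
    applied to [X^T - X] then gives symmetry. *)
Lemma lyap_solve n (A Q : 'M[R]_n) : hurwitz A -> Q^T = Q ->
  exists2 X, X^T = X & A^T *m X + X *m A = - Q.
Proof.
move=> hA Qs; pose L X := A^T *m X + X *m A.
have Llin : linear L.
  by move=> a u v; rewrite /L mulmxDr mulmxDl -scalemxAr -scalemxAl scalerDr addrACA.
pose LL := HB.pack_for {linear 'M[R]_n -> 'M[R]_n} L (GRing.isLinear.Build _ _ _ _ _ Llin).
pose f := linfun LL : 'End('M[R]_n).
have fE X : f X = L X by rewrite lfunE.
have kf : lker f == 0%VS.
  apply/lker0P => u v; rewrite !fE => /eqP; rewrite -subr_eq0 => /eqP E.
  apply/eqP; rewrite -subr_eq0; apply/eqP; apply: (lyap_inj hA).
  by rewrite -E /L mulmxBr mulmxBl opprD addrACA.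
pose X := (f^-1%VF : 'End('M[R]_n)) (- Q).
have EX : A^T *m X + X *m A = - Q.
  by rewrite -[LHS]/(L X) -fE /X lker0_lfunVK.
exists X => //; apply/eqP; rewrite -subr_eq0; apply/eqP; apply: (lyap_inj hA).
rewrite mulmxBr mulmxBl addrACA -opprD EX.
have := congr1 trmx EX; rewrite linearD/= !trmx_mul trmxK linearN/= Qs.
by move=> E; rewrite [X in X - _ = _]addrC E subrr.
Qed.

End Hurwitz.

(** * The algebraic Riccati equation *)

Section MatrixSequences.
Context {R : realType}.

Definition mxcvg p q (M : nat -> 'M[R]_(p, q)) (L : 'M[R]_(p, q)) :=
  forall i j, (fun k => M k i j) @ \oo --> L i j.

Lemma mxcvg_cst p q (M : 'M[R]_(p, q)) : mxcvg (fun=> M) M.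
Proof. by move=> i j; exact: cvg_cst. Qed.

Lemma mxcvgD p q (M N : nat -> 'M[R]_(p, q)) L K :
  mxcvg M L -> mxcvg N K -> mxcvg (fun k => M k + N k) (L + K).
Proof.
move=> ML NK i j; rewrite mxE (_ : (fun k => _) = fun k => M k i j + N k i j).
  by apply: cvgD; [exact: ML|exact: NK].
by apply/funext => k; rewrite mxE.
Qed.

Lemma mxcvgN p q (M : nat -> 'M[R]_(p, q)) L :
  mxcvg M L -> mxcvg (fun k => - M k) (- L).
Proof.
move=> ML i j; rewrite mxE (_ : (fun k => _) = fun k => - M k i j).
  by apply: cvgN; exact: ML.
by apply/funext => k; rewrite mxE.
Qed.

Lemma mxcvgM p q r (M : nat -> 'M[R]_(p, q)) (N : nat -> 'M[R]_(q, r)) L K :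
  mxcvg M L -> mxcvg N K -> mxcvg (fun k => M k *m N k) (L *m K).
Proof.
move=> ML NK i j; rewrite mxE (_ : (fun k => _) = fun k => \sum_l M k i l * N k l j).
  by apply: cvg_sumf => l; apply: cvgM; [exact: ML|exact: NK].
by apply/funext => k; rewrite mxE.
Qed.

Lemma mxcvg_unique p q (M : nat -> 'M[R]_(p, q)) L K :
  mxcvg M L -> mxcvg M K -> L = K.
Proof. by move=> ML MK; apply/matrixP => i j; apply: cvg_unique (ML i j) (MK i j). Qed.

End MatrixSequences.

Section Riccati.
Context {R : realType}.
Variables (n m : nat) (A : 'M[R]_n) (B : 'M[R]_(n, m)) (beta : R).
Hypothesis beta0 : 0 < beta.

Definition ctrlS : 'M[R]_n := beta^-1 *: (B *m B^T).

Lemma ctrlS_sym : ctrlS^T = ctrlS.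
Proof. by rewrite /ctrlS linearZ/= trmx_mul trmxK. Qed.

Lemma ctrlS_quad x : dotv x (ctrlS *m x) = beta^-1 * sqnorm (B^T *m x).
Proof. by rewrite /ctrlS -scalemxAl dotvZr -dotv_sqnorm [in RHS]dotv_mull trmxK mulmxA. Qed.

Lemma ctrlS_pos x : 0 <= dotv x (ctrlS *m x).
Proof. by rewrite ctrlS_quad mulr_ge0 ?sqnorm_ge0// invr_ge0 ltW. Qed.

Let S := ctrlS.

Definition ric P : 'M[R]_n := A^T *m P + P *m A - P *m S *m P + 1%:M.

(** The invariant of the iteration: the sign of the Riccati residual is what makes the closed loop
    [A - S P] stable. *)
Definition subric P := psd P /\ forall x, dotv x (ric P *m x) <= 0.

Lemma quad_sym (M : 'M[R]_n) x : dotv x (M *m x) = dotv x (M^T *m x).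
Proof. by rewrite dotvC dotv_mull. Qed.

(** [2 P] is the Lyapunov certificate: the form of [2 P (A - S P)] is that of the residual minus
    [|x|^2] minus the nonnegative form of [P S P]. *)
Lemma subric_hurwitz P : subric P -> hurwitz (A - S *m P).
Proof.
move=> [[Ps P0] PR]; exists (2 *: P).
  by split=> [|x]; rewrite ?linearZ/= ?Ps// -scalemxAl dotvZr mulr_ge0.
move=> x; rewrite -scalemxAl dotvZr mulmxBl mulmxBr !dotvL !mulmxA.
have := PR x; rewrite /ric !mulmxDl mulNmx mul1mx !dotvL dotv_sqnorm.
have -> : dotv x (A^T *m P *m x) = dotv x (P *m A *m x).
  by rewrite quad_sym trmx_mul trmxK Ps.
have := ctrlS_pos (P *m x); rewrite dotv_mull Ps !mulmxA; lra.
Qed.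

(** [P] is the cost matrix of the feedback [F], with weight [1 + beta F^T F]. Completing the square,
    its residual is [- beta |F x + B^T P x / beta|^2]. *)
Lemma kleinman_start F : hurwitz (A + B *m F) -> exists P, subric P.
Proof.
move=> hF; have Qs : (1%:M + beta *: (F^T *m F))^T = 1%:M + beta *: (F^T *m F).
  by rewrite linearD linearZ/= trmx1 trmx_mul trmxK.
have [P Ps EP] := lyap_solve hF Qs.
exists P; split; first split=> //.
  apply: (lyap_pos hF) => x; rewrite EP mulNmx mulmxDl mul1mx -scalemxAl !dotvL.
  rewrite -mulmxA -[F^T *m (F *m x)]mul1mx dotv_sqnorm mul1mx -dotv_mull dotv_sqnorm.
  by have := sqnorm_ge0 x; have := mulr_ge0 (ltW beta0) (sqnorm_ge0 (F *m x)); lra.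
move=> x; have := congr1 (fun M => dotv x (M *m x)) EP => /=.
rewrite linearD/= trmx_mul /ric !(mulmxDl, mulmxDr) !mulNmx !mul1mx !dotvL !mulmxA.
have E1 : dotv x (F^T *m B^T *m P *m x) = dotv x (P *m B *m F *m x).
  by rewrite quad_sym !trmx_mul !trmxK Ps mulmxA.
have E2 : dotv x (P *m S *m P *m x) = beta^-1 * dotv x (P *m B *m B^T *m P *m x).
  by rewrite /S /ctrlS -scalemxAr -!scalemxAl dotvZr !mulmxA.
have := sqnorm_ge0 (F *m x + beta^-1 *: (B^T *m P *m x)).
rewrite -dotv_sqnorm !dotvL.
have E3 : dotv (F *m x) (B^T *m P *m x) = dotv x (P *m B *m F *m x).
  by rewrite dotv_mull !mulmxA E1.
have E4 : dotv (B^T *m P *m x) (F *m x) = dotv x (P *m B *m F *m x) by rewrite dotvC.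
have E5 : dotv (B^T *m P *m x) (B^T *m P *m x) = dotv x (P *m B *m B^T *m P *m x).
  by rewrite dotv_mull trmx_mul trmxK Ps !mulmxA.
rewrite E1 E2 E3 E4 E5 mulmxDl mul1mx -scalemxAl !dotvL dotv_mull !mulmxA.
set f := dotv x (F^T *m F *m x); set g := dotv x (P *m B *m F *m x).
set h := dotv x (P *m B *m B^T *m P *m x).
move=> H1 H2.
have : beta * f + 2 * g + beta^-1 * h = beta * (f + beta^-1 * g + (beta^-1 * g + beta^-1 * (beta^-1 * h))).
  by field; rewrite gt_eqF.
have := mulr_ge0 (ltW beta0) H1; lra.
Qed.

(* Newton's method for the Riccati equation: each step solves a Lyapunov equation. *)
Lemma kleinman_step P : subric P -> exists P', [/\ subric P',
  forall x, dotv x (P' *m x) <= dotv x (P *m x) &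
  A^T *m P' + P' *m A - P *m S *m P' - P' *m S *m P + P *m S *m P + 1%:M = 0].
Proof.
move=> sP; have hP := subric_hurwitz sP; have [[Ps P0] PR] := sP.
have Qs : (1%:M + P *m S *m P)^T = 1%:M + P *m S *m P.
  by rewrite linearD/= trmx1 !trmx_mul Ps ctrlS_sym mulmxA.
have [P' P's EP] := lyap_solve hP Qs.
have AT : (A - S *m P)^T = A^T - P *m S by rewrite linearB/= trmx_mul Ps ctrlS_sym.
rewrite AT mulmxBl mulmxBr !mulmxA in EP.
have EX x := congr1 (fun M => dotv x (M *m x)) EP.
have XE x : dotv x (P *m S *m P' *m x) = dotv x (P' *m S *m P *m x).
  by rewrite quad_sym !trmx_mul Ps P's ctrlS_sym mulmxA.
exists P'; split; last 2 first.
- move=> x; suff : 0 <= dotv x ((P - P') *m x) by rewrite mulmxBl !dotvL; lra.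
  apply: (lyap_pos hP) => {}x.
  have := PR x; have := EX x; rewrite /ric AT.
  rewrite !(mulmxDl, mulmxDr, mulNmx, mulmxN, opprD) !mul1mx !dotvL !mulmxA; lra.
- apply/eqP; rewrite -addrA addr_eq0 [P *m S *m P + _]addrC -EP.
  by rewrite addrACA addrA.
split; first split=> //.
  apply: (lyap_pos hP) => x; rewrite AT mulmxBl mulmxBr !mulmxA EP.
  rewrite mulNmx mulmxDl mul1mx !dotvL dotv_sqnorm.
  have := ctrlS_pos (P *m x); rewrite dotv_mull Ps !mulmxA.
  by have := sqnorm_ge0 x; lra.
(* The new residual is [- (P - P') S (P - P')]: for a quadratic equation Newton's method leaves
   exactly the second-order term. *)
move=> x; have := EX x; have := ctrlS_pos ((P - P') *m x); have := XE x.
rewrite /ric dotv_mull (_ : (P - P')^T = P - P'); last by rewrite linearB/= Ps P's.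
by rewrite !(mulmxDl, mulmxDr, mulNmx, mulmxN, opprD) !mul1mx !dotvL !mulmxA; lra.
Qed.

(** The Newton iterates decrease as quadratic forms and are bounded below by 0. The values of the
    forms therefore converge, polarization gives convergence of the entries, and the linear step
    equation becomes the Riccati equation in the limit. *)
Lemma riccati_exists F : hurwitz (A + B *m F) ->
  exists P, [/\ P^T = P, ric P = 0 & hurwitz (A - S *m P)].
Proof.
move=> /kleinman_start[P0 sP0].
pose T := {P | subric P}.
pose next (P : T) : T := exist _ _ (let: And3 h _ _ := projT2 (cid (kleinman_step (projT2 P))) in h).
have nextP (P : T) := projT2 (cid (kleinman_step (projT2 P))).
pose s := fix s k : T := if k is k'.+1 then next (s k') else exist _ P0 sP0.
pose Q k : 'M[R]_n := projT1 (s k).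
have sQ k : subric (Q k) by exact: projT2 (s k).
have Qle k x : dotv x (Q k.+1 *m x) <= dotv x (Q k *m x).
  by have [_ + _] := nextP (s k); apply.
have QE k : A^T *m Q k.+1 + Q k.+1 *m A - Q k *m S *m Q k.+1 - Q k.+1 *m S *m Q k
            + Q k *m S *m Q k + 1%:M = 0.
  by have [_ _] := nextP (s k).
have cvq x : cvgn (fun k => dotv x (Q k *m x)).
  apply: nonincreasing_is_cvgn.
    by apply/nonincreasing_seqP => k; exact: Qle.
  by exists 0 => _ [k _ <-]; have [[_ H] _] := sQ k; exact: H.
have Qpol k i j : Q k i j = 2^-1 * (dotv (delta_mx i 0 + delta_mx j 0) (Q k *m (delta_mx i 0 + delta_mx j 0))
   - dotv (delta_mx i 0) (Q k *m delta_mx i 0) - dotv (delta_mx j 0) (Q k *m delta_mx j 0)).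
  have [[Qs _] _] := sQ k.
  have E i' j' : dotv (delta_mx i' 0) (Q k *m delta_mx j' 0) = Q k i' j'.
    by rewrite -colE dotvE (bigD1 i')//= big1 ?addr0 => [|l li]; rewrite !mxE ?eqxx/= ?mul1r// (negPf li) mul0r.
  rewrite mulmxDr !dotvL !E -{4}Qs mxE; lra.
pose P : 'M[R]_n := \matrix_(i, j) limn (fun k => Q k i j).
have QP : mxcvg Q P.
  move=> i j; rewrite mxE.
  under eq_fun do rewrite Qpol.
  by apply: is_cvgMl_tmp; apply: is_cvgB; [apply: is_cvgB|]; exact: cvq.
have QP1 : mxcvg (fun k => Q k.+1) P.
  by move=> i j; have := QP i j; rewrite -(cvg_shiftS (fun k => Q k i j)).
have Ps : P^T = P.
  have QT : (fun k => (Q k)^T) = Q by apply/funext => k; have [[]] := sQ k.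
  apply: mxcvg_unique (QP); rewrite -[in X in mxcvg X]QT => i j.
  rewrite mxE (_ : (fun k => _) = fun k => Q k j i); first exact: QP.
  by apply/funext => k; rewrite mxE.
have R0 : ric P = 0.
  apply: (@mxcvg_unique _ _ _ (fun k => A^T *m Q k.+1 + Q k.+1 *m A - Q k *m S *m Q k.+1
    - Q k.+1 *m S *m Q k + Q k *m S *m Q k + 1%:M)); last first.
    by rewrite (_ : (fun k => _) = fun=> 0); [exact: mxcvg_cst|apply/funext => k; exact: QE].
  have -> : ric P = A^T *m P + P *m A - P *m S *m P - P *m S *m P + P *m S *m P + 1%:M.
    by rewrite /ric subrK.
  have cQS (u v : nat -> 'M[R]_n) : mxcvg u P -> mxcvg v P -> mxcvg (fun k => u k *m S *m v k) (P *m S *m P).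
    by move=> uP vP; apply: mxcvgM => //; apply: mxcvgM => //; exact: mxcvg_cst.
  apply: mxcvgD; last exact: mxcvg_cst.
  apply: mxcvgD; last exact: cQS.
  apply: mxcvgD; last by apply: mxcvgN; exact: cQS.
  apply: mxcvgD; last by apply: mxcvgN; exact: cQS.
  by apply: mxcvgD; apply: mxcvgM => //; exact: mxcvg_cst.
exists P; split=> //; apply: subric_hurwitz; split; last first.
  by move=> x; rewrite R0 mul0mx dotv0r.
split=> // x.
have H : (fun k => dotv x (Q k *m x)) @ \oo --> dotv x (P *m x).
  have H0 := mxcvgM (@mxcvg_cst _ _ _ x^T) (mxcvgM QP (@mxcvg_cst _ _ _ x)).
  by have := H0 0 0; rewrite /dotv.
rewrite -(cvg_lim _ H)//; apply: limr_ge; first exact: cvq.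
by near=> k; have [[_ qk] _] := sQ k; exact: qk.
Unshelve. all: by end_near. Qed.

End Riccati.

(** * From the spectral condition to a Lyapunov matrix *)

Section SpectralLyapunov.
Import complex.
Context {R : realType}.
Local Notation rc := (complex.real_complex R).
Local Notation C := (complex.complex R).

Lemma Re_sum I (r : seq I) (F : I -> C) :
  complex.Re (\sum_(i <- r) F i) = \sum_(i <- r) complex.Re (F i).
Proof.
elim: r => [|i r IH]; first by rewrite !big_nil.
by rewrite !big_cons -IH; case: (F i) => a b; case: (\sum_(_ <- _) _).
Qed.

Lemma Im_sum I (r : seq I) (F : I -> C) :
  complex.Im (\sum_(i <- r) F i) = \sum_(i <- r) complex.Im (F i).
Proof.
elim: r => [|i r IH]; first by rewrite !big_nil.
by rewrite !big_cons -IH; case: (F i) => a b; case: (\sum_(_ <- _) _).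
Qed.

Lemma ReM (x y : C) :
  complex.Re (x * y) = complex.Re x * complex.Re y - complex.Im x * complex.Im y.
Proof. by case: x => a b; case: y. Qed.

Lemma ImM (x y : C) :
  complex.Im (x * y) = complex.Re x * complex.Im y + complex.Im x * complex.Re y.
Proof. by case: x => a b; case: y. Qed.

(** Complex Schur triangularization [P E = T P] written in real and imaginary parts, [P = U + i V]
    and [T = Ta + i Tb], with [P] unitary. The diagonal of [T] consists of eigenvalues of [E],
    whence the last clause. *)
Lemma real_schur n (E : 'M[R]_n) : exp_stable E ->
  exists U V Ta Tb : 'M[R]_n,
  [/\ U^T *m U + V^T *m V = 1%:M, U *m E = Ta *m U - Tb *m V,
      V *m E = Ta *m V + Tb *m U,
      forall i j : 'I_n, (i < j)%N -> Ta i j = 0 /\ Tb i j = 0 &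
      forall i, Ta i i < 0].
Proof.
move=> hE; pose Ec : 'M[C]_n := map_mx rc E.
have [] := @cotrigonalization _ n [:: Ec].
  by move=> X Y; rewrite !inE => /eqP-> /eqP->.
move=> P Pu /= /andP[trig _].
have Pun := unitarymx_unit Pu.
set T := conjmx P Ec in trig.
have PT : P *m Ec = T *m P by apply/(similarP Pun); rewrite /similar_to/= eqxx.
pose U : 'M[R]_n := map_mx (@complex.Re R) P.
pose V : 'M[R]_n := map_mx (@complex.Im R) P.
pose Ta : 'M[R]_n := map_mx (@complex.Re R) T.
pose Tb : 'M[R]_n := map_mx (@complex.Im R) T.
exists U, V, Ta, Tb; split.
- have /matrixP PP : (P^t*)%sesqui *m P = 1%:M by rewrite -invmx_unitary// mulVmx.
  apply/matrixP => i j; have /(congr1 (@complex.Re R)) := PP i j.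
  rewrite !mxE Re_sum -big_split/= => H.
  have -> : ((i == j)%:R : R) = complex.Re ((i == j)%:R : C) by case: (i == j).
  rewrite -H; apply: eq_bigr => k _; rewrite !mxE ReM.
  by case: (P k i) => a b; case: (P k j) => c d /=; ring.
- apply/matrixP => i j; have /matrixP/(_ i j)/(congr1 (@complex.Re R)) := PT.
  rewrite !mxE !Re_sum => H.
  rewrite -sumrB; transitivity (\sum_k complex.Re (P i k * Ec k j)).
    by apply: eq_bigr => k _; rewrite !mxE ReM/= mulr0 subr0.
  by rewrite H; apply: eq_bigr => k _; rewrite !mxE ReM.
- apply/matrixP => i j; have /matrixP/(_ i j)/(congr1 (@complex.Im R)) := PT.
  rewrite !mxE !Im_sum => H.
  rewrite -big_split/=; transitivity (\sum_k complex.Im (P i k * Ec k j)).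
    by apply: eq_bigr => k _; rewrite !mxE ImM/= mulr0 add0r.
  by rewrite H; apply: eq_bigr => k _; rewrite !mxE ImM.
- move=> i j ij; have T0 : T i j = 0 by have /is_trig_mxP := trig; apply.
  by rewrite [Ta _ _]mxE [Tb _ _]mxE T0.
- move=> i; rewrite [Ta _ _]mxE; apply: hE; rewrite map_char_poly -/Ec.
  have : root (char_poly T) (T i i).
    by rewrite char_poly_trig// (bigD1 i)//= rootM root_XsubC eqxx.
  rewrite -!eigenvalue_root_char => /eigenvalueP[v vT v0].
  apply/eigenvalueP; exists (v *m P).
    by rewrite -mulmxA PT mulmxA vT scalemxAl.
  by apply: contra_neq v0 => vP; rewrite -[v](mulmxK Pun) vP mul0mx.
Qed.

Lemma sqr_sum_le n (g : 'I_n -> R) : (\sum_i g i) ^+ 2 <= n%:R * \sum_i g i ^+ 2.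
Proof.
rewrite expr2 mulr_suml.
have H i j : g i * g j <= 2^-1 * (g i ^+ 2 + g j ^+ 2).
  by have := sqr_ge0 (g i - g j); rewrite !expr2; lra.
apply: le_trans (_ : \sum_i \sum_j 2^-1 * (g i ^+ 2 + g j ^+ 2) <= _).
  by apply: ler_sum => i _; rewrite mulr_sumr; apply: ler_sum => j _.
have -> : \sum_i \sum_j 2^-1 * (g i ^+ 2 + g j ^+ 2)
    = 2^-1 * (\sum_i \sum_(j < n) g i ^+ 2 + \sum_(i < n) \sum_j g j ^+ 2).
  rewrite -big_split mulr_sumr; apply: eq_bigr => i _.
  by rewrite -big_split mulr_sumr.
rewrite [\sum_i \sum_(j < n) g i ^+ 2]exchange_big/= !sumr_const card_ord -mulr_natl.
by set z := \sum_i _; lra.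
Qed.

(* In a triangular basis rescaled by the powers of a small [s], the off-diagonal part is negligible
   against the negative diagonal. *)
Lemma exp_stable_hurwitz n (E : 'M[R]_n) : exp_stable E -> hurwitz E.
Proof.
move=> /real_schur[U [V [Ta [Tb [UV UE VE trig diag]]]]].
have [w w0 Hw] : exists2 w, 0 < w & forall i, Ta i i <= - w.
  exists (\big[Num.min/1]_i (- Ta i i)).
    by apply: (big_ind (fun x : R => 0 < x)) => // [x y x0 y0|i _]; rewrite ?lt_min ?x0// oppr_gt0.
  by move=> i; rewrite lerNr; exact: bigmin_le.
pose tau := 1 + `|Ta| + `|Tb|.
have tau0 : 0 < tau by rewrite /tau; have := normr_ge0 Ta; have := normr_ge0 Tb; lra.
(* Off-diagonal entries will contribute at most [2 * s * tau * n.+1%:R] times the weighted form, and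
   this choice of [s] makes that at most half of the rate [w]. *)
pose s := Num.min 1 (w / (4 * n.+1%:R * tau)).
have nt0 : 0 < 4 * n.+1%:R * tau by rewrite !mulr_gt0.
have s0 : 0 < s by rewrite lt_min ltr01 divr_gt0.
have s1 : s <= 1 by rewrite ge_min lexx.
have sw : s * (4 * n.+1%:R * tau) <= w by rewrite -ler_pdivlMr// ge_min lexx orbT.
pose D : 'M[R]_n := diag_mx (\row_i (s ^+ i) ^+ 2).
pose P0 := U^T *m D *m U + V^T *m D *m V.
have DE (u v : 'cV[R]_n) : dotv u (D *m v) = \sum_(i < n) (s ^+ i) ^+ 2 * (u i 0 * v i 0).
  by rewrite dotvE; apply: eq_bigr => i _; rewrite mul_diag_mx !mxE; ring.
have P0E x y : dotv x (P0 *m y) =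
   \sum_(i < n) (s ^+ i) ^+ 2 * ((U *m x) i 0 * (U *m y) i 0 + (V *m x) i 0 * (V *m y) i 0).
  rewrite /P0 mulmxDl dotvDr -!mulmxA -!dotv_mull !DE -big_split/=.
  by apply: eq_bigr => i _; rewrite -mulrDr.
have xE x : sqnorm x = \sum_(i < n) ((U *m x) i 0 ^+ 2 + (V *m x) i 0 ^+ 2).
  rewrite big_split/= -[X in X + _]/(sqnorm _) -[X in _ + X]/(sqnorm _).
  rewrite -!dotv_sqnorm !dotv_mull -dotvDr !mulmxA -mulmxDl.
  by rewrite UV mul1mx.
have main x : dotv x (P0 *m (E *m x)) <= - (w / 2) * dotv x (P0 *m x).
  rewrite !P0E !mulmxA UE VE mulmxDl mulNmx mulmxDl -!mulmxA.
  move: (U *m x) (V *m x) => a b.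
  pose g (i : 'I_n) := s ^+ i * (`|a i 0| + `|b i 0|).
  have s_ge0 k : 0 <= s ^+ k by rewrite exprn_ge0// ltW.
  have g0 i : 0 <= g i by rewrite /g mulr_ge0// addr_ge0.
  have sg0 i j : 0 <= s * tau * (g i * g j).
    by rewrite !mulr_ge0 ?(ltW s0) ?(ltW tau0).
  apply: (@le_trans _ _ (\sum_(i < n) ((s ^+ i) ^+ 2 * (- w * (a i 0 ^+ 2 + b i 0 ^+ 2))
     + \sum_(j < n) s * tau * (g i * g j)))).
    apply: ler_sum => i _; rewrite !mxE -!sumrN -!big_split/= !mulr_sumr -big_split/= mulr_sumr.
    pose h (j : 'I_n) := (s ^+ i) ^+ 2 * (a i 0 * (Ta i j * a j 0 - Tb i j * b j 0)
       + b i 0 * (Ta i j * b j 0 + Tb i j * a j 0)).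
    rewrite (_ : \sum_(j < n) _ = \sum_(j < n) h j); last by apply: eq_bigr => j _; rewrite /h; ring.
    rewrite (bigD1 i)//= [X in _ <= _ + X](bigD1 i)//= addrA; apply: lerD; last first.
      apply: ler_sum => j ji; rewrite /h.
      case: (ltngtP i j) => ij; last by move/val_inj: ij ji => ->; rewrite eqxx.
        have [-> ->] := trig i j ij; rewrite !mul0r subr0 addr0 !mulr0 addr0 mulr0.
        exact: sg0.
      (* Here [j < i], so [s ^+ i <= s ^+ j.+1]; this spare factor [s] is the gain on the entries
         below the diagonal. *)
      have Hij : (s ^+ i) ^+ 2 <= s * (s ^+ i * s ^+ j).
        rewrite expr2 [leRHS]mulrCA ler_wpM2l// -exprS.
        by rewrite ler_wiXn2l// ltW.
      have Hab : a i 0 * (Ta i j * a j 0 - Tb i j * b j 0)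
       + b i 0 * (Ta i j * b j 0 + Tb i j * a j 0) <=
         tau * ((`|a i 0| + `|b i 0|) * (`|a j 0| + `|b j 0|)).
        have T1 := mx_coord_le Ta i j; have T2 := mx_coord_le Tb i j.
        have pr (u v y z t : R) : `|u| <= t -> v * (u * y) <= t * (`|v| * `|y|).
          move=> ut; apply: le_trans (ler_norm _) _; rewrite !normrM mulrCA.
          by rewrite ler_wpM2r// mulr_ge0.
        have := pr _ (a i 0) (a j 0) 0 _ T1; have := pr _ (b i 0) (b j 0) 0 _ T1.
        have := pr _ (b i 0) (a j 0) 0 _ T2; have := pr (- Tb i j) (a i 0) (b j 0) 0 `|Tb|.
        rewrite normrN => /(_ T2).
        have z0 : 0 <= `|a i 0| * `|a j 0| by rewrite mulr_ge0.
        have z1 : 0 <= `|a i 0| * `|b j 0| by rewrite mulr_ge0.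
        have z2 : 0 <= `|b i 0| * `|a j 0| by rewrite mulr_ge0.
        have z3 : 0 <= `|b i 0| * `|b j 0| by rewrite mulr_ge0.
        have N1 := normr_ge0 Ta; have N2 := normr_ge0 Tb.
        rewrite /tau !(mulrDl, mulrDr) !mul1r.
        have := mulr_ge0 N1 z1; have := mulr_ge0 N1 z2.
        have := mulr_ge0 N2 z0; have := mulr_ge0 N2 z3.
        lra.
      apply: le_trans (ler_wpM2l (sqr_ge0 _) Hab) _.
      apply: le_trans (ler_wpM2r _ Hij) _.
        by rewrite !mulr_ge0 ?addr_ge0 ?(ltW tau0).
      by rewrite le_eqVlt; apply/orP; left; apply/eqP; rewrite /g; ring.
    have -> : h i = (s ^+ i) ^+ 2 * (Ta i i * (a i 0 ^+ 2 + b i 0 ^+ 2)).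
      by rewrite /h; ring.
    rewrite -[leLHS]addr0; apply: lerD; last exact: sg0.
    by rewrite ler_wpM2l ?sqr_ge0// ler_wpM2r// addr_ge0// sqr_ge0.
  rewrite big_split/=.
  have -> : \sum_(i < n) \sum_(j < n) s * tau * (g i * g j) = s * tau * (\sum_(i < n) g i) ^+ 2.
    rewrite expr2 mulr_suml mulr_sumr; apply: eq_bigr => i _.
    by rewrite mulr_sumr mulr_sumr.
  have Hg : \sum_(i < n) g i ^+ 2 <= 2 * \sum_(i < n) (s ^+ i) ^+ 2 * (a i 0 * a i 0 + b i 0 * b i 0).
    rewrite mulr_sumr; apply: ler_sum => i _; rewrite /g exprMn [leRHS]mulrCA ler_wpM2l ?sqr_ge0//.
    have := sqr_ge0 (`|a i 0| - `|b i 0|).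
    rewrite -!expr2 -(real_normK (num_real (a i 0))) -(real_normK (num_real (b i 0))) !expr2; lra.
  have -> : \sum_(i < n) (s ^+ i) ^+ 2 * (- w * (a i 0 ^+ 2 + b i 0 ^+ 2)) =
     - w * \sum_(i < n) (s ^+ i) ^+ 2 * (a i 0 * a i 0 + b i 0 * b i 0).
    by rewrite mulr_sumr; apply: eq_bigr => i _; rewrite !expr2; ring.
  have := sqr_sum_le g; move: Hg.
  set N := \sum_(i < n) _ * (_ + _); set G := \sum_(i < n) g i ^+ 2; set H := _ ^+ 2 => GN HG.
  have N0 : 0 <= N.
    by apply: sumr_ge0 => i _; rewrite mulr_ge0 ?sqr_ge0// -!expr2 addr_ge0 ?sqr_ge0.
  have st0 : 0 <= s * tau by rewrite mulr_ge0 ?ltW.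
  have H1 : s * tau * H <= s * tau * (n.+1%:R * (2 * N)).
    rewrite ler_wpM2l//; apply: le_trans HG _; apply: ler_pM => //.
      by apply: sumr_ge0 => i _; exact: sqr_ge0.
    by rewrite ler_nat.
  have := ler_wpM2r N0 sw; lra.
(* [s ^+ n] bounds all weights [s ^+ i] from below, so division by [c] normalizes the decay of the
   form to [- sqnorm x]. *)
pose c := (w / 2) * (s ^+ n) ^+ 2.
have c0 : 0 < c by rewrite !mulr_gt0 ?exprn_gt0// invr_gt0.
have low x : (s ^+ n) ^+ 2 * sqnorm x <= dotv x (P0 *m x).
  rewrite P0E xE mulr_sumr; apply: ler_sum => i _; rewrite -!expr2.
  rewrite ler_wpM2r ?addr_ge0 ?sqr_ge0// lerXn2r ?nnegrE ?exprn_ge0 ?(ltW s0)//.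
  by rewrite ler_wiXn2l ?(ltW s0)// ltnW.
have psd0 x : 0 <= dotv x (P0 *m x).
  by apply: le_trans (low x); rewrite mulr_ge0 ?sqr_ge0 ?sqnorm_ge0.
exists (c^-1 *: P0).
  split=> [|x]; last by rewrite -scalemxAl dotvZr mulr_ge0// invr_ge0 ltW.
  by rewrite linearZ linearD/= !trmx_mul !trmxK tr_diag_mx !mulmxA.
move=> x; rewrite -scalemxAl dotvZr ler_pdivrMl//.
apply: le_trans (main x) _; rewrite mulrN mulNr lerN2 /c -[leLHS]mulrA ler_wpM2l//.
by rewrite ltW// divr_gt0.
Qed.

End SpectralLyapunov.

(** * Local Lipschitz and Taylor estimates *)

Lemma is_derive_eps (R : realType) (u : R -> R) (s l : R) :
  (forall e : R, 0 < e -> exists2 d : R, 0 < d & forall h : R, `|h| < d ->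
     `|u (s + h) - u s - h * l| <= e * `|h|) -> is_derive s 1 u l.
Proof.
move=> H; have [||D E] := @diff_lin_eps R R R u
  (HB.pack_for {linear R -> R} (fun r : R => r * l)
    (GRing.isLinear.Build R R R _ (fun r : R => r * l)
      (fun c u v => etrans (mulrDl _ _ _) (congr1 (fun x => x + _) (esym (mulrA c u _)))))) s.
- by move=> r; apply: mulrr_continuous.
- exact: H.
split; first by apply/derivable1_diffP.
by have := E 1; rewrite /= mul1r.
Qed.

Section LocalEstimates.
Context {R : realType}.
Variables (p q : nat) (g : 'cV[R]_p -> 'cV[R]_q).
Hypothesis dg : forall x, differentiable g x.

Lemma deriveZ_dir (x d : 'cV[R]_p) (h : R) : 'D_(h *: d) g x = h *: 'D_d g x.
Proof. by rewrite !deriveE// linearZ. Qed.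

Lemma line_derive (a d : 'cV[R]_p) (i : 'I_q) (s : R) :
  is_derive s 1 (fun s : R => g (a + s *: d) i 0) ('D_d g (a + s *: d) i 0).
Proof.
apply: is_derive_eps => e e0; have e1 : 0 < e / (1 + `|d|) by rewrite divr_gt0// ltr_wpDr.
have [z z0 Hz] := diff_eps (dg (a + s *: d)) e1.
exists (z / (1 + `|d|)) => [|h]; first by rewrite divr_gt0// ltr_wpDr.
have d0 : 0 < 1 + `|d| by rewrite ltr_wpDr.
rewrite ltr_pdivlMr// => hz.
have hd : `|h *: d| < z.
  by apply: le_lt_trans hz; rewrite normrZ ler_wpM2l// lerDr.
have := Hz _ hd; rewrite scalerDl addrA deriveZ_dir.
move=> /(le_trans (mx_coord_le _ i 0)); rewrite !mxE => /le_trans; apply.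
by rewrite normrZ mulrAC ler_pdivrMr// -mulrA ler_wpM2l ?(ltW e0)// ler_wpM2l// lerDr.
Qed.

Lemma derive_coord_bound c (x d : 'cV[R]_p) : 0 <= c ->
  (forall j, `|'D_(delta_mx j 0) g x| <= c) -> `|'D_d g x| <= p%:R * c * `|d|.
Proof.
move=> c0 H; rewrite (cV_linear_sum d (diff_linear (dg x))).
apply: le_trans (ler_norm_sum _ _ _) _.
have -> : p%:R * c * `|d| = \sum_(j < p) `|d| * c.
  by rewrite sumr_const card_ord -mulr_natl; ring.
by apply: ler_sum => j _; rewrite normrZ ler_pM ?mx_coord_le.
Qed.

Lemma segment_norm (a b : 'cV[R]_p) (r s : R) : `|a| <= r -> `|b| <= r ->
  0 < s < 1 -> `|a + s *: (b - a)| <= r.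
Proof.
move=> ar br /andP[s0 s1].
have -> : a + s *: (b - a) = (1 - s) *: a + s *: b.
  by rewrite scalerBr scalerBl scale1r addrCA addrC.
apply: le_trans (ler_normD _ _) _; rewrite !normrZ.
rewrite (@gtr0_norm _ s)// (@gtr0_norm _ (1 - s)) ?subr_gt0//.
have := ler_wpM2l (ltW s0) br.
have s1' : 0 <= 1 - s by rewrite subr_ge0 ltW.
have := ler_wpM2l s1' ar; lra.
Qed.

Lemma mvt_lip c r : 0 <= c ->
  (forall x, `|x| <= r -> forall j, `|'D_(delta_mx j 0) g x| <= c) ->
  forall a b, `|a| <= r -> `|b| <= r -> `|g a - g b| <= p%:R * c * `|a - b|.
Proof.
move=> c0 H a b ar br; apply: cV_norm_le => [|i]; first by rewrite !mulr_ge0.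
pose d := a - b; pose phi (s : R) := g (b + s *: d) i 0.
have L : continuous (fun s : R => p%:R * c * `|d| * s).
  by move=> s; exact: mulrl_continuous.
have := @derive_le_diff _ phi (fun s => 'D_d g (b + s *: d) i 0)
  (fun s => p%:R * c * `|d| * s) (fun=> p%:R * c * `|d|) 0 1 ler01
  (continuous_derive (line_derive b d i)) L (fun s _ => line_derive b d i s).
have -> : phi 1 - phi 0 = (g a - g b) i 0.
  by rewrite /phi scale1r scale0r addr0 [b + _]addrC subrK !mxE.
rewrite mulr1 mulr0 subr0; apply.
- move=> s _; apply: is_derive_eq (is_derive_mulf (is_derive_cst (p%:R * c * `|d|) s 1) (is_derive_id s 1)) _.
  by rewrite mul0r add0r mulr1.
- move=> s s01; apply: le_trans (mx_coord_le _ i 0) _.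
  by apply: derive_coord_bound => // j; apply: H; exact: segment_norm.
Qed.

Lemma taylor_lip c r : 0 <= c ->
  (forall a b, `|a| <= r -> `|b| <= r -> forall j,
    `|'D_(delta_mx j 0) g a - 'D_(delta_mx j 0) g b| <= c * `|a - b|) ->
  forall a b, `|a| <= r -> `|b| <= r ->
    `|g b - g a - 'D_(b - a) g a| <= p%:R * c * `|b - a| ^+ 2.
Proof.
move=> c0 H a b ar br; apply: cV_norm_le => [|i].
  by rewrite !mulr_ge0// sqr_ge0.
(* [phi] is a coordinate of [g] along the segment minus its linear part; its derivative is an
   increment of [Dg] applied to [d], hence quadratic in [|d|]. *)
pose d := b - a; pose phi (s : R) := g (a + s *: d) i 0 - s * 'D_d g a i 0.
have Dl (k s : R) : is_derive s 1 (fun s : R => s * k) k.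
  by apply: is_derive_eq (is_derive_mulf (is_derive_id s 1) (is_derive_cst k s 1)) _; rewrite mulr0 addr0 mul1r.
have Dphi (s : R) : is_derive s 1 phi ('D_d g (a + s *: d) i 0 - 'D_d g a i 0).
  exact: (is_deriveB (line_derive a d i s) (Dl _ s)).
have := @derive_le_diff _ phi (fun s => 'D_d g (a + s *: d) i 0 - 'D_d g a i 0)
  (fun s => s * (p%:R * c * `|d| ^+ 2)) (fun=> p%:R * c * `|d| ^+ 2) 0 1 ler01
  (continuous_derive Dphi) (continuous_derive (Dl _)) (fun s _ => Dphi s)
  (fun s _ => Dl _ s).
have -> : phi 1 - phi 0 = (g b - g a - 'D_d g a) i 0.
  by rewrite /phi scale1r scale0r addr0 mul1r mul0r subr0 [a + d]addrC subrK !mxE addrAC.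
rewrite mul1r mul0r subr0; apply => s s01.
have -> : 'D_d g (a + s *: d) i 0 - 'D_d g a i 0 = ('D_d g (a + s *: d) - 'D_d g a) i 0.
  by rewrite !mxE.
apply: le_trans (mx_coord_le _ i 0) _.
rewrite (cV_linear_sum d (diff_linear (dg (a + s *: d)))) (cV_linear_sum d (diff_linear (dg a))).
rewrite -sumrB; apply: le_trans (ler_norm_sum _ _ _) _.
have -> : p%:R * c * `|d| ^+ 2 = \sum_(j < p) `|d| * (c * `|d|).
  by rewrite sumr_const card_ord -mulr_natl; ring.
apply: ler_sum => j _; rewrite -scalerBr normrZ ler_pM ?mx_coord_le//.
have sr := segment_norm ar br s01.
apply: le_trans (H _ _ sr ar j) _; rewrite addrAC subrr add0r normrZ.
rewrite ler_wpM2l// gtr0_norm; last by case/andP: s01.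
by rewrite ler_piMl// ltW//; case/andP: s01.
Qed.

End LocalEstimates.

Section LocalLipschitz.
Context {R : realType}.

Definition liponball p q (g : 'cV[R]_p -> 'cV[R]_q) (r c : R) :=
  forall a b, `|a| <= r -> `|b| <= r -> `|g a - g b| <= c * `|a - b|.

Lemma liponball_le p q (g : 'cV[R]_p -> 'cV[R]_q) r r' c :
  r' <= r -> liponball g r c -> liponball g r' c.
Proof. by move=> rr H a b ar br; apply: H; exact: le_trans rr. Qed.

Lemma finite_radius p (P : 'I_p -> R -> Prop) :
  (forall i r r', r' <= r -> P i r -> P i r') ->
  (forall i, exists2 r, 0 < r & P i r) -> exists2 r, 0 < r & forall i, P i r.
Proof.
move=> mono H; pose r i := projT1 (cid2 (H i)).
have r0 i : 0 < r i by rewrite /r; case: cid2.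
have rP i : P i (r i) by rewrite /r; case: cid2.
exists (\big[Num.min/1]_i r i).
  by apply: (big_ind (fun x : R => 0 < x)) => // x y x0 y0; rewrite lt_min x0.
by move=> i; apply: mono (rP i); exact: bigmin_le.
Qed.

Lemma C1_derive_near0 p q (g : 'cV[R]_p -> 'cV[R]_q) e : 0 < e ->
  CkOn 1 g setT -> exists2 r, 0 < r & forall x, `|x| <= r -> forall j,
   `|'D_(delta_mx j 0) g x - 'D_(delta_mx j 0) g 0| <= e.
Proof.
move=> e0 [_ cg].
have [] := @finite_radius p (fun j r => forall x, `|x| <= r ->
   `|'D_(delta_mx j 0) g x - 'D_(delta_mx j 0) g 0| <= e).
- by move=> i r r' rr H x xr; apply: H; exact: le_trans rr.
- move=> j; have [d d0 Hd] := (continuous_atP _ _).1 (cg (delta_mx j 0) 0 I) e e0.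
  exists (d / 2); first by rewrite divr_gt0.
  by move=> x xd; apply/ltW/Hd; rewrite subr0; lra.
- by move=> r r0 H; exists r => // x xr j; exact: H.
Qed.

(** A derivative vanishing at 0 makes the Lipschitz constant as small as desired on a small ball;
    the contraction in the fixed point argument comes from here. *)
Lemma C1_flat p q (g : 'cV[R]_p -> 'cV[R]_q) c : 0 < c -> CkOn 1 g setT ->
  (forall v, 'D_v g 0 = 0) -> exists2 r, 0 < r & liponball g r c.
Proof.
(* The mean value bound costs a factor [p]; dividing by [p.+1] compensates it and stays meaningful
   for [p = 0]. *)
move=> c0 Cg g0; have e0 : 0 < c / p.+1%:R by rewrite divr_gt0.
have [r r0 Hr] := C1_derive_near0 e0 Cg.
exists r => // a b ar br.
have [dg _] := Cg.
apply: le_trans (mvt_lip (fun x => dg x I) (ltW e0) _ ar br) _.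
  by move=> x xr j; have := Hr x xr j; rewrite g0 subr0.
rewrite ler_wpM2r// mulrCA ler_piMr ?(ltW c0)//.
by rewrite ler_pdivrMr// mul1r ler_nat.
Qed.

Lemma C1_loclip p q (g : 'cV[R]_p -> 'cV[R]_q) : CkOn 1 g setT ->
  exists r c, [/\ 0 < r, 0 <= c & liponball g r c].
Proof.
move=> Cg; have [r r0 Hr] := C1_derive_near0 ltr01 Cg.
pose c := 1 + \sum_j `|'D_(delta_mx j 0) g 0|.
have c0 : 0 <= c by rewrite addr_ge0// sumr_ge0.
exists r, (p%:R * c); split=> //; first by rewrite mulr_ge0.
have [dg _] := Cg.
apply: (mvt_lip (fun x => dg x I)) => // x xr j.
have := Hr x xr j => H; rewrite -[X in `|X|](subrK ('D_(delta_mx j 0) g 0)).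
apply: le_trans (ler_normD _ _) _; rewrite lerD// (bigD1 j)//= lerDl.
by rewrite sumr_ge0.
Qed.

Lemma C2_taylor p q (g : 'cV[R]_p -> 'cV[R]_q) : CkOn 2 g setT ->
  exists r c, [/\ 0 < r, 0 <= c, forall a b, `|a| <= r -> `|b| <= r ->
    `|g b - g a - 'D_(b - a) g a| <= c * `|b - a| ^+ 2 &
    forall a b d, `|a| <= r -> `|b| <= r ->
    `|'D_d g a - 'D_d g b| <= c * `|d| * `|a - b|].
Proof.
move=> Cg; have [dg' Cg'] := Cg.
have dg x : differentiable g x by exact: dg'.
have [] := @finite_radius p (fun j r => exists2 c, 0 <= c & liponball (fun x => 'D_(delta_mx j 0) g x) r c).
- by move=> j r r' rr [c c0 H]; exists c => //; exact: liponball_le H.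
- move=> j; have [r [c [r0 c0 H]]] := C1_loclip (Cg' (delta_mx j 0)).
  by exists r => //; exists c.
move=> r r0 H; pose c j := projT1 (cid2 (H j)).
have c0 j : 0 <= c j by rewrite /c; case: cid2.
have cP j : liponball (fun x => 'D_(delta_mx j 0) g x) r (c j) by rewrite /c; case: cid2.
pose C := \sum_j c j.
have C0 : 0 <= C by apply: sumr_ge0.
have HC a b : `|a| <= r -> `|b| <= r -> forall j,
    `|'D_(delta_mx j 0) g a - 'D_(delta_mx j 0) g b| <= C * `|a - b|.
  move=> ar br j; apply: le_trans (cP j a b ar br) _; rewrite ler_wpM2r//.
  by rewrite /C (bigD1 j)//= lerDl sumr_ge0.
exists r, (p%:R * C); split=> //; first by rewrite mulr_ge0.
  by move=> a b ar br; exact: (taylor_lip dg C0 HC).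
move=> a b d ar br.
rewrite (cV_linear_sum d (diff_linear (dg a))) (cV_linear_sum d (diff_linear (dg b))).
rewrite -sumrB; apply: le_trans (ler_norm_sum _ _ _) _.
have -> : p%:R * C * `|d| * `|a - b| = \sum_(j < p) `|d| * (C * `|a - b|).
  by rewrite sumr_const card_ord -mulr_natl; ring.
by apply: ler_sum => j _; rewrite -scalerBr normrZ ler_pM ?mx_coord_le// HC.
Qed.

End LocalLipschitz.

(** * The fixed point equation *)

Section Halving.
Context {R : realType}.

Lemma halves_small (C e : R) : 0 < e -> exists k, C * 2^-1 ^+ k < e.
Proof.
move=> e0; have [k Hk] : exists k : nat, `|C| / e < k%:R.
  by exists (Num.bound (`|C| / e)); apply: archi_boundP; rewrite divr_ge0// ltW.
exists k; rewrite exprVn; apply: le_lt_trans (_ : `|C| / 2 ^+ k < _).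
  by rewrite ler_wpM2r ?invr_ge0 ?exprn_ge0// ler_norm.
rewrite ltr_pdivrMr ?exprn_gt0// mulrC -ltr_pdivrMr//; apply: lt_trans Hk _.
by rewrite -natrX ltr_nat ltn_expl.
Qed.

Lemma halves_le (x a C : R) : (forall k, x <= a + C * 2^-1 ^+ k) -> x <= a.
Proof.
move=> H; rewrite leNgt; apply/negP => ax.
have [|k Hk] := @halves_small C (x - a); first by rewrite subr_gt0.
by have := H k; lra.
Qed.

(** The intervals of radius [2 C 2^-k] about [u k] are nested, so the supremum of their lower ends
    lies in all of them. *)
Lemma halves_lim (u : nat -> R) C : (forall k, `|u k.+1 - u k| <= C * 2^-1 ^+ k) ->
  exists l, forall k, `|l - u k| <= 2 * C * 2^-1 ^+ k.
Proof.
move=> H; pose lo k := u k - 2 * C * 2^-1 ^+ k; pose hi k := u k + 2 * C * 2^-1 ^+ k.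
have loS k : lo k <= lo k.+1.
  by have := H k; rewrite /lo ler_norml exprS => /andP[]; lra.
have hiS k : hi k.+1 <= hi k.
  by have := H k; rewrite /hi ler_norml exprS => /andP[]; lra.
have lo_mono j k : (j <= k)%N -> lo j <= lo k.
  elim: k => [|k IH]; first by rewrite leqn0 => /eqP->.
  by rewrite leq_eqVlt => /predU1P[->//|]; rewrite ltnS => /IH/le_trans; apply.
have hi_mono j k : (j <= k)%N -> hi k <= hi j.
  elim: k => [|k IH]; first by rewrite leqn0 => /eqP->.
  by rewrite leq_eqVlt => /predU1P[->//|]; rewrite ltnS => /IH; apply: le_trans.
have lohi k : lo k <= hi k.
  have : 0 <= C * 2^-1 ^+ k by apply: le_trans (H k).
  by rewrite /lo /hi; lra.
have LH j k : lo j <= hi k.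
  apply: le_trans (lo_mono j (maxn j k) (leq_maxl _ _)) _.
  by apply: le_trans (lohi _) _; apply: hi_mono; exact: leq_maxr.
exists (sup (range lo)) => k; rewrite ler_norml.
have hs : has_sup (range lo).
  by split; [exists (lo 0%N), 0%N|exists (hi 0%N) => _ [j _ <-]].
have H1 : lo k <= sup (range lo) by apply: ub_le_sup; [case: hs|exists k].
have H2 : sup (range lo) <= hi k.
  by apply: ge_sup; [case: hs|move=> _ [j _ <-]].
by move: H1 H2; rewrite /lo /hi; lra.
Qed.
End Halving.

(** * Contraction in exponentially weighted function spaces *)

Section Perron.
Context {R : realType}.

Definition bd N (e : R -> R) (h : R -> 'cV[R]_N) (H : R) :=
  forall t, `|h t| <= H * e t.

Record weight (e : R -> R) : Prop := Weight {
  weight_ge0 : forall t, 0 <= e t ; weight_le1 : forall t, e t <= 1 }.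

(* [Psi y0 + S h] stands for the decaying solution of a linear system with forcing [h] whose state
   component starts at [y0]. *)
Record solop n N (e : R -> R) (Psi : 'cV[R]_n -> R -> 'cV[R]_N)
    (S : (R -> 'cV[R]_N) -> R -> 'cV[R]_N) (K : R) : Prop := SolOp {
  solop_K : 0 < K ;
  solop_bd : forall h H, cmx h -> bd e h H -> cmx (S h) /\ bd e (S h) (K * H) ;
  solop_lin : forall h h' H H' (a : R), cmx h -> cmx h' -> bd e h H -> bd e h' H' ->
    forall t, S (fun s => a *: h s + h' s) t = a *: S h t + S h' t ;
  solop_init : forall v, cmx (Psi v) /\ bd e (Psi v) (K * `|v|) ;
  solop_initlin : forall (a : R) u v t, Psi (a *: u + v) t = a *: Psi u t + Psi v t }.

Lemma bdD N (e : R -> R) (h h' : R -> 'cV[R]_N) H H' :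
  bd e h H -> bd e h' H' -> bd e (fun t => h t + h' t) (H + H').
Proof. by move=> a b t; apply: le_trans (ler_normD _ _) _; rewrite mulrDl lerD. Qed.

Lemma bdN N (e : R -> R) (h : R -> 'cV[R]_N) H : bd e h H -> bd e (fun t => - h t) H.
Proof. by move=> a t; rewrite normrN. Qed.

Lemma bdB N (e : R -> R) (h h' : R -> 'cV[R]_N) H H' :
  bd e h H -> bd e h' H' -> bd e (fun t => h t - h' t) (H + H').
Proof. by move=> a b; apply: bdD => //; exact: bdN. Qed.

Lemma bd_le N e (we : weight e) (h : R -> 'cV[R]_N) H H' :
  H <= H' -> bd e h H -> bd e h H'.
Proof.
by move=> HH a t; apply: le_trans (a t) _; rewrite ler_wpM2r// weight_ge0.
Qed.

Lemma bd_norm N e (we : weight e) (h : R -> 'cV[R]_N) H t :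
  0 <= H -> bd e h H -> `|h t| <= H.
Proof.
by move=> H0 a; apply: le_trans (a t) _; rewrite ler_piMr// weight_le1.
Qed.

(** The term [H / 2] is absorbed by iterating the implication from some a priori bound [H0]; this
    bound supplies finiteness and drops out in the limit. *)
Lemma bd_absorb N e (we : weight e) (d : R -> 'cV[R]_N) a H0 :
  (forall H, 0 <= H -> bd e d H -> bd e d (a + H / 2)) -> 0 <= a -> 0 <= H0 -> bd e d H0 -> bd e d (2 * a).
Proof.
move=> H a0 H00 b0.
have key k : bd e d (2 * a + H0 * 2^-1 ^+ k).
  elim: k => [|k IH]; first by rewrite expr0 mulr1; apply: bd_le b0 => //; lra.
  have h0 : 0 <= H0 * 2^-1 ^+ k by rewrite mulr_ge0// exprn_ge0.
  apply: bd_le (H _ _ IH) => //; rewrite ?exprS; lra.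
move=> t; apply: (@halves_le _ _ _ (H0 * e t)) => k.
by have := key k t; lra.
Qed.

Lemma cmx_at N (z : R -> 'cV[R]_N) t (e : R) : cmx z -> 0 < e ->
  exists2 d : R, 0 < d & forall s, `|s - t| < d -> `|z s - z t| < e.
Proof.
move=> cz e0.
have [] := @finite_radius _ N (fun i r => forall s, `|s - t| < r -> `|z s i 0 - z t i 0| < e / 2).
- by move=> i r r' rr H s sr; apply: H; exact: lt_le_trans rr.
- move=> i; have e2 : 0 < e / 2 by rewrite divr_gt0.
  have [d d0 Hd] := (continuous_atP _ _).1 (cz i 0 t) _ e2.
  by exists d.
move=> r r0 H; exists r => // s sr; apply: le_lt_trans (_ : e / 2 < e); last by lra.
apply: cV_norm_le => [|i]; first by rewrite divr_ge0// ltW.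
by rewrite !mxE ltW// H.
Qed.

Lemma atP_cmx N (z : R -> 'cV[R]_N) :
  (forall t (e : R), 0 < e -> exists2 d : R, 0 < d & forall s, `|s - t| < d -> `|z s - z t| < e) ->
  cmx z.
Proof.
move=> H i j t; apply/continuous_atP => e e0; have [d d0 Hd] := H t e e0.
exists d => // s /Hd; apply: le_lt_trans; apply: le_trans (mx_coord_le _ i j).
by rewrite !mxE.
Qed.

Lemma cmx_compG N M (G : 'cV[R]_N -> 'cV[R]_M) (z : R -> 'cV[R]_N) :
  (forall x, {for x, continuous G}) -> cmx z -> cmx (fun t => G (z t)).
Proof.
move=> cG cz; apply: atP_cmx => t e e0.
have [d d0 Hd] := (continuous_atP _ _).1 (cG (z t)) e e0.
have [d' d'0 Hd'] := cmx_at t cz d0.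
by exists d' => // s /Hd'/Hd.
Qed.

Definition issol n N (e : R -> R) (Psi : 'cV[R]_n -> R -> 'cV[R]_N) S
    (G : 'cV[R]_N -> 'cV[R]_N) (r : R) y0 (z : R -> 'cV[R]_N) :=
  [/\ cmx z, bd e z r & forall t, z t = Psi y0 t + S (fun s => G (z s)) t].

Section FixedPoint.
Variables (n N : nat) (e : R -> R) (Psi : 'cV[R]_n -> R -> 'cV[R]_N).
Variables (S : (R -> 'cV[R]_N) -> R -> 'cV[R]_N) (K : R).
Variables (G : 'cV[R]_N -> 'cV[R]_N) (r c : R).
Hypothesis we : weight e.
Hypothesis so : solop e Psi S K.
Hypothesis cG : forall x, {for x, continuous G}.
Hypothesis G0 : G 0 = 0.
Hypothesis lG : liponball G r c.
Hypothesis r0 : 0 < r.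
Hypothesis c0 : 0 <= c.
Hypothesis Kc : K * c <= 2^-1.

Let K0 := solop_K so.

Lemma bd_G_diff z z' H : bd e z r -> bd e z' r -> bd e (fun t => z t - z' t) H ->
  bd e (fun t => G (z t) - G (z' t)) (c * H).
Proof.
move=> bz bz' bH t.
apply: le_trans (lG (bd_norm _ _ (ltW r0) bz) (bd_norm _ _ (ltW r0) bz')) _ => //.
by rewrite -mulrA ler_wpM2l.
Qed.

Lemma bd_G z : bd e z r -> bd e (fun t => G (z t)) (c * r).
Proof.
move=> bz t; have b0 : bd e (fun=> 0 : 'cV[R]_N) r.
  by move=> s; rewrite normr0 mulr_ge0 ?(ltW r0)// weight_ge0.
have := @bd_G_diff z (fun=> 0) r bz b0; rewrite /bd => /(_ _ t).
by rewrite G0 !subr0; apply => s; rewrite subr0.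
Qed.

Lemma solop_sub h h' H H' : cmx h -> cmx h' -> bd e h H -> bd e h' H' ->
  forall t, S (fun s => h s - h' s) t = S h t - S h' t.
Proof.
move=> ch ch' bh bh' t.
have := solop_lin so (-1) ch' ch bh' bh t.
rewrite scaleN1r addrC => <-; congr (S _ t); apply/funext => s.
by rewrite scaleN1r addrC.
Qed.

Lemma solop_diff h h' H0 H1 H : cmx h -> cmx h' -> bd e h H0 -> bd e h' H1 ->
  bd e (fun t => h t - h' t) H -> bd e (fun t => S h t - S h' t) (K * H).
Proof.
move=> ch ch' bh bh' bH t; rewrite -(solop_sub ch ch' bh bh').
by have [_] := solop_bd so (cmxB ch ch') bH; apply.
Qed.

(** Picard iteration from 0. With [K * c <= 1/2] the map halves weighted distances, and with
    [K |y0| <= r / 2] it keeps the iterates within [r]. The limit is formed pointwise by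
    coordinates; the error bound is uniform in time, which gives continuity. *)
Lemma fixed_point y0 : K * `|y0| <= r / 2 -> exists z, issol e Psi S G r y0 z.
Proof.
move=> y0r; pose T z (t : R) := Psi y0 t + S (fun s => G (z s)) t.
pose z := fix z k := if k is k'.+1 then T (z k') else (fun _ : R => 0 : 'cV[R]_N).
have [cP bP] := solop_init so y0.
have zP k : cmx (z k) /\ bd e (z k) r.
  elim: k => [|k [cz bz]] /=.
    split; first exact: cmx_cst.
    by move=> s; rewrite normr0 mulr_ge0 ?(ltW r0)// weight_ge0.
  have [cS bS] := solop_bd so (cmx_compG cG cz) (bd_G bz).
  split; first exact: cmxD.
  apply: bd_le (bdD bP bS) => //; have := ler_wpM2r (ltW r0) Kc; rewrite mulrA; lra.
have cz k := (zP k).1; have bz k := (zP k).2.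
have TT u v H : cmx u -> cmx v -> bd e u r -> bd e v r -> bd e (fun t => u t - v t) H ->
    0 <= H -> bd e (fun t => T u t - T v t) (H / 2).
  move=> cu cv bu bv bH H0 t.
  have -> : T u t - T v t = S (fun s => G (u s)) t - S (fun s => G (v s)) t.
    by rewrite /T opprD addrACA subrr add0r.
  have := solop_diff (cmx_compG cG cu) (cmx_compG cG cv) (bd_G bu) (bd_G bv) (bd_G_diff bu bv bH) t.
  move=> /le_trans; apply; rewrite ler_wpM2r ?weight_ge0// mulrA mulrC ler_wpM2l//.
have dz k : bd e (fun t => z k.+1 t - z k t) (r * 2^-1 ^+ k).
  elim: k => [|k IH].
    by move=> t; rewrite expr0 mulr1 /= subr0; exact: (bz 1%N t).
  have := TT _ _ _ (cz k.+1) (cz k) (bz k.+1) (bz k) IH.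
  rewrite exprSr mulrA; apply.
  by rewrite mulr_ge0 ?(ltW r0)// exprn_ge0.
have lim t i : exists l, forall k, `|l - z k t i 0| <= 2 * (r * e t) * 2^-1 ^+ k.
  apply: halves_lim => k; have := dz k t => /(le_trans (mx_coord_le _ i 0)).
  by rewrite !mxE mulrAC.
pose w t : 'cV[R]_N := \col_i projT1 (cid (lim t i)).
have wz k : bd e (fun t => w t - z k t) (2 * r * 2^-1 ^+ k).
  move=> t; apply: cV_norm_le => [|i].
    by rewrite !mulr_ge0 ?(ltW r0) ?exprn_ge0// weight_ge0.
  rewrite !mxE; case: cid => l Hl /=; apply: le_trans (Hl k) _.
  by rewrite mulrA [leRHS]mulrAC.
have cw : cmx w.
  apply: atP_cmx => t eps eps0; have eps3 : 0 < eps / 3 by rewrite divr_gt0.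
  have [k Hk] := halves_small (2 * r) eps3.
  have [d d0 Hd] := cmx_at t (cz k) eps3; exists d => // s /Hd sd.
  have h0 : 0 <= 2 * r * 2^-1 ^+ k by rewrite !mulr_ge0 ?(ltW r0) ?exprn_ge0.
  have H1 := bd_norm we s h0 (wz k); have H2 := bd_norm we t h0 (wz k).
  have -> : w s - w t = (w s - z k s) + (z k s - z k t) - (w t - z k t).
    by rewrite addrA subrK opprB addrA subrK.
  apply: le_lt_trans (ler_normB _ _) _; apply: le_lt_trans (lerD (ler_normD _ _) (lexx _)) _.
  by lra.
have bw : bd e w r.
  move=> t; apply: (@halves_le _ _ _ (2 * r * e t)) => k.
  have -> : w t = (w t - z k t) + z k t by rewrite subrK.
  apply: le_trans (ler_normD _ _) _; rewrite addrC lerD//; first exact: bz.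
  by have := wz k t; rewrite mulrAC.
exists w; split=> // t; apply/eqP; rewrite -subr_eq0 -normr_le0.
apply: (@halves_le _ _ _ (4 * r * e t)) => k; rewrite add0r.
have -> : w t - (Psi y0 t + S (fun s => G (w s)) t) = (w t - z k.+1 t) - (T w t - T (z k) t).
  by rewrite /= opprB addrA subrK.
apply: le_trans (ler_normB _ _) _.
have h0 : 0 <= 2 * r * 2^-1 ^+ k by rewrite !mulr_ge0 ?(ltW r0) ?exprn_ge0.
have := wz k.+1 t; have := TT _ _ _ cw (cz k) bw (bz k) (wz k) h0 t.
by rewrite exprS; have := mulr_ge0 h0 (weight_ge0 we t); lra.
Qed.

(** The difference is bounded by [K |y1 - y2|] plus half of itself, which is where the factor 2
    comes from. *)
Lemma issol_lip y1 y2 z1 z2 :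
  issol e Psi S G r y1 z1 -> issol e Psi S G r y2 z2 ->
  bd e (fun t => z1 t - z2 t) (2 * (K * `|y1 - y2|)).
Proof.
move=> [cz1 bz1 E1] [cz2 bz2 E2].
apply: (@bd_absorb _ _ _ _ _ (r + r)) => //; last exact: bdB.
- move=> H H0 bH t; rewrite E1 E2 opprD addrACA.
  have -> : Psi y1 t - Psi y2 t = Psi (y1 - y2) t.
    have := solop_initlin so (-1) y2 y1 t; rewrite !scaleN1r => E.
    by rewrite addrC -E addrC.
  have [_ bP] := solop_init so (y1 - y2).
  apply: le_trans (ler_normD _ _) _; rewrite mulrDl lerD//.
  have := solop_diff (cmx_compG cG cz1) (cmx_compG cG cz2) (bd_G bz1) (bd_G bz2) (bd_G_diff bz1 bz2 bH) t.
  move=> /le_trans; apply; rewrite ler_wpM2r ?weight_ge0// mulrA mulrC ler_wpM2l//.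
- by rewrite mulr_ge0// ltW.
- by rewrite addr_ge0 ?ltW.
Qed.

Lemma issol_unique y0 z1 z2 :
  issol e Psi S G r y0 z1 -> issol e Psi S G r y0 z2 -> z1 = z2.
Proof.
move=> s1 s2; apply/funext => t; apply/eqP; rewrite -subr_eq0 -normr_le0.
by have := issol_lip s1 s2 t; rewrite subrr normr0 mulr0 mulr0 mul0r.
Qed.

End FixedPoint.
End Perron.

(** * Smooth dependence on the initial state *)

Section TangentSystem.
Context {R : realType}.

Lemma usubmxE_mul m n (x : 'cV[R]_(m + n)) : usubmx x = row_mx 1%:M 0 *m x.
Proof. by rewrite -[in RHS](vsubmxK x) mul_row_col mul1mx mul0mx addr0. Qed.

Lemma CkOn_usub m n k (V : normedModType R) (g : 'cV[R]_m -> V) :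
  CkOn k g setT -> CkOn k (fun x : 'cV[R]_(m + n) => g (usubmx x)) setT.
Proof.
move=> Cg; rewrite (_ : (fun x => _) = fun x : 'cV[R]_(m + n) => g (row_mx 1%:M 0 *m x + 0)).
  by apply: CkOn_comp_affine Cg => //; exact: openT.
by apply/funext => x; rewrite usubmxE_mul addr0.
Qed.

Lemma lip_derive p q (g : 'cV[R]_p -> 'cV[R]_q) r c (x d : 'cV[R]_p) :
  differentiable g x -> liponball g r c -> `|x| < r -> `|'D_d g x| <= c * `|d|.
Proof.
move=> dg lg xr; have [->|d0] := eqVneq d 0.
  by rewrite derive0 !normr0 mulr0.
have nd0 : 0 < `|d| by rewrite normr_gt0.
rewrite -ler_pdivrMr//; apply/ler_addgt0Pr => eps; move: (eps : R) => e {eps} e0; rewrite ler_pdivrMr//.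
have [z z0 Hz] := diff_eps dg e0.
(* The step is small enough for the differentiability estimate and also keeps [x + s d] in the ball
   where [g] is Lipschitz. *)
pose s : R := Num.min z (r - `|x|) / (2 * `|d|).
have m0 : 0 < Num.min z (r - `|x|) by rewrite lt_min z0 subr_gt0.
have s0 : 0 < s by rewrite divr_gt0// mulr_gt0.
have nsd : `|s *: d| = Num.min z (r - `|x|) / 2.
  by rewrite normrZ gtr0_norm// /s; field; rewrite gt_eqF.
have sz : `|s *: d| < z.
  rewrite nsd.
  have : Num.min z (r - `|x|) <= z by rewrite ge_min lexx.
  lra.
have sr : `|x + s *: d| <= r.
  apply: le_trans (ler_normD _ _) _; rewrite nsd.
  have : Num.min z (r - `|x|) <= r - `|x| by rewrite ge_min lexx orbT.
  lra.
have H1 := Hz _ sz; have H2 := lg _ _ sr (ltW xr).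
rewrite [x + _ - x]addrAC subrr add0r in H2.
have E : 'D_(s *: d) g x = s *: 'D_d g x by rewrite !deriveE// linearZ.
have : `|'D_(s *: d) g x| <= (c + e) * `|s *: d|.
  have -> : 'D_(s *: d) g x = (g (x + s *: d) - g x) - (g (x + s *: d) - g x - 'D_(s *: d) g x).
    by rewrite subKr.
  by apply: le_trans (ler_normB _ _) _; rewrite mulrDl lerD.
have -> : `|s *: d| = s * `|d| by rewrite normrZ gtr0_norm.
have -> : `|'D_(s *: d) g x| = s * `|'D_d g x| by rewrite E normrZ gtr0_norm.
by rewrite mulrCA ler_pM2l.
Qed.

Variables (N : nat) (G : 'cV[R]_N -> 'cV[R]_N).

Definition tanG (x : 'cV[R]_(N + N)) : 'cV[R]_(N + N) :=
  col_mx (G (usubmx x)) ('D_(dsubmx x) G (usubmx x)).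

Lemma tanG_Ck k : CkOn k.+1 G setT -> CkOn k tanG setT.
Proof.
move=> CG; have [dG DG] := CG; apply: CkOn_coords; first exact: openT.
move=> i; case: (split_ordP i) => j ->.
  rewrite (_ : (fun x => _) = fun x : 'cV[R]_(N + N) => G (usubmx x) j 0).
    by apply: (@CkOn_usub _ _ _ _ (fun x => G x j 0)); apply: CkOn_coord; [exact: openT|exact: CkOn_pred].
  by apply/funext => x; rewrite /tanG col_mxEu.
rewrite (_ : (fun x => _) = fun x : 'cV[R]_(N + N) =>
    \sum_l x (rshift N l) 0 *: ('D_(delta_mx l 0) G (usubmx x) j 0 : R)).
  apply: CkOn_sum => [|l]; first exact: openT.
  apply: CkOnZ; first exact: openT.
    by apply: CkOn_proj; exact: openT.
  apply: (@CkOn_usub _ _ _ _ (fun x => 'D_(delta_mx l 0) G x j 0)).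
  by apply: CkOn_coord; [exact: openT|exact: DG].
apply/funext => x; rewrite /tanG col_mxEd (cV_linear_sum _ (diff_linear (dG _ I))).
by rewrite summxE; apply: eq_bigr => l _; rewrite !mxE.
Qed.

Lemma tanG0 : G 0 = 0 -> tanG 0 = 0.
Proof. by move=> G0; rewrite /tanG !linear0 derive0 G0 col_mx0. Qed.

(** Both components at [h] are at most [e |h|], with [e] an arbitrarily small Lipschitz constant of
    [G] near 0. The tangent system thus meets the hypotheses of the original one, and the induction
    can be repeated on it. *)
Lemma tanG_flat : CkOn 2 G setT -> G 0 = 0 -> (forall v, 'D_v G 0 = 0) ->
  forall v, 'D_v tanG 0 = 0.
Proof.
move=> CG G0 DG0; have C1 : CkOn 1 G setT by exact: CkOn_pred.
have [dG _] := CG.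
have [||_ H v] := @diff_cV _ _ _ tanG (fun=> 0) 0; last exact: H.
  by move=> a u v; rewrite scaler0 addr0.
move=> e e0; have [r r0 lr] := C1_flat e0 C1 DG0.
exists r => // h hr; rewrite add0r tanG0// !subr0; apply: norm_col_mx.
  have hu : `|usubmx h| <= r by apply: le_trans (norm_usubmx h) _; exact: ltW.
  have := lr _ 0 hu; rewrite normr0 G0 !subr0 => /(_ (ltW r0)) /le_trans; apply.
  by rewrite ler_wpM2l ?(ltW e0)// norm_usubmx.
apply: le_trans (lip_derive _ (dG _ I) lr _) _.
  exact: le_lt_trans (norm_usubmx h) hr.
by rewrite ler_wpM2l ?(ltW e0)// norm_dsubmx.
Qed.

End TangentSystem.

Section SolutionSmoothness.
Context {R : realType}.
Variables (e : R -> R).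
Hypothesis we : weight e.

Section Tangent.
Variables (n N : nat) (Psi : 'cV[R]_n -> R -> 'cV[R]_N).
Variables (S : (R -> 'cV[R]_N) -> R -> 'cV[R]_N) (K : R).
Hypothesis so : solop e Psi S K.

Definition tanPsi (x : 'cV[R]_(n + n)) (t : R) : 'cV[R]_(N + N) :=
  col_mx (Psi (usubmx x) t) (Psi (dsubmx x) t).

Definition tanS (h : R -> 'cV[R]_(N + N)) (t : R) : 'cV[R]_(N + N) :=
  col_mx (S (fun s => usubmx (h s)) t) (S (fun s => dsubmx (h s)) t).

Lemma bd_usub (h : R -> 'cV[R]_(N + N)) H : bd e h H -> bd e (fun t => usubmx (h t)) H.
Proof. by move=> b t; apply: le_trans (norm_usubmx _) (b t). Qed.

Lemma bd_dsub (h : R -> 'cV[R]_(N + N)) H : bd e h H -> bd e (fun t => dsubmx (h t)) H.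
Proof. by move=> b t; apply: le_trans (norm_dsubmx _) (b t). Qed.

Lemma tan_solop : solop e tanPsi tanS K.
Proof.
have K0 := solop_K so; split=> //.
- move=> h H ch bh.
  have [c1 b1] := solop_bd so (cmx_usub ch) (bd_usub bh).
  have [c2 b2] := solop_bd so (cmx_dsub ch) (bd_dsub bh).
  by split; [exact: cmx_col|move=> t; exact: norm_col_mx].
- move=> h h' H H' a ch ch' bh bh' t; rewrite /tanS.
  rewrite scale_col_mx add_col_mx.
  rewrite -(solop_lin so _ (cmx_usub ch) (cmx_usub ch') (bd_usub bh) (bd_usub bh')).
  rewrite -(solop_lin so _ (cmx_dsub ch) (cmx_dsub ch') (bd_dsub bh) (bd_dsub bh')).
  by congr col_mx; congr (S _ t); apply/funext => s; rewrite linearP.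
- move=> v; have [c1 b1] := solop_init so (usubmx v); have [c2 b2] := solop_init so (dsubmx v).
  split; first exact: cmx_col.
  move=> t; apply: norm_col_mx.
    apply: le_trans (b1 t) _; rewrite ler_wpM2r ?weight_ge0// ler_wpM2l ?(ltW K0)//.
    exact: norm_usubmx.
  apply: le_trans (b2 t) _; rewrite ler_wpM2r ?weight_ge0// ler_wpM2l ?(ltW K0)//.
  exact: norm_dsubmx.
- move=> a u v t; rewrite /tanPsi scale_col_mx add_col_mx !linearP.
  by rewrite !(solop_initlin so).
Qed.

Variables (G : 'cV[R]_N -> 'cV[R]_N).
Hypothesis dG : forall x, differentiable G x.

Lemma tan_issol r x zeta : issol e tanPsi tanS (tanG G) r x zeta ->
  let u t := usubmx (zeta t) in let w t := dsubmx (zeta t) in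
  issol e Psi S G r (usubmx x) u /\
  [/\ cmx w, bd e w r & forall t, w t = Psi (dsubmx x) t + S (fun s => 'D_(w s) G (u s)) t].
Proof.
move=> [cz bz Ez] u w; split; split.
- exact: cmx_usub.
- exact: bd_usub.
- move=> t; rewrite {1}/u Ez /tanPsi /tanS add_col_mx col_mxKu; congr (_ + S _ t).
  by apply/funext => s; rewrite /tanG col_mxKu.
- exact: cmx_dsub.
- exact: bd_dsub.
- move=> t; rewrite {1}/w Ez /tanPsi /tanS add_col_mx col_mxKd; congr (_ + S _ t).
  by apply/funext => s; rewrite /tanG col_mxKd.
Qed.

(* The linearisation along [z], with initial datum [v]. *)
Definition isvar (z : R -> 'cV[R]_N) v (w : R -> 'cV[R]_N) :=
  [/\ cmx w, (exists2 H, 0 <= H & bd e w H) &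
      forall t, w t = Psi v t + S (fun s => 'D_(w s) G (z s)) t].

Variables (r c : R).
Hypothesis c0 : 0 <= c.
Hypothesis lG : liponball G r c.
Hypothesis cDG : forall v x, {for x, continuous (fun y => 'D_v G y)}.

Lemma cmx_DG z w : cmx z -> cmx w -> cmx (fun s => 'D_(w s) G (z s)).
Proof.
move=> cz cw i j; rewrite (_ : (fun s => _) = fun s =>
    \sum_l w s l 0 * 'D_(delta_mx l 0) G (z s) i j).
  apply: continuous_sumf => l t; apply: continuousM; first exact: cw.
  have cl : cmx (fun s => 'D_(delta_mx l 0) G (z s)).
    by apply: (@cmx_compG _ _ _ (fun x => 'D_(delta_mx l 0) G x)) => // x; exact: cDG.
  exact: cl.
apply/funext => s; rewrite (cV_linear_sum (w s) (diff_linear (dG (z s)))) summxE.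
by apply: eq_bigr => l _; rewrite !mxE.
Qed.

Lemma bd_DG z w H : 0 <= H -> (forall t, `|z t| < r) -> bd e w H ->
  bd e (fun s => 'D_(w s) G (z s)) (c * H).
Proof.
move=> H0 bz bw t; apply: le_trans (lip_derive _ (dG _) lG (bz t)) _.
by rewrite -mulrA ler_wpM2l.
Qed.

Lemma isvar_lin z a u v wu wv : cmx z -> (forall t, `|z t| < r) ->
  isvar z u wu -> isvar z v wv -> isvar z (a *: u + v) (fun t => a *: wu t + wv t).
Proof.
move=> cz zr [cu [H H0 bu] Eu] [cv [H' H'0 bv] Ev].
have cau : cmx (fun t => a *: wu t).
  rewrite (_ : (fun t => _) = fun t => a%:M *m wu t); last by apply/funext => t; rewrite mul_scalar_mx.
  by apply: cmxM => //; exact: cmx_cst.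
split; first exact: cmxD.
  exists (`|a| * H + H'); first by rewrite addr_ge0// mulr_ge0.
  by apply: bdD => // t; rewrite normrZ -mulrA ler_wpM2l.
move=> t; rewrite (solop_initlin so).
rewrite (_ : (fun s => 'D_(_) G (z s)) = fun s => a *: 'D_(wu s) G (z s) + 'D_(wv s) G (z s)); last first.
  by apply/funext => s; rewrite (diff_linear (dG _)).
rewrite (solop_lin so _ (cmx_DG cz cu) (cmx_DG cz cv) (bd_DG H0 zr bu) (bd_DG H'0 zr bv)).
by rewrite {1}Eu {1}Ev scalerDr addrACA.
Qed.

Lemma isvar0 z : isvar z 0 (fun=> 0).
Proof.
have P0 t : Psi 0 t = 0.
  by have [_ b] := solop_init so 0; apply/eqP; rewrite -normr_le0; have := b t; rewrite normr0 mulr0 mul0r.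
split; first exact: cmx_cst.
  by exists 0 => // t; rewrite normr0 mul0r.
move=> t; rewrite P0 add0r; apply/esym/eqP; rewrite -normr_le0.
have [_ b] : cmx (S (fun s => 'D_0 G (z s))) /\ bd e (S (fun s => 'D_0 G (z s))) (K * 0).
  apply: (solop_bd so); last by move=> s; rewrite derive0 normr0 mul0r.
  rewrite (_ : (fun s => _) = fun=> 0); first exact: cmx_cst.
  by apply/funext => s; rewrite derive0.
by have := b t; rewrite mulr0 mul0r.
Qed.

Lemma isvar_sum z l (a : 'I_l -> R) (v : 'I_l -> 'cV[R]_n) (w : 'I_l -> R -> 'cV[R]_N) :
  cmx z -> (forall t, `|z t| < r) -> (forall j, isvar z (v j) (w j)) ->
  isvar z (\sum_j a j *: v j) (fun t => \sum_j a j *: w j t).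
Proof.
move=> cz zr; elim: l a v w => [|l IH] a v w H.
  rewrite big_ord0 (_ : (fun t => _) = fun=> 0); first exact: isvar0.
  by apply/funext => t; rewrite big_ord0.
rewrite big_ord_recl (_ : (fun t => _) = fun t => a ord0 *: w ord0 t +
  \sum_(j < l) a (lift ord0 j) *: w (lift ord0 j) t).
  by apply: isvar_lin => //; apply: (IH (fun j => a (lift ord0 j)) (fun j => v (lift ord0 j)) (fun j => w (lift ord0 j))).
by apply/funext => t; rewrite big_ord_recl.
Qed.

Hypothesis r0 : 0 < r.
Hypothesis G0 : G 0 = 0.
Hypothesis Kc : K * c <= 2^-1.
Variables (C : R).
Hypothesis C0 : 0 <= C.
Hypothesis tG : forall a b, `|a| <= r -> `|b| <= r ->
  `|G b - G a - 'D_(b - a) G a| <= C * `|b - a| ^+ 2.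

(** The error [z' - z - w] solves the linearised equation forced by the Taylor remainder of [G].
    That remainder is quadratic in [|h|] by the Lipschitz dependence on the initial state, and the
    linear part is absorbed. *)
Lemma solution_expansion (y0 h : 'cV[R]_n) (z z' w : R -> 'cV[R]_N) : (forall t, `|z t| < r) ->
  issol e Psi S G r y0 z -> issol e Psi S G r (y0 + h) z' -> isvar z h w ->
  bd e (fun t => z' t - z t - w t) (2 * (K * (C * (2 * (K * `|h|)) ^+ 2))).
Proof.
move=> zr sz sz' [cw [H H0 bw] Ew]; have [cz bz Ez] := sz; have [cz' bz' Ez'] := sz'.
have K0 := solop_K so.
have cG x : {for x, continuous G} by exact: differentiable_continuous.
have dz := issol_lip we so cG G0 lG r0 c0 Kc sz' sz.
rewrite addrAC subrr add0r in dz.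
set q := 2 * (K * `|h|) in dz *.
have q0 : 0 <= q by rewrite /q !mulr_ge0// ltW.
pose d t := z' t - z t - w t.
have cd : cmx d by apply: cmxB => //; exact: cmxB.
apply: (@bd_absorb _ _ _ we _ _ (r + r + H)).
- move=> X X0 bX.
  pose rem t := G (z' t) - G (z t) - 'D_(z' t - z t) G (z t).
  have brem : bd e rem (C * q ^+ 2).
    move=> t; have zt := bd_norm we t (ltW r0) bz.
    apply: le_trans (tG zt (bd_norm we t (ltW r0) bz')) _.
    rewrite -mulrA ler_wpM2l//.
    apply: (@le_trans _ _ ((q * e t) ^+ 2)).
      by apply: lerXn2r; rewrite ?nnegrE ?(mulr_ge0 q0 (weight_ge0 we t))//; exact: dz.
    rewrite exprMn ler_wpM2l ?sqr_ge0// expr2 ler_piMr ?weight_ge0//.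
    exact: weight_le1.
  have bdd := bd_DG X0 zr bX.
  have cdd := cmx_DG cz cd.
  have crem : cmx rem.
    apply: cmxB; last by apply: cmx_DG => //; exact: cmxB.
    by apply: cmxB; exact: cmx_compG.
  have bsum := bdD bdd brem.
  have [_ bS] := solop_bd so (cmxD cdd crem) bsum.
  have cGz := cmx_compG cG cz; have cGz' := cmx_compG cG cz'.
  have bGz := bd_G we G0 lG r0 c0 bz; have bGz' := bd_G we G0 lG r0 c0 bz'.
  have cDw := cmx_DG cz cw; have bDw := bd_DG H0 zr bw.
  have E t : d t = S (fun s => 'D_(d s) G (z s) + rem s) t.
    rewrite (_ : (fun s => _) = fun s => (G (z' s) - G (z s)) - 'D_(w s) G (z s)); last first.
      apply/funext => s; rewrite /rem /d.
      have -> : z' s - z s - w s = -1 *: w s + (z' s - z s) by rewrite scaleN1r addrC.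
      rewrite (diff_linear (dG _)) scaleN1r.
      by rewrite [LHS](AC (2*2)%AC (3*1*(2*4))%AC)/= subrr addr0.
    rewrite (solop_sub so (cmxB cGz' cGz) cDw (bdB bGz' bGz) bDw).
    rewrite (solop_sub so cGz' cGz bGz' bGz) /d {1}Ez' {1}Ez {1}Ew.
    have -> : Psi (y0 + h) t = Psi h t + Psi y0 t.
      have := solop_initlin so 1 h y0 t; rewrite !scale1r => <-.
      by rewrite addrC.
    rewrite !opprD; set a := Psi h t; set b := Psi y0 t.
    by rewrite [LHS](AC (3*2*2)%AC ((1*6)*(2*4)*3*5*7)%AC)/= !subrr !add0r.
  move=> t; rewrite -[X in `|X|]/(d t) E; apply: le_trans (bS t) _.
  rewrite ler_wpM2r ?weight_ge0// mulrDr addrC lerD//.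
  by rewrite mulrA mulrC ler_wpM2l.
- by rewrite !mulr_ge0 ?sqr_ge0// ltW.
- by rewrite !addr_ge0// ltW.
- by apply: bdB => //; exact: bdB.
Qed.

End Tangent.

(* The solution paired with its derivative in the direction [v] solves the tangent system, which has
   the same form and one derivative less. *)
Lemma solution_Ck k : forall n N (Psi : 'cV[R]_n -> R -> 'cV[R]_N) S K G c r d zeta,
  solop e Psi S K -> CkOn k.+1 G setT -> G 0 = 0 -> (forall v, 'D_v G 0 = 0) ->
  0 < r -> 0 < c -> K * c <= 2^-1 -> liponball G r c -> 0 < d ->
  (forall y0, `|y0| < d -> issol e Psi S G r y0 (zeta y0)) ->
  exists2 d' : R, 0 < d' & forall t, CkOn k (fun y0 => zeta y0 t) (openball d').
Proof.
elim: k => [|k IH] n N Psi S K G c r d zeta so CG G0 DG0 r0 c0 Kc lG d0 sol.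
  have cG x : {for x, continuous G} by exact: (CkOn_cont CG I).
  exists d => // t y0 y0d; apply/continuous_atP => eps eps0.
  have K0 := solop_K so.
  exists (Num.min (d - `|y0|) (eps / (2 * K + 1))) => [|y].
    by rewrite lt_min subr_gt0 y0d divr_gt0// addr_gt0// mulr_gt0.
  rewrite lt_min => /andP[yd ye].
  have yd' : `|y| < d.
    have -> : y = (y - y0) + y0 by rewrite subrK.
    by apply: le_lt_trans (ler_normD _ _) _; rewrite -ltrBrDr.
  have := issol_lip we so cG G0 lG r0 (ltW c0) Kc (sol _ yd') (sol _ y0d) t.
  move=> H; apply: le_lt_trans H _.
  move: ye; rewrite ltr_pdivlMr; last by rewrite addr_gt0// mulr_gt0.
  apply: le_lt_trans; rewrite mulrA.
  have q0 : 0 <= 2 * K * `|y - y0| by rewrite !mulr_ge0// ltW.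
  have := normr_ge0 (y - y0).
  have : 2 * K * `|y - y0| * e t <= 2 * K * `|y - y0| by rewrite ler_piMr// weight_le1.
  lra.
have dG x : differentiable G x by have [H _] := CG; exact: H.
have cG x : {for x, continuous G} by exact: differentiable_continuous.
have cDG v x : {for x, continuous (fun y => 'D_v G y)}.
  by have [_ H] := CG; exact: (@CkOn_cont _ _ _ k.+1 _ setT x (H v) I).
have C2 : CkOn 2 G setT by apply: CkOn_le CG.
have CT := tanG_Ck CG.
have T0 := tanG0 G0; have DT0 := tanG_flat C2 G0 DG0.
have C1T : CkOn 1 (tanG G) setT by apply: CkOn_le CT.
have [r1 r10 lr1] := C1_flat c0 C1T DT0.
have [rT [C [rT0 C0 tG _]]] := C2_taylor C2.
pose r2 : R := Num.min r (Num.min r1 rT).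
have r20 : 0 < r2 by rewrite !lt_min r0 r10.
have r2r : r2 <= r by rewrite ge_min lexx.
have r2r1 : r2 <= r1 by rewrite !ge_min lexx orbT.
have r2rT : r2 <= rT by rewrite !ge_min lexx !orbT.
(* Half the radius leaves room for the strict inequality [|zeta y0 t| < r2], under which the
   Lipschitz constant bounds the derivative of [G]. *)
pose r3 : R := r2 / 2; have r30 : 0 < r3 by rewrite divr_gt0.
have r3r2 : r3 < r2 by rewrite /r3; lra.
have K0 := solop_K so; have soT := tan_solop so.
have cT x : {for x, continuous (tanG G)} by exact: (CkOn_cont CT I).
have lT3 : liponball (tanG G) r3 c by apply: liponball_le lr1; apply: le_trans r2r1; exact: ltW.
pose d2 : R := Num.min d (r3 / (2 * K)).
have d20 : 0 < d2 by rewrite lt_min d0 divr_gt0// mulr_gt0.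
(* A total choice of tangent solutions; beyond radius [d2] the zero function is a default about
   which nothing is claimed. *)
have /boolp.choice[zT HzT] : forall x : 'cV[R]_(n + n), exists z, `|x| < d2 ->
    issol e (tanPsi Psi) (tanS S) (tanG G) r3 x z.
  move=> x; have [xd|] := ltP `|x| d2; last by move=> _; exists (fun=> 0).
  have Kx : K * `|x| <= r3 / 2.
    have : `|x| < r3 / (2 * K) by apply: lt_le_trans xd _; rewrite ge_min lexx orbT.
    by rewrite ltr_pdivlMr ?mulr_gt0//; lra.
  by have [z Hz] := fixed_point we soT cT T0 lT3 r30 (ltW c0) Kc Kx; exists z.
have [d3' d3'0 Hd3] := IH _ _ _ _ _ _ _ _ _ _ soT CT T0 DT0 r30 c0 Kc lT3 d20 HzT.
pose d3 : R := Num.min d2 d3'; have d30 : 0 < d3 by rewrite lt_min d20.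
have d3d2 : d3 <= d2 by rewrite ge_min lexx.
have d3d : d3 <= d by apply: le_trans d3d2 _; rewrite ge_min lexx.
(* Uniqueness identifies the upper half of the tangent solution with [zeta y0], so the lower half is
   a variation along [zeta y0] itself. *)
have uz (y0 v : 'cV[R]_n) : `|y0| < d3 -> `|v| < d3 ->
    isvar Psi S G (zeta y0) v (fun t => dsubmx (zT (col_mx y0 v) t)) /\
    issol e Psi S G r3 y0 (zeta y0).
  move=> y0d vd; have xd : `|col_mx y0 v| < d2.
    by apply: lt_le_trans d3d2; exact: norm_col_mx_lt.
  have [su [cw bw Ew]] := tan_issol (HzT _ xd).
  rewrite col_mxKu col_mxKd in su Ew.
  have E : zeta y0 = (fun t => usubmx (zT (col_mx y0 v) t)).
    apply: (issol_unique we so cG G0 lG r0 (ltW c0) Kc (sol _ _)).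
      exact: lt_le_trans y0d _.
    have [cu bu Eu] := su; split=> //; apply: bd_le bu => //.
    by apply: le_trans r2r; exact: ltW.
  rewrite E; split=> //; split=> //.
  by exists r3 => //; exact: ltW.
(* Tangent solutions are available for small data only: the basis vectors are shrunk by [s0], and
   [L] recovers the derivative in a general direction by linearity. *)
pose s0 : R := d3 / 2; have s00 : 0 < s0 by rewrite divr_gt0.
pose ej (j : 'I_n) : 'cV[R]_n := s0 *: delta_mx j 0.
have ejd j : `|ej j| < d3.
  apply: le_lt_trans (_ : s0 < _); last by rewrite /s0; lra.
  rewrite normrZ gtr0_norm// ler_piMr ?(ltW s00)//.
  apply: mx_norm_le => // a b; rewrite mxE.
  by case: (_ && _); rewrite ?normr1 ?normr0.
pose w (y0 : 'cV[R]_n) j t := dsubmx (zT (col_mx y0 (ej j)) t).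
pose L (y0 v : 'cV[R]_n) (t : R) : 'cV[R]_N := \sum_j (v j 0 / s0) *: w y0 j t.
have lG2 := liponball_le r2r lG.
have main (y0 : 'cV[R]_n) : `|y0| < d3 -> forall t, differentiable (fun y => zeta y t) y0 /\
    forall v, 'D_v (fun y => zeta y t) y0 = L y0 v t.
  move=> y0d t; apply: diff_cV.
    move=> a u v; rewrite /L scaler_sumr -big_split; apply: eq_bigr => j _.
    by rewrite !mxE mulrDl scalerDl scalerA mulrA.
  have [_ sz] := uz y0 0 y0d ltac:(by rewrite normr0).
  have sz2 (y : 'cV[R]_n) : `|y| < d3 -> issol e Psi S G r2 y (zeta y).
    move=> yd; have [_ [cy by_ Ey]] := uz y 0 yd ltac:(by rewrite normr0).
    by split=> //; apply: bd_le by_ => //; exact: ltW.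
  have zr s : `|zeta y0 s| < r2.
    have [_ b _] := sz; apply: le_lt_trans r3r2.
    exact: (bd_norm we s (ltW r30) b).
  have cz : cmx (zeta y0) by case: sz.
  have tG2 a b : `|a| <= r2 -> `|b| <= r2 -> `|G b - G a - 'D_(b - a) G a| <= C * `|b - a| ^+ 2.
    by move=> ar br; apply: tG; exact: le_trans r2rT.
  have var v : isvar Psi S G (zeta y0) v (L y0 v).
    have -> : v = \sum_j (v j 0 / s0) *: ej j.
      rewrite [LHS]cV_delta_sum; apply: eq_bigr => j _.
      by rewrite /ej scalerA divfK// gt_eqF.
    have := isvar_sum so dG (ltW c0) lG2 cDG (fun j => v j 0 / s0) cz zr (fun j => (uz y0 (ej j) y0d (ejd j)).1).
    rewrite (_ : (fun t => _) = L y0 (\sum_j (v j 0 / s0) *: ej j))//.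
    apply/funext => s; rewrite /L; apply: eq_bigr => j _; congr (_ / _ *: _).
    rewrite summxE (bigD1 j)//= big1 => [|i ij].
      by rewrite !mxE !eqxx addr0 mulr1 divfK// gt_eqF.
    by rewrite !mxE eq_sym (negPf ij) !mulr0.
  move=> eps eps0.
  pose Q : R := 2 * (K * (C * (2 * K) ^+ 2)).
  have Q0 : 0 <= Q by rewrite !mulr_ge0 ?sqr_ge0// ltW.
  exists (Num.min (d3 - `|y0|) (eps / (Q + 1))) => [|h].
    by rewrite lt_min subr_gt0 y0d divr_gt0// ltr_wpDl.
  rewrite lt_min => /andP[hd he].
  have yhd : `|y0 + h| < d3 by apply: le_lt_trans (ler_normD _ _) _; lra.
  have := solution_expansion so dG (ltW c0) lG2 cDG r20 G0 Kc C0 tG2 zr (sz2 _ y0d) (sz2 _ yhd) (var h) t.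
  move=> /le_trans; apply.
  have -> : 2 * (K * (C * (2 * (K * `|h|)) ^+ 2)) * e t = Q * `|h| ^+ 2 * e t by rewrite /Q; ring.
  apply: (@le_trans _ _ (Q * `|h| ^+ 2)).
    by rewrite ler_piMr ?weight_le1// mulr_ge0 ?sqr_ge0.
  rewrite expr2 mulrA ler_wpM2r//.
  move: he; rewrite ltr_pdivlMr ?ltr_wpDl// => he.
  by have := normr_ge0 h; lra.
exists d3 => // t; split=> [y0 y0d|v].
  by have [] := main y0 y0d t.
apply: (@CkOn_eq _ _ _ _ (fun y0 => L y0 v t)) => [|y0 y0d|].
- exact: open_openball.
- by have [_ ->] := main y0 y0d t.
apply: CkOn_sum => [|j]; first exact: open_openball.
apply: CkOnZ; [exact: open_openball|exact: CkOn_cst|].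
apply: CkOn_coords => [|i]; first exact: open_openball.
rewrite (_ : (fun x => _) = fun y0 : 'cV[R]_n =>
  zT (col_mx 1%:M 0 *m y0 + col_mx 0 (ej j)) t (rshift N i) 0).
  apply: (@CkOn_comp_affine _ _ _ _ _ (fun x => zT x t (rshift N i) 0) _ _ (openball d3)).
  - exact: open_openball.
  - move=> x xd; rewrite mul_col_mx mul1mx mul0mx add_col_mx addr0 add0r.
    exact: norm_col_mx_lt.
  - apply: CkOn_coord; first exact: open_openball.
    apply: CkOn_sub (Hd3 t) => x /lt_le_trans; apply.
    by rewrite ge_min lexx orbT.
by apply/funext => x; rewrite /w mxE mul_col_mx mul1mx mul0mx add_col_mx addr0 add0r.
Qed.

End SolutionSmoothness.

(** * The linear Hamiltonian system *)

Section ExpWeight.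
Context {R : realType}.

Definition pos (t : R) : R := Num.max t 0.
(* Trajectories are extended to negative times as constants, hence the truncation. *)
Definition expw (g t : R) : R := expR (- (g * pos t)).

Lemma pos_ge0 t : 0 <= pos t. Proof. by rewrite le_max lexx orbT. Qed.

Lemma pos_id t : 0 <= t -> pos t = t. Proof. by move=> t0; apply/max_idPl. Qed.

Lemma pos_le0 t : t <= 0 -> pos t = 0. Proof. by move=> t0; apply/max_idPr. Qed.

Lemma continuous_pos : continuous pos.
Proof.
by move=> t; apply: (@continuous_max _ _ id (cst 0)); [exact: cvg_id|exact: cst_continuous].
Qed.

Lemma weight_expw g : 0 <= g -> weight (expw g).
Proof.
move=> g0; split=> t; first exact: expR_ge0.
by rewrite expR_le1 oppr_le0 mulr_ge0// pos_ge0.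
Qed.

Lemma expw_id g t : 0 <= t -> expw g t = expR (- (g * t)).
Proof. by move=> t0; rewrite /expw pos_id. Qed.

Lemma expw_le0 g t : t <= 0 -> expw g t = 1.
Proof. by move=> t0; rewrite /expw pos_le0// mulr0 oppr0 expR0. Qed.

Lemma bd_expw_ge0 N g (h : R -> 'cV[R]_N) H : bd (expw g) h H -> 0 <= H.
Proof. by move=> /(_ 0); rewrite expw_le0// mulr1; exact: le_trans. Qed.

Lemma dmx_le_diff p (F F' : _) (g dg : R -> R) (a b : R) : a <= b ->
  cmx (F : R -> 'cV[R]_p) -> continuous g ->
  (forall x : R, a < x < b -> dmx F (F' x) x) ->
  (forall x : R, a < x < b -> is_derive x 1 g (dg x)) ->
  (forall x : R, a < x < b -> `|F' x| <= dg x) -> `|F b - F a| <= g b - g a.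
Proof.
move=> ab cF cg dF Dg Fg; apply: cV_norm_le => [|i].
  have := @derive_le_diff _ (cst 0) (cst 0) g dg a b ab.
  rewrite /cst subrr normr0; apply => //.
  - by move=> x; exact: cst_continuous.
  - by move=> x /Fg; exact: le_trans.
rewrite !mxE; apply: (@derive_le_diff _ (fun s => F s i 0) (fun s => F' s i 0) g dg) => //.
- by move=> x /dF; apply.
- by move=> x /Fg; apply: le_trans; exact: mx_coord_le.
Qed.

Lemma primitive0 N (h : R -> 'cV[R]_N) : cmx h ->
  exists H, [/\ cmx H, forall t, t <= 0 -> H t = 0 & forall t : R, 0 < t -> dmx H (h t) t].
Proof.
move=> ch; have [H0 DH] := primitive_mx ch.
exists (fun t => H0 (pos t) - H0 0); split.
- move=> i j t; rewrite (_ : (fun s => _) = (fun s => H0 s i j) \o pos \- cst (H0 0 i j)).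
    apply: continuousB; last exact: cst_continuous.
    apply: continuous_comp; first exact: continuous_pos.
    have [D _] := DH (pos t) (lt_le_trans (ltrN10 _) (pos_ge0 t)) i j.
    by apply: differentiable_continuous; apply/derivable1_diffP.
  by apply/funext => s; rewrite !mxE.
- by move=> t t0; rewrite pos_le0// subrr.
- move=> t t0; apply: (@dmx_near _ _ _ (fun s => H0 s - H0 0) _ _ _ 0) => //.
    by move=> s s0; rewrite pos_id// ltW.
  apply: dmx_eq (dmxB (DH t _) (dmx_cst (H0 0) t)) _; last by rewrite subr0.
  exact: lt_trans t0.
Qed.

Lemma exp_lim (u : R -> R) C k : 0 <= C ->
  (forall t r, 0 <= t -> t <= r -> `|u r - u t| <= C * expR (- (k * t))) ->
  exists l, forall t, 0 <= t -> `|l - u t| <= C * expR (- (k * t)).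
Proof.
move=> C0 H; pose lo t := u t - C * expR (- (k * t)); pose hi t := u t + C * expR (- (k * t)).
have LH t r : 0 <= t -> 0 <= r -> lo t <= hi r.
  move=> t0 r0; have Ct := mulr_ge0 C0 (expR_ge0 (- (k * t))).
  have Cr := mulr_ge0 C0 (expR_ge0 (- (k * r))).
  rewrite /lo /hi; have [tr|rt] := leP t r.
    by have := H t r t0 tr; rewrite ler_norml => /andP[]; lra.
  by have := H r t r0 (ltW rt); rewrite ler_norml => /andP[]; lra.
pose A := [set lo t | t in [set t | 0 <= t]].
have hs : has_sup A.
  split; first by exists (lo 0), 0 => /=.
  by exists (hi 0) => _ [t /= t0 <-]; exact: LH.
exists (sup A) => t t0; rewrite ler_norml.
have H1 : lo t <= sup A by apply: ub_le_sup; [case: hs|exists t].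
have H2 : sup A <= hi t by apply: ge_sup; [case: hs|move=> _ [r /= r0 <-]; exact: LH].
by move: H1 H2; rewrite /lo /hi; lra.
Qed.

Lemma is_derive_expc (c k t : R) :
  is_derive t 1 (fun s => c * expR (k * s)) (c * (k * expR (k * t))).
Proof.
apply: is_derive_eq (is_derive_mulf (is_derive_cst c t 1) (is_derive_expl k t)) _.
by rewrite mul0r add0r.
Qed.
End ExpWeight.

(** * Variation of constants, forward for the stable and from infinity for the antistable
    equation *)

Section LinearSolutions.
Context {R : realType}.
Variables (n : nat) (A : 'M[R]_n) (M w : R).
Hypothesis w0 : 0 < w.
Hypothesis AM : decays A M w.
(** Half the decay rate of the flow: convolving a forcing of rate [g] with the faster exponential of
    rate [w] preserves the rate [g] at the price of a factor [1 / g]. *)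
Let g := w / 2.
Let g0 : 0 < g. Proof. by rewrite divr_gt0. Qed.
Let we := weight_expw (ltW g0).

Let M0 : 0 <= M.
Proof. by have := AM (lexx 0); rewrite mulr0 oppr0 expR0 mulr1; exact: le_trans. Qed.

(** The integral over [[0, t]] of [mexp A (t - s) *m h s], with [mexp A t] pulled out of a
    primitive. The factor is put back before estimating, since [mexp A (- s)] alone may grow. *)
Lemma stable_solution (h : R -> 'cV[R]_n) H : cmx h -> bd (expw g) h H ->
  exists y, [/\ cmx y, bd (expw g) y (n%:R * M / g * H),
    forall t, t <= 0 -> y t = 0 & forall t : R, 0 < t -> dmx y (A *m y t + h t) t].
Proof.
move=> ch bh; have H0 := bd_expw_ge0 bh.
have cE : cmx (fun s => mexp A (- s)).
  exact: (dmx_cmx (dmx_mexpN A)).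
have [F [cF F0 dF]] := primitive0 (cmxM cE ch).
exists (fun t => mexp A (pos t) *m F t); split.
- have cEp : cmx (fun t => mexp A (pos t)) by have := cmx_comp continuous_pos (@cmx_mexp _ _ A).
  exact: (cmxM cEp cF).
- move=> t; have [t0|t0] := leP t 0.
    rewrite F0// mulmx0 normr0 !mulr_ge0 ?expR_ge0 ?invr_ge0//; exact: ltW.
  rewrite pos_id ?(ltW t0)// expw_id ?(ltW t0)//.
  pose c := n%:R * M / g * H * expR (- (w * t)).
  have -> : mexp A t *m F t = mexp A t *m F t - mexp A t *m F 0 by rewrite (F0 0 (lexx 0)) mulmx0 subr0.
  apply: le_trans (@dmx_le_diff _ _ (fun s => mexp A t *m F s)
    (fun s => mexp A t *m (mexp A (- s) *m h s))
    (fun s => c * expR (g * s)) (fun s => c * (g * expR (g * s))) 0 t (ltW t0) _ _ _ _ _) _.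
  + by apply: cmxM => //; exact: cmx_cst.
  + by apply: continuous_derive => s; exact: is_derive_expc.
  + by move=> s /andP[s0 _]; apply: dmxMl; exact: dF.
  + by move=> s _; exact: is_derive_expc.
  + move=> s /andP[s0 st]; rewrite mulmxA -mexpD.
    have ts : 0 <= - s + t by rewrite addrC subr_ge0 ltW.
    apply: le_trans (mulmx_normx (AM ts) (bh s)) _.
    rewrite expw_id ?(ltW s0)// /c.
    have -> : expR (- (w * (- s + t))) = expR (- (w * t)) * (expR (g * s) * expR (g * s)).
      by rewrite -!expRD; congr expR; rewrite /g; lra.
    have -> : n%:R * (M * (expR (- (w * t)) * (expR (g * s) * expR (g * s)))) * (H * expR (- (g * s)))
       = n%:R * M * H * expR (- (w * t)) * expR (g * s) * (expR (g * s) * expR (- (g * s))) by ring.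
    rewrite expRxMexpNx_1 mulr1 le_eqVlt; apply/orP; left; apply/eqP.
    by field; rewrite gt_eqF.
  have c0 : 0 <= c by rewrite !mulr_ge0 ?expR_ge0 ?invr_ge0//; exact: ltW.
  rewrite mulr0 expR0 mulr1 /c -mulrA -expRD.
  have -> : - (w * t) + g * t = - (g * t) by rewrite /g; lra.
  by rewrite lerBlDr lerDl.
- by move=> t t0; rewrite F0// mulmx0.
- move=> t t0; apply: (@dmx_near _ _ _ (fun s => mexp A s *m F s) _ _ _ 0) => //.
    by move=> s s0; rewrite pos_id// ltW.
  rewrite pos_id ?(ltW t0)//.
  apply: dmx_eq (dmxM (dmx_mexp A t) (dF t t0)) _.
  by rewrite -mulmxA mulmxA [mexp A t *m (mexp A (- t) *m _)]mulmxA mexpN mul1mx.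
Qed.

(** The adjoint flow expands, so the decaying solution is minus the integral of
    [(mexp A (s - t))^T *m h s] over [s >= t]. Here [L] is the limit of the primitive [F], and the
    initial value [q 0] is dictated by the forcing. *)
Lemma unstable_solution (h : R -> 'cV[R]_n) H : cmx h -> bd (expw g) h H ->
  exists q, [/\ cmx q, bd (expw g) q (n%:R * M / g * H),
    forall t, t <= 0 -> q t = q 0 & forall t : R, 0 < t -> dmx q (- (A^T *m q t) + h t) t].
Proof.
move=> ch bh; have H0 := bd_expw_ge0 bh.
have [F [cF F0 dF]] := primitive0 (cmxM (cmx_tr (@cmx_mexp _ _ A)) ch).
pose c := n%:R * M / g * H.
have c0 : 0 <= c by rewrite !mulr_ge0 ?invr_ge0//; exact: ltW.
have cE : cmx (fun s => mexp A (- s)).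
  exact: (dmx_cmx (dmx_mexpN A)).
have key t r : 0 <= t -> t <= r ->
    `|(mexp A (- t))^T *m F r - (mexp A (- t))^T *m F t| <= c * expR (- (g * t)).
  (* [c' * expR (- (w + g) * s)] is a primitive in [s] of the majorant of the integrand, which
     decays because the exponential is evaluated at [s - t >= 0]. *)
  move=> t0 tr; pose c' := - (n%:R * M / (w + g) * H) * expR (w * t).
  apply: le_trans (@dmx_le_diff _ _ (fun s => (mexp A (- t))^T *m F s)
    (fun s => (mexp A (- t))^T *m ((mexp A s)^T *m h s))
    (fun s => c' * expR (- (w + g) * s)) (fun s => c' * (- (w + g) * expR (- (w + g) * s))) t r tr _ _ _ _ _) _.
  + by apply: cmxM => //; exact: cmx_cst.
  + by apply: continuous_derive => s; exact: is_derive_expc.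
  + by move=> s /andP[s0 _]; apply: dmxMl; apply: dF; exact: le_lt_trans s0.
  + by move=> s _; exact: is_derive_expc.
  + move=> s /andP[s0 st]; rewrite mulmxA -trmx_mul -mexpD.
    have ts : 0 <= - t + s by rewrite addrC subr_ge0 ltW.
    have Es : `|(mexp A (- t + s))^T| <= M * expR (- (w * (- t + s))).
      by rewrite trmx_norm; exact: AM.
    apply: le_trans (mulmx_normx Es (bh s)) _.
    have s00 : 0 <= s by apply: le_trans t0 _; exact: ltW.
    rewrite expw_id// /c'.
    have -> : expR (- (w * (- t + s))) = expR (w * t) * expR (- (w * s)).
      by rewrite -!expRD; congr expR; lra.
    have -> : expR (- (w + g) * s) = expR (- (w * s)) * expR (- (g * s)).
      by rewrite -!expRD; congr expR; lra.
    rewrite le_eqVlt; apply/orP; left; apply/eqP.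
    by field; rewrite gt_eqF// addr_gt0.
  have e0 := expR_ge0 (- (w + g) * r).
  have D0 : 0 <= n%:R * M / (w + g) * H by rewrite !mulr_ge0 ?invr_ge0 ?addr_ge0// ltW.
  have -> : c' * expR (- (w + g) * t) = - (n%:R * M / (w + g) * H * expR (- (g * t))).
    rewrite /c' mulNr -mulNr -mulrA -expRD mulNr; congr (- (_ * expR _)); lra.
  have : n%:R * M / (w + g) * H * expR (- (g * t)) <= c * expR (- (g * t)).
    rewrite ler_wpM2r ?expR_ge0// /c ler_wpM2r// ler_wpM2l ?mulr_ge0//.
    by rewrite lef_pV2 ?posrE ?addr_gt0// lerDr ltW.
  have := mulr_ge0 D0 (mulr_ge0 (expR_ge0 (w * t)) e0); rewrite /c'; lra.
have limF i : exists l, forall t, 0 <= t -> `|l - F t i 0| <= (n%:R * M * H / (w + g)) * expR (- ((w + g) * t)).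
  have wg : 0 < w + g by rewrite addr_gt0.
  have D0 : 0 <= n%:R * M * H / (w + g) by rewrite !mulr_ge0 ?invr_ge0// ltW.
  apply: exp_lim => // t r t0 tr.
  pose D := n%:R * M * H / (w + g).
  have -> : F r i 0 - F t i 0 = (F r - F t) i 0 by rewrite !mxE.
  apply: le_trans (mx_coord_le _ i 0) _.
  apply: le_trans (@dmx_le_diff _ _ F (fun s => (mexp A s)^T *m h s)
    (fun s => - D * expR (- (w + g) * s)) (fun s => - D * (- (w + g) * expR (- (w + g) * s))) t r tr _ _ _ _ _) _ => //.
  + by apply: continuous_derive => s; exact: is_derive_expc.
  + by move=> s /andP[s0 _]; apply: dF; exact: le_lt_trans s0.
  + by move=> s _; exact: is_derive_expc.
  + move=> s /andP[s0 st]; have s00 : 0 <= s by apply: le_trans t0 _; exact: ltW.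
    have Es : `|(mexp A s)^T| <= M * expR (- (w * s)) by rewrite trmx_norm; exact: AM.
    apply: le_trans (mulmx_normx Es (bh s)) _; rewrite expw_id//.
    have -> : expR (- (w + g) * s) = expR (- (w * s)) * expR (- (g * s)).
      by rewrite -!expRD; congr expR; lra.
    rewrite le_eqVlt; apply/orP; left; apply/eqP.
    by rewrite /D; field; rewrite gt_eqF.
  have -> : - (w + g) * t = - ((w + g) * t) by lra.
  have := mulr_ge0 D0 (expR_ge0 (- (w + g) * r)); rewrite /D; lra.
pose L : 'cV[R]_n := \col_i projT1 (cid (limF i)).
have LF t : 0 <= t -> `|L - F t| <= n%:R * M * H / (w + g) * expR (- ((w + g) * t)).
  move=> t0; apply: cV_norm_le => [|i].
    by rewrite !mulr_ge0 ?expR_ge0 ?invr_ge0 ?addr_ge0// ltW.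
  by rewrite !mxE; case: cid => l /= Hl; exact: Hl.
exists (fun t => (mexp A (- pos t))^T *m (F t - L)); split.
- have cEp : cmx (fun t => mexp A (- pos t)) by have := cmx_comp continuous_pos cE.
  exact: (cmxM (cmx_tr cEp) (cmxB cF (@cmx_cst _ _ _ L))).
(* The prefactor may grow with [t], so the tail of the integral is cut off at a time [r'] depending
   on [t]; up to [r'] the estimate [key] applies. *)
- have bound t : 0 <= t -> `|(mexp A (- t))^T *m (F t - L)| <= c * expR (- (g * t)).
    move=> t0; apply/ler_addgt0Pr => eps eps0.
    have wg : 0 < w + g by rewrite addr_gt0.
    have [r r0 Hr] := @exp_small _ (n%:R * `|(mexp A (- t))^T| * (n%:R * M * H / (w + g))) (w + g) eps wg eps0.
    pose r' := Num.max r t.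
    have tr' : t <= r' by rewrite le_max lexx orbT.
    have rr' : r <= r' by rewrite le_max lexx.
    have -> : (mexp A (- t))^T *m (F t - L) =
      - ((mexp A (- t))^T *m F r' - (mexp A (- t))^T *m F t) - (mexp A (- t))^T *m (L - F r').
      by rewrite -!mulmxBr -mulmxN -mulmxBr; congr (_ *m _); rewrite opprB opprB addrA subrK.
    apply: le_trans (ler_normB _ _) _; rewrite normrN lerD//; first exact: key.
    apply: le_trans (norm_mulmx _ _) _.
    have r'0 : 0 <= r' by exact: le_trans tr'.
    apply: le_trans (ler_wpM2l _ (LF _ r'0)) _; first by rewrite mulr_ge0.
    apply: le_trans (ltW Hr); rewrite mulrA ler_wpM2l//.
      by rewrite !mulr_ge0 ?invr_ge0//; exact: ltW.
    by rewrite ler_expR lerN2 ler_pM2l.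
  move=> t; have [t0|t0] := leP t 0.
    rewrite pos_le0// expw_le0// mulr1 F0//.
    by have := bound 0 (lexx 0); rewrite F0// mulr0 oppr0 expR0 mulr1.
  by rewrite pos_id ?(ltW t0)// expw_id ?(ltW t0)//; apply: bound; exact: ltW.
- by move=> t t0; rewrite pos_le0// pos_le0// !F0.
- move=> t t0; apply: (@dmx_near _ _ _ (fun s => (mexp A (- s))^T *m (F s - L)) _ _ _ 0) => //.
    by move=> s s0; rewrite pos_id// ltW.
  rewrite pos_id ?(ltW t0)//.
  apply: dmx_eq (dmxM (dmx_tr (dmx_mexpN A t)) (dmxB (dF t t0) (dmx_cst L t))) _.
  rewrite subr0 mulmxA -trmx_mul mexpN trmx1 mul1mx; congr (_ + h t).
  by rewrite linearN/= mexp_comm trmx_mul mulNmx mulmxA.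
Qed.

Lemma stable_unique (y : R -> 'cV[R]_n) : cmx y -> y 0 = 0 ->
  (forall t : R, 0 < t -> dmx y (A *m y t) t) -> forall t, 0 <= t -> y t = 0.
Proof.
move=> cy y0 dy t t0.
have cE : cmx (fun s => mexp A (- s)).
  exact: (dmx_cmx (dmx_mexpN A)).
have : mexp A (- t) *m y t = mexp A (- 0) *m y 0.
  apply: (@dmx0_cst _ _ _ (fun s => mexp A (- s) *m y s)) => //.
    exact: cmxM.
  move=> s /andP[s0 _]; apply: dmx_eq (dmxM (dmx_mexpN A s) (dy s s0)) _.
  by rewrite mulNmx mulmxA mexp_comm addrC subrr.
rewrite y0 mulmx0 => /(congr1 (mulmx (mexp A t))).
by rewrite mulmxA mexpN mul1mx mulmx0.
Qed.

(** [(mexp A t)^T *m q t] is constant, and it tends to 0 because [q] is bounded while the flow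
    decays. *)
Lemma unstable_unique (q : R -> 'cV[R]_n) H : cmx q -> bd (expw g) q H ->
  (forall t : R, 0 < t -> dmx q (- (A^T *m q t)) t) -> forall t, 0 <= t -> q t = 0.
Proof.
move=> cq bq dq.
have C t : 0 <= t -> (mexp A t)^T *m q t = q 0.
  move=> t0; have -> : q 0 = (mexp A 0)^T *m q 0 by rewrite mexp0 trmx1 mul1mx.
  apply: (@dmx0_cst _ _ _ (fun s => (mexp A s)^T *m q s)) => //.
    by apply: cmxM => //; apply: cmx_tr; exact: cmx_mexp.
  move=> s /andP[s0 _]; apply: dmx_eq (dmxM (dmx_tr (dmx_mexp A s)) (dq s s0)) _.
  by rewrite trmx_mul mulmxN !mulmxA subrr.
have H0 := bd_expw_ge0 bq.
have q0 : q 0 = 0.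
  suff : 0 <= - `|q 0| by rewrite oppr_ge0 normr_le0 => /eqP.
  apply: (@ge0_exp _ _ (n%:R * M * H) w) => // t t0; rewrite lerN2 -(C t t0).
  have Es : `|(mexp A t)^T| <= M * expR (- (w * t)) by rewrite trmx_norm; exact: AM.
  apply: le_trans (mulmx_normx Es (bd_norm we t H0 bq)) _.
  by rewrite le_eqVlt; apply/orP; left; apply/eqP; ring.
move=> t t0; have := C t t0; rewrite q0 => /(congr1 (mulmx (mexp A (- t))^T)).
by rewrite mulmxA -trmx_mul mexpN trmx1 mul1mx mulmx0.
Qed.

End LinearSolutions.

Lemma bd_mul (R : realType) p n (e : R -> R) (X : 'M[R]_(p, n)) (h : R -> 'cV[R]_n) H :
  bd e h H -> bd e (fun t => X *m h t) (n%:R * `|X| * H).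
Proof.
move=> b t; apply: le_trans (norm_mulmx _ _) _.
by rewrite -[leRHS]mulrA ler_wpM2l// mulr_ge0.
Qed.

Lemma cmx_mull (R : realType) p q (X : 'M[R]_(p, q)) (h : R -> 'cV[R]_q) :
  cmx h -> cmx (fun t => X *m h t).
Proof. by move=> ch; apply: cmxM => //; exact: cmx_cst. Qed.

(** * Solution operator of the linear Hamiltonian system *)

Section HamiltonianOperator.
Context {R : realType}.
Variables (n m : nat) (A : 'M[R]_n) (B : 'M[R]_(n, m)) (beta : R) (P : 'M[R]_n).
Let S := ctrlS B beta.
Hypothesis Ps : P^T = P.
Hypothesis RP : ric A B beta P = 0.
Let Ac := A - S *m P.
Variables (M w : R).
Hypothesis w0 : 0 < w.
Hypothesis AM : decays Ac M w.
Let g := w / 2.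
Let e := expw g.
Let g0 : 0 < g. Proof. by rewrite divr_gt0. Qed.
Let we : weight e. Proof. exact: weight_expw (ltW g0). Qed.

Let M0 : 0 <= M.
Proof. by have := AM (lexx 0); rewrite mulr0 oppr0 expR0 mulr1; exact: le_trans. Qed.

Definition ham : 'M[R]_(n + n) := block_mx A (- S) (- 1%:M) (- A^T).

(** The costate has no initial condition; the exponential bound replaces a condition at infinity and
    singles out one solution. *)
Definition hamrel (h z : R -> 'cV[R]_(n + n)) :=
  [/\ cmx z, exists H, bd e z H, forall t, t <= 0 -> z t = z 0, usubmx (z 0) = 0 &
      forall t : R, 0 < t -> dmx z (ham *m z t + h t) t].

(* With [q = p - P y] the Riccati equation decouples [q' = - Ac^T q + ...]
   from [y' = Ac y - S q + ...]. *)
Lemma ham_decouple (y q h1 h2 : 'cV[R]_n) :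
  ham *m col_mx y (P *m y + q) + col_mx h1 h2 =
  col_mx (Ac *m y + (h1 - S *m q))
    (P *m (Ac *m y + (h1 - S *m q)) + (- (Ac^T *m q) + (h2 - P *m h1))).
Proof.
rewrite /ham mul_block_col add_col_mx; congr col_mx.
  by rewrite mulNmx mulmxDr opprD /Ac mulmxBl mulmxA !addrA [LHS](ACl (1*2*4*3)%AC).
have AcT : Ac^T = A^T - P *m S by rewrite /Ac linearB/= trmx_mul Ps ctrlS_sym.
have E : P *m A *m y - P *m S *m P *m y = - (A^T *m P *m y) - y.
  have := congr1 (fun X => X *m y) RP; rewrite /ric !mulmxDl mulNmx mul1mx mul0mx.
  move=> H; apply/eqP; rewrite -subr_eq0 opprB opprK; apply/eqP; rewrite -[RHS]H.
  by rewrite addrA [LHS](ACl (4*1*2*3)%AC).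
rewrite AcT /Ac !mulmxDr !mulmxN mulmxBl !mulmxBr mulmxBl !mulNmx mul1mx !mulmxA opprB.
rewrite E.
by rewrite [RHS](AC (2*2*(2*2))%AC ((3*8)*(5*4)*(2*(1*6)*7))%AC)/= !subrr !add0r.
Qed.

(** [C1] is the constant of both scalar-type estimates above. [K1] and [K2] bound the state and the
    costate produced by a forcing, [K3] and [K4] those produced by an initial state. *)
Let C1 := n%:R * M / g.
Let K1 := C1 * (1 + n%:R * `|S| * (C1 * (1 + n%:R * `|P|))).
Let K2 := n%:R * `|P| * K1 + C1 * (1 + n%:R * `|P|).
Let K3 := n%:R * M.
Let K4 := n%:R * `|P| * K3.
Definition hamK := 1 + K1 + K2 + K3 + K4.

Let C10 : 0 <= C1. Proof. by rewrite !mulr_ge0// invr_ge0 ltW. Qed.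
Let CP0 : 0 <= C1 * (1 + n%:R * `|P|).
Proof. by rewrite mulr_ge0// addr_ge0// mulr_ge0. Qed.
Let K10 : 0 <= K1.
Proof. by rewrite /K1 mulr_ge0// addr_ge0// mulr_ge0// mulr_ge0. Qed.
Let K20 : 0 <= K2. Proof. by rewrite /K2 addr_ge0// mulr_ge0// mulr_ge0. Qed.
Let K30 : 0 <= K3. Proof. by rewrite mulr_ge0. Qed.
Let K40 : 0 <= K4. Proof. by rewrite /K4 mulr_ge0// mulr_ge0. Qed.

Let sum5 (a b c d : R) : 0 <= a -> 0 <= b -> 0 <= c -> 0 <= d ->
  [/\ 0 < 1 + a + b + c + d, a <= 1 + a + b + c + d, b <= 1 + a + b + c + d,
      c <= 1 + a + b + c + d & d <= 1 + a + b + c + d].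
Proof. by move=> ? ? ? ?; split; lra. Qed.

Let hamKs := sum5 K10 K20 K30 K40.

(** The decoupled system is triangular: [q] is found from the forcing alone and then enters the
    stable equation for [y] as a forcing. *)
Lemma hamrel_exists h H : cmx h -> bd e h H -> exists2 z, hamrel h z & bd e z (hamK * H).
Proof.
move=> ch bh; have H0 := bd_expw_ge0 bh.
pose h1 t := usubmx (h t); pose h2 t := dsubmx (h t).
have c1 : cmx h1 by exact: cmx_usub. have c2 : cmx h2 by exact: cmx_dsub.
have b1 : bd e h1 H by exact: bd_usub. have b2 : bd e h2 H by exact: bd_dsub.
have [q [cq bq q0 dq]] := unstable_solution w0 AM
  (cmxB c2 (cmx_mull (X := P) c1)) (bdB b2 (bd_mul P b1)).
have [y [cy by_ y0 dy]] := stable_solution w0 AM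
  (cmxB c1 (cmx_mull (X := S) cq)) (bdB b1 (bd_mul S bq)).
have bp := bdD (bd_mul P by_) bq.
have bz : bd e (fun t => col_mx (y t) (P *m y t + q t)) (hamK * H).
  move=> t; apply: norm_col_mx.
    apply: le_trans (by_ t) _; rewrite ler_wpM2r ?(weight_ge0 we)// -/g -/C1.
    have -> : C1 * (H + n%:R * `|S| * (C1 * (H + n%:R * `|P| * H))) = K1 * H by rewrite /K1; ring.
    by rewrite ler_wpM2r//; case: hamKs.
  apply: le_trans (bp t) _; rewrite ler_wpM2r ?(weight_ge0 we)// -/g -/C1.
  have -> : n%:R * `|P| * (C1 * (H + n%:R * `|S| * (C1 * (H + n%:R * `|P| * H)))) +
     C1 * (H + n%:R * `|P| * H) = K2 * H by rewrite /K2 /K1; ring.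
  by rewrite ler_wpM2r//; case: hamKs.
exists (fun t => col_mx (y t) (P *m y t + q t)) => //; split.
- by apply: cmx_col => //; apply: cmxD => //; exact: cmx_mull.
- by exists (hamK * H).
- by move=> t t0; rewrite !y0// q0.
- by rewrite col_mxKu y0.
- move=> t t0; rewrite -[h t]vsubmxK ham_decouple.
  apply: dmx_col; first exact: dy.
  by apply: dmxD; [apply: dmxMl; exact: dy|exact: dq].
Qed.

Lemma hamrel_lin h h' z z' a : hamrel h z -> hamrel h' z' ->
  hamrel (fun t => a *: h t + h' t) (fun t => a *: z t + z' t).
Proof.
move=> [cz [H bz] z0 uz dz] [cz' [H' bz'] z'0 uz' dz'].
have aE p (f : R -> 'cV[R]_p) : (fun t => a *: f t) = fun t => a%:M *m f t.
  by apply/funext => t; rewrite mul_scalar_mx.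
split.
- apply: cmxD => //; rewrite aE; exact: cmx_mull.
- exists (`|a| * H + H'); apply: bdD => // t.
  by rewrite normrZ -mulrA ler_wpM2l.
- by move=> t t0; rewrite z0// z'0.
- by rewrite linearP/= uz uz' scaler0 addr0.
- move=> t t0; apply: dmx_eq (dmxD _ (dz' t t0)) _.
  + by rewrite aE; apply: dmxMl; exact: dz.
  + by rewrite mul_scalar_mx scalerDr mulmxDr -scalemxAr addrACA.
Qed.

(** In the decoupled variables, decay forces [q = 0], and then [y] solves the stable equation from
    the initial value 0. *)
Lemma hamrel0 z : hamrel (fun=> 0) z -> z = fun=> 0.
Proof.
move=> [cz [H bz] z0 uz dz].
pose y t := usubmx (z t); pose p t := dsubmx (z t); pose q t := p t - P *m y t.
have zE t : z t = col_mx (y t) (P *m y t + q t).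
  by rewrite /q addrC subrK vsubmxK.
have cy : cmx y by exact: cmx_usub. have cp : cmx p by exact: cmx_dsub.
have cq : cmx q by apply: cmxB => //; exact: cmx_mull.
have by_ : bd e y H by exact: bd_usub. have bp : bd e p H by exact: bd_dsub.
have bq := bdB bp (bd_mul P by_).
have dz' (t : R) : 0 < t -> dmx z (col_mx (Ac *m y t - S *m q t)
    (P *m (Ac *m y t - S *m q t) - (Ac^T *m q t))) t.
  move=> t0; apply: dmx_eq (dz t t0) _.
  rewrite zE -[X in _ + X]col_mx0 ham_decouple !sub0r mulmx0.
  by rewrite ?oppr0 ?subr0 ?addr0.
have dy (t : R) : 0 < t -> dmx y (Ac *m y t - S *m q t) t.
  move=> t0 i j; have := dz' t t0 (lshift n i) j; rewrite col_mxEu.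
  by rewrite (_ : (fun s => z s _ _) = fun s => y s i j)//; apply/funext => s; rewrite mxE.
have dp (t : R) : 0 < t -> dmx p (P *m (Ac *m y t - S *m q t) - (Ac^T *m q t)) t.
  move=> t0 i j; have := dz' t t0 (rshift n i) j; rewrite col_mxEd.
  by rewrite (_ : (fun s => z s _ _) = fun s => p s i j)//; apply/funext => s; rewrite mxE.
have dq (t : R) : 0 < t -> dmx q (- (Ac^T *m q t)) t.
  move=> t0; apply: dmx_eq (dmxB (dp t t0) (dmxMl P (dy t t0))) _.
  by rewrite addrAC subrr add0r.
have q0 := unstable_unique w0 AM cq bq dq.
have y0 : forall t, 0 <= t -> y t = 0.
  apply: (stable_unique (A := Ac)) => // t t0.
  by have := dy t t0; rewrite q0 ?(ltW t0)// mulmx0 subr0.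
have zp t : 0 <= t -> z t = 0 by move=> t0; rewrite zE y0// q0// mulmx0 addr0 col_mx0.
apply/funext => t; have [t0|t0] := leP t 0; first by rewrite z0// zp.
by rewrite zp// ltW.
Qed.

Lemma hamrel_unique h z z' : hamrel h z -> hamrel h z' -> z = z'.
Proof.
move=> s s'; have := hamrel_lin (-1) s s'.
rewrite (_ : (fun t => -1 *: h t + h t) = fun=> 0); last first.
  by apply/funext => t; rewrite scaleN1r addrC subrr.
move=> /hamrel0 E; apply/funext => t; have /(congr1 (fun f => f t)) := E.
by rewrite scaleN1r addrC => /eqP; rewrite subr_eq0 => /eqP ->.
Qed.

(** [hamrel] is functional, so choice turns it into an operator; a forcing without a solution is
    sent to 0. *)
Definition hamS h : R -> 'cV[R]_(n + n) :=
  if pselect (exists z, hamrel h z) is left ex then projT1 (cid ex) else fun=> 0.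

Lemma hamSE h z : hamrel h z -> hamS h = z.
Proof.
move=> hz; rewrite /hamS; case: pselect => [ex|nex]; last by exfalso; apply: nex; exists z.
by apply: hamrel_unique hz; exact: projT2 (cid ex).
Qed.

(** The stable subspace of the Hamiltonian matrix is the graph of [P], hence the costate [P y] along
    the closed-loop flow. *)
Definition hamPsi (v : 'cV[R]_n) t : 'cV[R]_(n + n) :=
  col_mx (mexp Ac (pos t) *m v) (P *m (mexp Ac (pos t) *m v)).

Lemma hamSP h H : cmx h -> bd e h H -> hamrel h (hamS h) /\ bd e (hamS h) (hamK * H).
Proof. by move=> ch bh; have [z rz bz] := hamrel_exists ch bh; rewrite (hamSE rz). Qed.

Lemma ham_solop : solop e hamPsi hamS hamK.
Proof.
split.
- by case: hamKs.
- by move=> h H ch bh; have [[cS _ _ _ _] bS] := hamSP ch bh.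
- move=> h h' H H' a ch ch' bh bh' t.
  have [r _] := hamSP ch bh; have [r' _] := hamSP ch' bh'.
  by rewrite (hamSE (hamrel_lin a r r')).
- move=> v; have cEv : cmx (fun t => mexp Ac (pos t) *m v).
    have cEp : cmx (fun t => mexp Ac (pos t)) by have := cmx_comp continuous_pos (@cmx_mexp _ _ Ac).
    exact: (cmxM cEp (@cmx_cst _ _ _ v)).
  have bEv : bd e (fun t => mexp Ac (pos t) *m v) (K3 * `|v|).
    move=> t; apply: le_trans (mulmx_normx (AM (pos_ge0 t)) (lexx _)) _.
    rewrite /K3 /e /expw -!mulrA ler_wpM2l// ler_wpM2l// mulrC ler_wpM2l//.
    by rewrite ler_expR lerN2; have := mulr_ge0 (ltW w0) (pos_ge0 t); lra.
  split; first by apply: cmx_col => //; exact: cmx_mull.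
  move=> t; apply: norm_col_mx.
    apply: le_trans (bEv t) _; rewrite ler_wpM2r ?(weight_ge0 we)// ler_wpM2r//.
    by case: hamKs.
  apply: le_trans (bd_mul P bEv t) _; rewrite ler_wpM2r ?(weight_ge0 we)// mulrA ler_wpM2r//.
  by case: hamKs.
- move=> a u v t; rewrite /hamPsi scale_col_mx add_col_mx !mulmxDr -!scalemxAr.
  by rewrite !mulmxA.
Qed.

Lemma ham_ode G r H (y0 : 'cV[R]_n) z : issol e hamPsi hamS G r y0 z ->
  cmx (fun s => G (z s)) -> bd e (fun s => G (z s)) H ->
  usubmx (z 0) = y0 /\ forall t : R, 0 < t -> dmx z (ham *m z t + G (z t)) t.
Proof.
move=> [cz bz Ez] cG bG; have [[cS [H' bS] S0 uS dS] _] := hamSP cG bG.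
split.
  by rewrite Ez linearD/= uS addr0 /hamPsi col_mxKu pos_id// mexp0 mul1mx.
move=> t t0.
have zE : z = fun t => hamPsi y0 t + hamS (fun s => G (z s)) t by apply/funext => s; exact: Ez.
have dP : dmx (hamPsi y0) (ham *m hamPsi y0 t) t.
  apply: (@dmx_near _ _ _ (fun s => col_mx (mexp Ac s *m y0) (P *m (mexp Ac s *m y0))) _ _ _ 0) => //.
    by move=> s s0; rewrite /hamPsi pos_id// ltW.
  have dE : dmx (fun s => mexp Ac s *m y0) (Ac *m (mexp Ac t *m y0)) t.
    by apply: dmx_eq (dmxMr y0 (dmx_mexp Ac t)) _; rewrite mulmxA.
  apply: dmx_eq (dmx_col dE (dmxMl P dE)) _.
  rewrite /hamPsi pos_id ?(ltW t0)//; set y := mexp Ac t *m y0.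
  have := ham_decouple y 0 0 0; rewrite !mulmx0 !subr0 oppr0 !addr0 col_mx0 addr0.
  by move=> ->.
rewrite [X in dmx X]zE.
apply: dmx_eq (dmxD dP (dS t t0)) _.
by rewrite addrA -mulmxDr -Ez.
Qed.

End HamiltonianOperator.

(** * Square-integrable functions *)

Section IntegrableReal.
Context {d : measure_display} {T : measurableType d} {R : realType}.
Variable mu : {measure set T -> \bar R}.

Lemma integrableZ_fun (D : set T) (a : R) (f : T -> R) : measurable D ->
  mu.-integrable D (EFin \o f) -> mu.-integrable D (EFin \o (fun t => a * f t)).
Proof. by move=> mD If; have := integrableZl mD a If. Qed.

Lemma integrableD_fun (D : set T) (f g : T -> R) : measurable D ->
  mu.-integrable D (EFin \o f) -> mu.-integrable D (EFin \o g) ->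
  mu.-integrable D (EFin \o (fun t => f t + g t)).
Proof. by move=> mD If Ig; have := integrableD mD If Ig. Qed.

Lemma integrableB_fun (D : set T) (f g : T -> R) : measurable D ->
  mu.-integrable D (EFin \o f) -> mu.-integrable D (EFin \o g) ->
  mu.-integrable D (EFin \o (fun t => f t - g t)).
Proof. by move=> mD If Ig; have := integrableB mD If Ig. Qed.

End IntegrableReal.

Section L2facts.
Context {R : realType}.
Local Notation mu := (@lebesgue_measure R).

Lemma measurable_Iset : measurable (@Iset R).
Proof. exact: measurable_itv. Qed.

Lemma IsetE (t : R) : Iset t = (0 <= t) :> Prop.
Proof. by rewrite /Iset /= in_itv/= andbT. Qed.

Lemma measurable_sqnorm p (D : set R) (y : R -> 'cV[R]_p) :
  (forall i, measurable_fun D (fun t => y t i 0)) ->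
  measurable_fun D (fun t => sqnorm (y t)).
Proof. by move=> my; apply: measurable_sum => i; exact: measurable_funX. Qed.

Lemma isL2_integrable p (y : R -> 'cV[R]_p) :
  isL2 y -> mu.-integrable (@Iset R) (EFin \o (fun t => sqnorm (y t))).
Proof.
move=> [my yoo]; apply/integrableP; split.
  by apply/measurable_EFinP; exact: measurable_sqnorm.
rewrite [X in (X < _)%E](_ : _ = L2sq y)//; apply: eq_integral => t _ /=.
by rewrite ger0_norm// sqnorm_ge0.
Qed.

Lemma L2sq_ge0 p (y : R -> 'cV[R]_p) : 0 <= fine (L2sq y).
Proof. by apply: fine_ge0; apply: integral_ge0 => t _; rewrite lee_fin sqnorm_ge0. Qed.

Lemma isL2_dominated p (y : R -> 'cV[R]_p) (F : R -> R) :
  (forall i, measurable_fun (@Iset R) (fun t => y t i 0)) ->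
  mu.-integrable (@Iset R) (EFin \o F) ->
  (forall t, 0 <= t -> sqnorm (y t) <= F t) -> isL2 y.
Proof.
move=> my iF yF; split=> //.
have : mu.-integrable (@Iset R) (EFin \o (fun t => sqnorm (y t))).
  apply: le_integrable iF => //; first exact: measurable_Iset.
    by apply/measurable_EFinP; exact: measurable_sqnorm.
  move=> t; rewrite IsetE => t0 /=; rewrite lee_fin ger0_norm ?sqnorm_ge0//.
  by apply: le_trans (yF t t0) _; exact: ler_norm.
by move/integrable_lty; apply; exact: measurable_Iset.
Qed.

Lemma isL2N p (y : R -> 'cV[R]_p) : isL2 y -> isL2 (fun t => - y t).
Proof.
move=> iy; have [my _] := iy; apply: isL2_dominated (isL2_integrable iy) _.
  move=> i; rewrite (_ : (fun t => _) = (fun t => - (y t i 0))).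
    exact: measurableT_comp.
  by apply/funext => t; rewrite mxE.
by move=> t _; rewrite -!dotv_sqnorm dotvNl dotvNr opprK.
Qed.

Lemma isL2D p (y z : R -> 'cV[R]_p) : isL2 y -> isL2 z -> isL2 (fun t => y t + z t).
Proof.
move=> iy iz; have [my _] := iy; have [mz _] := iz.
apply: (@isL2_dominated _ _ (fun t => 2 * sqnorm (y t) + 2 * sqnorm (z t))).
- move=> i; rewrite (_ : (fun t => _) = (fun t => y t i 0) \+ (fun t => z t i 0)).
    exact: measurable_funD.
  by apply/funext => t; rewrite mxE.
- have mI := measurable_Iset.
  by apply: integrableD_fun => //; apply: integrableZ_fun => //; exact: isL2_integrable.
- move=> t _; have := sqnorm_ge0 (y t - z t); rewrite -!dotv_sqnorm !dotvL (dotvC (z t) (y t)); lra.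
Qed.

Lemma isL2B p (y z : R -> 'cV[R]_p) : isL2 y -> isL2 z -> isL2 (fun t => y t - z t).
Proof. by move=> iy iz; apply: isL2D => //; exact: isL2N. Qed.

Lemma segment_sub_Iset (a b : R) : 0 <= a -> `[a, b] `<=` (@Iset R).
Proof.
move=> a0 t /=; rewrite in_itv/= => /andP[at_ _].
by rewrite IsetE; exact: le_trans at_.
Qed.

Lemma integrable_cst_segment (a b c : R) : mu.-integrable `[a, b] (EFin \o cst c).
Proof.
apply: continuous_compact_integrable; first exact: segment_compact.
by apply: continuous_subspaceT => x; exact: cst_continuous.
Qed.

Lemma sqnorm_integrable_segment p (y : R -> 'cV[R]_p) (a b : R) : isL2 y -> 0 <= a ->
  mu.-integrable `[a, b] (EFin \o (fun t => sqnorm (y t))).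
Proof.
move=> iy a0; apply: integrableS (isL2_integrable iy) => //.
- exact: measurable_Iset.
- exact: segment_sub_Iset.
Qed.

Lemma coord_integrable p (y : R -> 'cV[R]_p) (a b : R) i : isL2 y -> 0 <= a ->
  mu.-integrable `[a, b] (EFin \o (fun t => y t i 0)).
Proof.
move=> iy a0; have [my _] := iy.
have iF : mu.-integrable `[a, b] (EFin \o (fun t => 1 + sqnorm (y t))).
  by apply: integrableD_fun => //; [exact: integrable_cst_segment|exact: sqnorm_integrable_segment].
apply: le_integrable iF => //.
  apply/measurable_EFinP; apply: measurable_funS (my i) => //.
  - exact: measurable_Iset.
  - exact: segment_sub_Iset.
move=> t _ /=; rewrite lee_fin; apply: le_trans (ler_norm _).
have := sqcoord_le (y t) i; rewrite -(real_normK (num_real (y t i 0))).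
have := sqr_ge0 (`|y t i 0| - 1); have := normr_ge0 (y t i 0); rewrite !expr2; nra.
Qed.

Lemma sqnorm_segment_le p (y : R -> 'cV[R]_p) (a b : R) : isL2 y -> 0 <= a ->
  \int[mu]_(t in `[a, b]) sqnorm (y t) <= fine (L2sq y).
Proof.
move=> iy a0; have [my yoo] := iy; rewrite /Rintegral; apply: fine_le.
- by apply: integrable_fin_num => //; exact: sqnorm_integrable_segment.
- by rewrite ge0_fin_numE//; apply: integral_ge0 => t _; rewrite lee_fin sqnorm_ge0.
- apply: ge0_subset_integral => //; [exact: measurable_Iset| | |exact: segment_sub_Iset].
    by apply/measurable_EFinP; exact: measurable_sqnorm.
  by move=> t _; rewrite lee_fin sqnorm_ge0.
Qed.

Lemma exp_cvgy (C k : R) : 0 < k -> C * expR (- (k * t)) @[t --> +oo] --> (0 : R).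
Proof.
move=> k0; apply/cvgrPdist_lt => eps eps0.
have [T T0 HT] := exp_small `|C| k0 eps0.
apply: filterS (nbhs_pinfty_ge (num_real T)) => t Tt.
rewrite sub0r normrN normrM (ger0_norm (expR_ge0 _)).
by apply: le_lt_trans HT; rewrite ler_wpM2l// ler_expR lerN2 ler_pM2l.
Qed.

Lemma exp_integrable (C k : R) : 0 <= C -> 0 < k ->
  mu.-integrable (@Iset R) (EFin \o (fun t => C * expR (- (k * t)))).
Proof.
move=> C0 k0.
have E t : C * expR (- (k * t)) = C * expR (- k * t) by rewrite mulNr.
have cf : continuous (fun t => C * expR (- (k * t))).
  under eq_fun do rewrite E.
  by apply: continuous_derive => t; exact: is_derive_expc.
have f0 t : 0 <= C * expR (- (k * t)) by rewrite mulr_ge0 ?expR_ge0.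
apply/integrableP; split.
  apply/measurable_EFinP; apply: measurable_funTS.
  exact: continuous_measurable_fun.
rewrite [X in (X < _)%E](_ : _ = \int[mu]_(t in (@Iset R)) (C * expR (- (k * t)))%:E)%E; last first.
  by apply: eq_integral => t _ /=; rewrite ger0_norm.
have dF (t : R) : is_derive t 1 (fun s => - (C / k) * expR (- k * s)) (C * expR (- (k * t))).
  by apply: is_derive_eq (is_derive_expc _ _ t) _; rewrite E; field; rewrite gt_eqF.
rewrite (@ge0_continuous_FTC2y _ _ (fun s => - (C / k) * expR (- k * s)) 0 0).
- by rewrite -EFinB ltry.
- by move=> t _; exact: f0.
- exact: continuous_subspaceT.
- rewrite (_ : (fun s => _) = (fun s => - (C / k) * expR (- (k * s)))); first exact: exp_cvgy.
  by apply/funext => s; rewrite (mulNr k).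
- by move=> t _; have [] := dF t.
- by apply: cvg_at_right_filter; exact: (continuous_derive dF).
- by move=> t _; rewrite derive1E; have [_ ->] := dF t.
Qed.

Lemma cmx_measurable p (y : R -> 'cV[R]_p) (D : set R) i : cmx y ->
  measurable_fun D (fun t => y t i 0).
Proof. by move=> cy; apply: measurable_funTS; apply: continuous_measurable_fun; exact: cy. Qed.

Lemma isL2_exp p (y : R -> 'cV[R]_p) g H : 0 < g -> cmx y -> bd (expw g) y H -> isL2 y.
Proof.
move=> g0 cy by_; have H0 := bd_expw_ge0 by_.
apply: (@isL2_dominated _ _ (fun t => p%:R * H ^+ 2 * expR (- (2 * g * t)))).
- by move=> i; exact: cmx_measurable.
- by apply: exp_integrable; [rewrite mulr_ge0// sqr_ge0|rewrite mulr_gt0].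
move=> t t0; apply: le_trans (sqnorm_norm _) _; rewrite -[leRHS]mulrA ler_wpM2l//.
have := by_ t; rewrite expw_id// => b.
apply: le_trans (_ : (H * expR (- (g * t))) ^+ 2 <= _).
  by rewrite lerXn2r ?nnegrE// mulr_ge0 ?expR_ge0.
by rewrite exprMn ler_wpM2l ?sqr_ge0// expr2 -expRD ler_expR; lra.
Qed.

Lemma isWderiv_exp p (y y' : R -> 'cV[R]_p) g H H' : 0 < g ->
  cmx y -> cmx y' -> bd (expw g) y H -> bd (expw g) y' H' ->
  (forall t : R, 0 < t -> dmx y (y' t) t) -> isWderiv y y'.
Proof.
move=> g0 cy cy' by_ by' dy.
split; first exact: isL2_exp by_. split; first exact: isL2_exp by'.
move=> t; rewrite le_eqVlt => /predU1P[<-|t0]; apply/colP => i; rewrite !mxE.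
  by rewrite set_itv1 Rintegral_set1 addr0.
rewrite /Rintegral (@continuous_FTC2 _ (fun s => y' s i 0) (fun s => y s i 0) 0 t t0) /=.
- by rewrite addrC subrK.
- by apply: continuous_subspaceT; exact: cy'.
- split.
  + by move=> s; rewrite in_itv/= => /andP[s0 _]; have [] := dy s s0 i 0.
  + by apply: cvg_at_right_filter; exact: cy.
  + by apply: cvg_at_left_filter; exact: cy.
- by move=> s; rewrite in_itv/= => /andP[s0 _]; rewrite derive1E; have [_ ->] := dy s s0 i 0.
Qed.

End L2facts.

(** * Smoothness of f from the Nemytskii operator *)

Section Nemytskii.
Context {R : realType}.
Local Notation mu := (@lebesgue_measure R).

(** With [s = max (t - 1) 0] the bump is [(1 + s) exp (- s)]. Its derivative [- s exp (- s)]
    vanishes at [s = 0], so it joins the constant 1 with a continuous derivative, and its decay puts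
    the test functions in [W_infty]. *)
Lemma bump_exists : exists phi psi : R -> R, exists H : R,
  [/\ continuous phi, continuous psi, forall t : R, 0 < t -> is_derive t 1 phi (psi t),
      forall t, 0 <= t <= 1 -> phi t = 1 &
      forall t, `|phi t| <= H * expw 2^-1 t /\ `|psi t| <= H * expw 2^-1 t].
Proof.
pose s (t : R) := pos (t - 1).
have cs : continuous s.
  move=> t; apply: (@continuous_comp R R R (fun t : R => t - 1) pos); last exact: continuous_pos.
  by apply: continuousB; [exact: cvg_id|exact: cst_continuous].
have ce : continuous (fun t => expR (- s t)).
  move=> t; apply: (@continuous_comp R R R (fun t : R => - s t) expR); last exact: continuous_expR.
  exact/continuousN/cs.
pose psi t := - (s t * expR (- s t)).
have cpsi : continuous psi.
  by move=> t; apply: cvgN; apply: cvgM; [exact: cs|exact: ce].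
have [F DF] := primitive_exists cpsi.
pose phi t := 1 + (F (pos t) - F 0).
have cphi : continuous phi.
  move=> t; apply: cvgD; first exact: cvg_cst.
  apply: cvgB; last exact: cvg_cst.
  apply: (@continuous_comp R R R pos F); first exact: continuous_pos.
  have [D _] := DF (pos t) (lt_le_trans (ltrN10 _) (pos_ge0 t)).
  by apply: differentiable_continuous; apply/derivable1_diffP.
have dphi (t : R) : 0 < t -> is_derive t 1 phi (psi t).
  move=> t0; have d : is_derive t 1 (fun s => 1 + (F s - F 0)) (psi t).
    have DFt := DF t (lt_trans (ltrN10 _) t0).
    have := @is_deriveD R R R (cst 1) (F \- cst (F 0)) t 1 _ _ (is_derive_cst (1 : R) t 1)
      (@is_deriveB R R R F (cst (F 0)) t 1 _ _ DFt (is_derive_cst (F 0) t 1)).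
    by rewrite subr0 add0r.
  apply: near_eq_is_derive d; near=> r; rewrite /phi pos_id//; near: r.
  by apply: filterS (lt_nbhsr t0) => r; exact: ltW.
have phi0 : phi 0 = 1 by rewrite /phi pos_id// subrr addr0.
have s0 t : 0 <= s t by exact: pos_ge0.
have phi1 t : 0 <= t <= 1 -> phi t = 1.
  move=> /andP[t0 t1]; rewrite -phi0; apply: derive0_cst => // x /andP[x0 xt].
  apply: is_derive_eq (dphi x x0) _; rewrite /psi /s pos_le0 ?mul0r ?oppr0//; lra.
(* For [t >= 1] this is [(1 + s) exp (- s)] with [s = t - 1], in a form that is differentiable
   everywhere. *)
pose q (t : R) := expR 1 * (t * expR (- 1 * t)).
have dq (t : R) : is_derive t 1 q (expR 1 * (expR (- 1 * t) - t * expR (- 1 * t))).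
  apply: is_derive_eq (is_derive_mulf (is_derive_cst (expR 1) t 1) (is_derive_mulf (is_derive_id t 1) (is_derive_expl (-1) t))) _.
  rewrite /cst; ring.
have cq := continuous_derive dq.
have phis t : phi t = (1 + s t) * expR (- s t) \/ phi t = 1 /\ s t = 0.
  have [t1|t1] := leP t 1.
    right; split; last by rewrite /s pos_le0//; lra.
    by have [t0|t0] := leP 0 t; [apply: phi1; rewrite t0|rewrite /phi pos_le0 ?ltW// subrr addr0].
  left; have : phi t - q t = phi 1 - q 1.
    apply: (@derive0_cst _ (fun t => phi t - q t) _ _ (ltW t1)).
      by move=> x; apply: cvgB; [exact: cphi|exact: cq].
    move=> x /andP[x1 xt]; have x0 : 0 < x by lra.
    apply: is_derive_eq (@is_deriveB R R R phi q x 1 _ _ (dphi x x0) (dq x)) _.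
    rewrite /psi /s pos_id; last lra.
    by rewrite (_ : - (x - 1) = 1 + -1 * x) ?expRD; ring.
  rewrite (phi1 1) ?lexx ?ler01// /q mul1r -expRD mulr1 subrr expR0 subrr => /eqP.
  rewrite subr_eq0 => /eqP->; rewrite /s pos_id; last lra.
  by rewrite (_ : - (t - 1) = 1 + -1 * t) ?expRD; ring.
have half t : (1 + s t) * expR (- s t) <= 2 * expR (- (s t / 2)).
  have -> : - s t = - (s t / 2) + - (s t / 2) by field.
  rewrite expRD mulrA ler_wpM2r ?expR_ge0//.
  have := expR_ge1Dx (s t / 2); rewrite -{2}(opprK (s t / 2)) (expRN (- _)).
  move: (expR_gt0 (- (s t / 2))); set E := expR _ => E0 h.
  have : (1 + s t / 2) * E <= 1 by rewrite -ler_pdivlMr// mul1r.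
  nra.
have wt t : expR (- (s t / 2)) <= expR 1 * expw 2^-1 t.
  rewrite /expw -expRD ler_expR /s.
  have : pos t <= pos (t - 1) + 1.
    rewrite {1}/pos ge_max; apply/andP; split; last by have := pos_ge0 (t - 1); lra.
    by rewrite -lerBlDr /pos le_max lexx.
  lra.
exists phi, psi, (2 * expR 1); split=> // t.
have wt' : 2 * expR (- (s t / 2)) <= 2 * expR 1 * expw 2^-1 t by rewrite -mulrA ler_wpM2l.
split; apply: le_trans wt'.
  case: (phis t) => [->|[-> ->]]; last by rewrite mul0r oppr0 expR0 normr1; lra.
  by rewrite ger0_norm// mulr_ge0 ?expR_ge0// addr_ge0.
rewrite normrN ger0_norm ?mulr_ge0 ?expR_ge0//; apply: le_trans (half t).
by rewrite ler_wpM2r ?expR_ge0//; lra.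
Unshelve. all: by end_near. Qed.

(** Functions in [L^2] are known only up to null sets, so evaluation at a time is replaced by this
    bounded functional; on functions constant on [[0, 1]] it returns their value. *)
Definition avg p (y : R -> 'cV[R]_p) : 'cV[R]_p :=
  \col_i \int[mu]_(t in `[0, 1]) y t i 0.

Lemma Rintegral_unit_cst (c : R) : \int[mu]_(t in `[0, 1]) c = c.
Proof.
have E : fine (mu `[0, 1]) = 1.
  by rewrite lebesgue_measure_itv /= lte_fin ltr01 -EFinB /= subr0.
by rewrite (Rintegral_cst mu)// [X in _ * X]E mulr1.
Qed.

Lemma avgD p (y z : R -> 'cV[R]_p) : isL2 y -> isL2 z ->
  avg (fun t => y t + z t) = avg y + avg z.
Proof.
move=> iy iz; apply/colP => i; rewrite !mxE -RintegralD//; last 2 first.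
- exact: coord_integrable.
- exact: coord_integrable.
by apply: eq_Rintegral => t _; rewrite mxE.
Qed.

Lemma avgZ p a (y : R -> 'cV[R]_p) : isL2 y -> avg (fun t => a *: y t) = a *: avg y.
Proof.
move=> iy; apply/colP => i; rewrite !mxE -RintegralZl//; last exact: coord_integrable.
by apply: eq_Rintegral => t _; rewrite mxE.
Qed.

Lemma avgB p (y z : R -> 'cV[R]_p) : isL2 y -> isL2 z ->
  avg (fun t => y t - z t) = avg y - avg z.
Proof.
move=> iy iz; rewrite avgD//; last exact: isL2N.
congr (_ + _); rewrite -scaleN1r -avgZ//; congr avg.
by apply/funext => t; rewrite scaleN1r.
Qed.

(* The variance of a coordinate over [0, 1] is nonnegative. *)
Lemma avg_norm p (y : R -> 'cV[R]_p) : isL2 y -> `|avg y| <= L2norm y.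
Proof.
move=> iy; apply: cV_norm_le => [|i]; first exact: sqrtr_ge0.
rewrite -[leLHS]sqrtr_sqr; apply: ler_wsqrtr.
apply: le_trans (sqnorm_segment_le 1 iy (lexx 0)).
rewrite mxE; set c := \int[mu]_(t in _) _.
have iyi := coord_integrable 1 i iy (lexx 0); have iy2 := sqnorm_integrable_segment 1 iy (lexx 0).
have ic : mu.-integrable `[0, 1] (EFin \o (fun t => 2 * c * y t i 0)).
  exact: integrableZ_fun.
have id : mu.-integrable `[0, 1] (EFin \o (fun t => sqnorm (y t) - 2 * c * y t i 0)).
  exact: integrableB_fun.
have : 0 <= \int[mu]_(t in `[0, 1]) (sqnorm (y t) - 2 * c * y t i 0 + c ^+ 2).
  apply: Rintegral_ge0 => t _; have := sqcoord_le (y t) i; have := sqr_ge0 (y t i 0 - c).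
  rewrite !expr2; lra.
rewrite RintegralD//; last exact: integrable_cst_segment.
rewrite RintegralB// RintegralZl// -/c Rintegral_unit_cst expr2; lra.
Qed.

Lemma Wnorm_le p (y yd : R -> 'cV[R]_p) : isWderiv y yd ->
  0 <= Wnorm y <= Num.sqrt (fine (L2sq y) + fine (L2sq yd)).
Proof.
move=> w; have lb0 : lbound [set r : R | exists yd, isWderiv y yd /\
    r = Num.sqrt (fine (L2sq y) + fine (L2sq yd))] 0.
  by move=> _ [yd' [_ ->]]; exact: sqrtr_ge0.
apply/andP; split.
  by apply: lb_le_inf => //; exists (Num.sqrt (fine (L2sq y) + fine (L2sq yd))), yd.
by apply: ge_inf; [exists 0|exists yd].
Qed.

Lemma sqnormZ p a (x : 'cV[R]_p) : sqnorm (a *: x) = a ^+ 2 * sqnorm x.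
Proof. by rewrite /sqnorm mulr_sumr; apply: eq_bigr => i _; rewrite mxE exprMn. Qed.

Lemma L2sqZ p g H (a : R -> R) (x : 'cV[R]_p) : 0 < g -> continuous a ->
  (forall t, `|a t| <= H * expw g t) ->
  fine (L2sq (fun t => a t *: x)) = sqnorm x * \int[mu]_(t in (@Iset R)) a t ^+ 2.
Proof.
move=> g0 ca ba; rewrite -RintegralZl; last 2 first.
- exact: measurable_Iset.
- have := @isL2_integrable _ _ (fun t => const_mx (a t) : 'cV[R]_1) (isL2_exp g0 _ _).
  rewrite (_ : (fun t => sqnorm _) = (fun t => a t ^+ 2)).
    apply.
    + by move=> i j; rewrite (_ : (fun t => _) = a)//; apply/funext => t; rewrite mxE.
    + move=> t; apply: le_trans (ba t); apply: cV_norm_le => // i; by rewrite mxE.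
  by apply/funext => t; rewrite /sqnorm big_ord_recl big_ord0 mxE addr0.
by rewrite /Rintegral; congr fine; apply: eq_integral => t _; rewrite sqnormZ mulrC.
Qed.

(* The derivatives of [f] are the averages over [0, 1] of those of the operator at the functions
   [phi t *: x], where [phi] is a bump that equals 1 on [0, 1]. *)
Lemma FrechetCk_CkOn p q m (f : 'cV[R]_p -> 'cV[R]_q) :
  FrechetCk (@inW R p) (@Wnorm R p) (@isL2 R q) (@L2norm R q) m (fun y t => f (y t)) ->
  CkOn m f setT.
Proof.
move=> [_ [D [D0 [Dj [Ddiff Dcont]]]]].
have [phi [psi [H [cphi cpsi dphi phi1 bb]]]] := bump_exists.
have h0 : 0 < 2^-1 :> R by rewrite invr_gt0.
pose Phi (x : 'cV[R]_p) t := phi t *: x.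
have cZ (a : R -> R) (x : 'cV[R]_p) : continuous a -> cmx (fun t => a t *: x).
  move=> ca i j t; rewrite (_ : (fun s => _) = (fun s => a s * x i j)).
    by apply: cvgM; [exact: ca|exact: cvg_cst].
  by apply/funext => s; rewrite mxE.
have PhiW x : isWderiv (Phi x) (fun t => psi t *: x).
  apply: (@isWderiv_exp _ _ _ _ 2^-1 (H * `|x|) (H * `|x|)) => //.
  - exact: cZ.
  - exact: cZ.
  - by move=> t; rewrite normrZ mulrAC ler_wpM2r//; case: (bb t).
  - by move=> t; rewrite normrZ mulrAC ler_wpM2r//; case: (bb t).
  - move=> t t0 i j; rewrite (_ : (fun s => _) = (fun s => phi s * x i j)).
      apply: is_derive_eq (is_derive_mulf (dphi t t0) (is_derive_cst (x i j) t 1)) _.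
      by rewrite mulr0 addr0 mxE.
    by apply/funext => s; rewrite mxE.
have Phi_in x : inW (Phi x) by exists (fun t => psi t *: x).
have PhiD x h : Phi (x + h) = fun s => Phi x s + Phi h s.
  by apply/funext => s; rewrite /Phi scalerDr.
pose c1 := \int[mu]_(t in (@Iset R)) phi t ^+ 2; pose c2 := \int[mu]_(t in (@Iset R)) psi t ^+ 2.
have c10 : 0 <= c1 by apply: Rintegral_ge0 => t _; exact: sqr_ge0.
have c20 : 0 <= c2 by apply: Rintegral_ge0 => t _; exact: sqr_ge0.
pose c := Num.sqrt (p%:R * (c1 + c2)).
have c0 : 0 <= c by exact: sqrtr_ge0.
have Wge0 x : 0 <= Wnorm (Phi x) by have /andP[] := Wnorm_le (PhiW x).
have Wle x : Wnorm (Phi x) <= c * `|x|.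
  have /andP[_ /le_trans] := Wnorm_le (PhiW x); apply.
  rewrite (L2sqZ _ h0 cphi (fun t => (bb t).1)) (L2sqZ _ h0 cpsi (fun t => (bb t).2)) -mulrDr.
  have -> : c * `|x| = Num.sqrt (p%:R * (c1 + c2) * `|x| ^+ 2).
    by rewrite sqrtrM ?mulr_ge0 ?addr_ge0// sqrtr_sqr normr_id.
  by apply: ler_wsqrtr; rewrite mulrAC ler_wpM2r ?addr_ge0//; exact: sqnorm_norm.
(* This will turn out to be the iterated directional derivative of [f] at [x] along the first [j]
   entries of [w], the most recent direction coming first. *)
pose F j x (w : nat -> 'cV[R]_p) := avg (D j (Phi x) (fun i => Phi (w i))).
have DL2 j x w : (j <= m)%N -> isL2 (D j (Phi x) (fun i => Phi (w i))).
  by move=> jm; have [_ [Dm _]] := Dj j jm (Phi x) (Phi_in x); apply: Dm.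
(* Induction on the number [l] of derivatives still to be taken, for all [j] and all directions at
   once; at [l = 0] the continuity of the top derivative is used. *)
have key l : forall j w, (j + l = m)%N -> CkOn l (fun x => F j x w) setT.
  elim: l => [|l IH] j w jl.
    rewrite addn0 in jl; subst j; move=> x _; apply/continuous_atP => e e0.
    pose Q := \prod_(i < m) Wnorm (Phi (w i)).
    have Q0 : 0 <= Q by apply: prodr_ge0.
    have [d [d0 Hd]] := Dcont (Phi x) (Phi_in x) (e / (Q + 1)) (divr_gt0 e0 (ltr_wpDl Q0 ltr01)).
    exists (d / (c + 1)) => [|y yd]; first by rewrite divr_gt0// ltr_wpDl.
    rewrite -avgB; [|exact: DL2|exact: DL2].
    apply: le_lt_trans (avg_norm (isL2B (DL2 _ _ _ _) (DL2 _ _ _ _))) _ => //.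
    have := Hd (Phi (y - x)) (Phi_in _) _ (fun i => Phi (w i)) (fun i _ => Phi_in _).
    rewrite -PhiD (addrC x) subrK => /(_ _)/le_lt_trans; apply.
      apply: le_lt_trans (Wle _) _; apply: le_lt_trans (_ : (c + 1) * `|y - x| < _).
        by rewrite ler_wpM2r// lerDl.
      by rewrite mulrC -ltr_pdivlMr// ltr_wpDl.
    by rewrite -/Q -mulrA gtr_pMr// mulrC ltr_pdivrMr ?ltr_wpDl// mul1r ltrDl.
  have jm : (j < m)%N by rewrite -jl addnS ltnS leq_addr.
  have consE h : (fun i => Phi (consv h w i)) = consv (Phi h) (fun i => Phi (w i)).
    by apply/funext => -[].
  pose L x h := F j.+1 x (consv h w).
  have linL x : linear (L x).
    move=> a h h'; rewrite /L /F.
    have [_ [_ [/(_ (fun i => Phi (consv h w i)) (fun i _ => Phi_in _) 0%N (ltn0Sn j) a (Phi h') (Phi_in h')) + _]]] :=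
      Dj j.+1 jm (Phi x) (Phi_in x).
    rewrite (_ : setv _ 0 (fun s => _) = (fun i => Phi (consv (a *: h + h') w i))); last first.
      apply/funext => -[|i] //=; apply/funext => s.
      by rewrite /setv/= /Phi scalerDr !scalerA mulrC.
    rewrite (_ : setv _ 0 (Phi h') = (fun i => Phi (consv h' w i))); last first.
      by apply/funext => -[|i].
    have i1 := DL2 j.+1 x (consv (a *: h + h') w) jm.
    have i2 := DL2 j.+1 x (consv h w) jm; have i3 := DL2 j.+1 x (consv h' w) jm.
    have i4 : isL2 (fun t => a *: D j.+1 (Phi x) (fun i => Phi (consv h w i)) t).
      apply: (@isL2_dominated _ _ _ (fun t => a ^+ 2 * sqnorm (D j.+1 (Phi x) (fun i => Phi (consv h w i)) t))).
      - move=> i; rewrite (_ : (fun t => _) = (fun t => a * (D j.+1 (Phi x) (fun i => Phi (consv h w i)) t i 0))).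
          by apply: measurable_funM => //; case: i2.
        by apply/funext => t; rewrite mxE.
      - by apply: integrableZ_fun; [exact: measurable_Iset|exact: isL2_integrable].
      - by move=> t _; rewrite sqnormZ.
    move=> N0; have := avg_norm (isL2B i1 (isL2D i4 i3)); rewrite N0.
    by rewrite normr_le0 avgB// ?avgD// ?avgZ// ?subr_eq0; [move/eqP|exact: isL2D].
  have dF x : differentiable (fun x => F j x w) x /\ forall v, 'D_v (fun x => F j x w) x = L x v.
    apply: diff_cV => // e e0.
    pose Q := \prod_(i < j) Wnorm (Phi (w i)).
    have Q0 : 0 <= Q by apply: prodr_ge0.
    pose e' := e / ((c + 1) * (Q + 1)).
    have cQ : 0 < (c + 1) * (Q + 1) by rewrite mulr_gt0 ?ltr_wpDl.
    have e'0 : 0 < e' by rewrite divr_gt0.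
    have [d [d0 Hd]] := Ddiff j jm (Phi x) (Phi_in x) e' e'0.
    exists (d / (c + 1)) => [|h hd]; first by rewrite divr_gt0// ltr_wpDl.
    have Wh : Wnorm (Phi h) <= (c + 1) * `|h|.
      by apply: le_trans (Wle _) _; rewrite ler_wpM2r// lerDl.
    have jm' := ltnW jm; have i1 := DL2 j (x + h) w jm'; have i2 := DL2 j x w jm'.
    have i3 := DL2 j.+1 x (consv h w) jm; have i12 := isL2B i1 i2.
    have -> : F j (x + h) w - F j x w - L x h = avg (fun t => D j (Phi (x + h)) (fun i => Phi (w i)) t -
        D j (Phi x) (fun i => Phi (w i)) t - D j.+1 (Phi x) (fun i => Phi (consv h w i)) t).
      by rewrite avgB// avgB.
    apply: le_trans (avg_norm (isL2B i12 i3)) _.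
    have := Hd (Phi h) (Phi_in _) _ (fun i => Phi (w i)) (fun i _ => Phi_in _).
    rewrite -PhiD consE => /(_ _)/le_trans; apply.
      by apply: le_lt_trans Wh _; rewrite mulrC -ltr_pdivlMr// ltr_wpDl.
    rewrite -/Q; apply: le_trans (_ : e' * ((c + 1) * `|h|) * (Q + 1) <= _).
      apply: ler_pM => //; first by rewrite mulr_ge0// ltW.
        by rewrite ler_wpM2l// ltW.
      by rewrite lerDl.
    have -> : e' * ((c + 1) * `|h|) * (Q + 1) = e' * ((c + 1) * (Q + 1)) * `|h| by ring.
    by rewrite /e' divfK// gt_eqF.
  split=> [x _|v]; first by case: (dF x).
  rewrite (_ : (fun x => _) = (fun x => F j.+1 x (consv v w))).
    by apply: IH; rewrite addSnnS.
  by apply/funext => x; have [_ ->] := dF x.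
(* For [j = 0] the average is that of [f (phi t *: x)] over [[0, 1]], where [phi] is 1. *)
have := key m 0%N (fun=> 0) (add0n m); rewrite (_ : (fun x => F 0%N x _) = f)//.
apply/funext => x; rewrite /F D0//; apply/colP => i; rewrite mxE.
rewrite -[RHS]Rintegral_unit_cst; apply: eq_Rintegral => t; rewrite inE/= in_itv/= => t01.
by rewrite /Phi phi1// scale1r.
Qed.

End Nemytskii.

(** * Dissipation along trajectories *)

Section IntegralSums.
Context {d : measure_display} {T : measurableType d} {R : realType}.
Variable mu : {measure set T -> \bar R}.
Variables (D : set T) (n : nat) (h : 'I_n -> T -> R).
Hypothesis mD : measurable D.
Hypothesis ih : forall i, mu.-integrable D (EFin \o h i).

Lemma Rintegral_sum : mu.-integrable D (EFin \o (fun t => \sum_i h i t)) /\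
  \int[mu]_(t in D) (\sum_i h i t) = \sum_i \int[mu]_(t in D) h i t.
Proof.
elim: n h ih => [|k IH] f If.
  rewrite big_ord0; have E : (fun t => \sum_(i < 0) f i t) = cst 0.
    by apply/funext => t; rewrite big_ord0.
  rewrite E; split; last by rewrite /Rintegral/= integral0.
  exact: integrable0.
have [I1 E1] := IH (fun i => f (lift ord0 i)) (fun i => If (lift ord0 i)).
have E : (fun t => \sum_(i < k.+1) f i t) = fun t => f ord0 t + \sum_i f (lift ord0 i) t.
  by apply/funext => t; rewrite big_ord_recl.
rewrite E big_ord_recl; split; first exact: integrableD_fun.
by rewrite RintegralD// E1.
Qed.

Lemma integrable_norm_fun (f : T -> R) : mu.-integrable D (EFin \o f) ->
  mu.-integrable D (EFin \o (fun t => `|f t|)).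
Proof. by move=> If; have := integrable_abse If. Qed.

Lemma ae_imply (P Q : T -> Prop) : {ae mu, forall t, P t} -> (forall t, P t -> Q t) ->
  {ae mu, forall t, Q t}.
Proof. by move=> aeP PQ; apply: filterS aeP. Qed.

Lemma ae_all (P : T -> Prop) : (forall t, P t) -> {ae mu, forall t, P t}.
Proof. by move=> H; apply: aeW => t; exact: H. Qed.

Lemma ae_le_Rintegral (f g : T -> R) :
  mu.-integrable D (EFin \o f) -> mu.-integrable D (EFin \o g) ->
  {ae mu, forall t, D t -> f t <= g t} ->
  \int[mu]_(t in D) f t <= \int[mu]_(t in D) g t.
Proof.
move=> If Ig fg; rewrite -subr_ge0 -RintegralB//.
have Igf := integrableB_fun mD Ig If.
rewrite (_ : \int[mu]_(t in D) _ = \int[mu]_(t in D) `|g t - f t|).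
  by apply: Rintegral_ge0 => t _.
rewrite /Rintegral; congr fine; apply: ae_eq_integral => //.
- exact: measurable_int Igf.
- exact: measurable_int (integrable_norm_fun Igf).
- by apply: filterS fg => t H /H gft; rewrite /= ger0_norm// subr_ge0.
Qed.

End IntegralSums.

Section Dissipation.
Context {R : realType}.
Local Notation mu := (@lebesgue_measure R).
Variables (n : nat) (y yd : R -> 'cV[R]_n).
Hypothesis iyd : isL2 yd.
Hypothesis yE : forall t, 0 <= t -> y t = y 0 + vint yd t.

Let g (s : R) : R := \sum_i `|yd s i 0|.
(** Arc length for the sum norm. As [yd] is only square integrable, increments of [y] are not
    controlled by a multiple of elapsed time, but they are by arc length. *)
Definition arclen (t : R) : R := \int[mu]_(s in `[0, t]) g s.

Let coord_oc s t i : 0 <= s -> mu.-integrable `]s, t] (EFin \o (fun r => yd r i 0)).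
Proof.
move=> s0; apply: integrableS (coord_integrable t i iyd s0) => //.
by apply: subset_itvr; rewrite bnd_simp.
Qed.

Let g_cc s t : 0 <= s -> mu.-integrable `[s, t] (EFin \o g).
Proof.
move=> s0.
by have [] := @Rintegral_sum _ _ _ mu `[s, t] n (fun i r => `|yd r i 0|) (measurable_itv _)
  (fun i => integrable_norm_fun (coord_integrable t i iyd s0)).
Qed.

Let g_oc s t : 0 <= s -> mu.-integrable `]s, t] (EFin \o g).
Proof.
move=> s0; apply: integrableS (g_cc t s0) => //.
by apply: subset_itvr; rewrite bnd_simp.
Qed.

Lemma cum_sub (h : R -> R) s t : 0 <= s <= t -> mu.-integrable `[0, t] (EFin \o h) ->
  \int[mu]_(r in `[0, t]) h r - \int[mu]_(r in `[0, s]) h r = \int[mu]_(r in `]s, t]) h r.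
Proof. by move=> /andP[s0 st] ih; rewrite Rintegral_itvB// bnd_simp. Qed.

Lemma arclen_sub s t : 0 <= s <= t -> arclen t - arclen s = \int[mu]_(r in `]s, t]) g r.
Proof. by move=> st; rewrite /arclen cum_sub//; exact: g_cc. Qed.

Lemma arclen_nondecreasing s t : 0 <= s <= t -> arclen s <= arclen t.
Proof.
move=> st; rewrite -subr_ge0 arclen_sub//; apply: Rintegral_ge0 => r _.
by apply: sumr_ge0.
Qed.

Lemma coord_sub s t i : 0 <= s <= t ->
  y t i 0 - y s i 0 = \int[mu]_(r in `]s, t]) yd r i 0.
Proof.
move=> st; have /andP[s0 st'] := st.
rewrite -(cum_sub st (coord_integrable t i iyd (lexx 0))) (yE s0) (yE (le_trans s0 st')) !mxE.
lra.
Qed.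

Lemma arclen_norm s t : 0 <= s <= t -> `|y t - y s| <= arclen t - arclen s.
Proof.
move=> st; apply: cV_norm_le => [|i]; first by rewrite subr_ge0 arclen_nondecreasing.
have /andP[s0 _] := st; rewrite !mxE coord_sub// arclen_sub//.
apply: le_trans (le_normr_Rintegral _ (coord_oc t i s0)) _ => //.
apply: le_Rintegral => //; first exact: integrable_norm_fun (coord_oc t i s0).
  exact: g_oc.
by move=> r _; rewrite /g (bigD1 i)//= lerDl sumr_ge0.
Qed.

Lemma arclen_cont T : 0 <= T -> {within `[0, T], continuous arclen}.
Proof. by move=> T0; apply: parameterized_integral_continuous => //; exact: g_cc. Qed.

Lemma state_at t (e : R) : 0 <= t -> 0 < e ->
  exists2 d : R, 0 < d & forall s, 0 <= s -> `|s - t| < d -> `|y s - y t| < e.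
Proof.
move=> t0 e0.
have T0 : 0 <= t + 1 by lra.
have /subspace_continuousP /(_ t) := arclen_cont T0.
have tin : `[0, t + 1]%classic t by rewrite /= in_itv/= t0; lra.
move=> /(_ tin)/cvgrPdist_lt/(_ e e0); rewrite near_withinE => /nbhs_ballP[d d0 Hd].
exists (Num.min d 1) => [|s s0]; first by rewrite lt_min; apply/andP; split.
rewrite lt_min => /andP[sd s1].
have st1 : s <= t + 1 by move: s1; rewrite ltr_norml => /andP[]; lra.
have := Hd s; rewrite /ball/= distrC => /(_ sd).
rewrite in_itv/= s0 => /(_ st1) H.
have [ts|st] := leP t s.
  apply: le_lt_trans (arclen_norm _) _; first by rewrite t0.
  by apply: le_lt_trans H; rewrite distrC ler_norm.
rewrite distrC; apply: le_lt_trans (arclen_norm _) _; first by rewrite s0 ltW.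
by apply: le_lt_trans H; rewrite ler_norm.
Qed.

(* The defect [Phi (y t) - Phi (y s) - \int l] is additive in [[s, t]] and at most quadratic in the
   arc length, so halving the arc length repeatedly shows that it is nonpositive. *)
Lemma dissipation T (Phi : 'cV[R]_n -> R) (phi : 'cV[R]_n -> 'cV[R]_n) (rho C : R) (l : R -> R) :
  0 <= T -> 0 <= C ->
  (forall t, 0 <= t <= T -> `|y t| <= rho) ->
  (forall a b, `|a| <= rho -> `|b| <= rho ->
    Phi b - Phi a <= dotv (phi a) (b - a) + C * `|b - a| ^+ 2) ->
  (forall a b, `|a| <= rho -> `|b| <= rho -> `|phi a - phi b| <= C * `|a - b|) ->
  mu.-integrable `[0, T] (EFin \o l) ->
  {ae mu, forall t, 0 <= t <= T -> dotv (phi (y t)) (yd t) <= l t} ->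
  Phi (y T) - Phi (y 0) <= \int[mu]_(t in `[0, T]) l t.
Proof.
move=> T0 C0 yr HPhi Hphi il ael.
pose L t := \int[mu]_(r in `[0, t]) l r.
pose D s t := Phi (y t) - Phi (y s) - (L t - L s).
(* On [[s, t]] the covector is frozen at [phi (y s)]: replacing it costs [C * dl] times the arc
   length, and the expansion of [Phi] costs another [C * dl ^+ 2]. *)
have base s t : 0 <= s -> s <= t -> t <= T -> D s t <= 2 * C * (arclen t - arclen s) ^+ 2.
  move=> s0 st tT; have st' : 0 <= s <= t by rewrite s0.
  have ys : `|y s| <= rho by apply: yr; rewrite s0 (le_trans st).
  have yt : `|y t| <= rho by apply: yr; rewrite (le_trans s0).
  have iloc : mu.-integrable `[0, t] (EFin \o l).
    by apply: integrableS il => //; apply: subset_itvl; rewrite bnd_simp.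
  have ilo : mu.-integrable `]s, t] (EFin \o l).
    apply: integrableS iloc => //.
    by apply: subset_itvr; rewrite bnd_simp.
  set dl := arclen t - arclen s; have dl0 : 0 <= dl by rewrite subr_ge0 arclen_nondecreasing.
  have H1 : dotv (phi (y s)) (y t - y s) <= (L t - L s) + C * dl * dl.
    rewrite /L cum_sub// {2}/dl arclen_sub// -RintegralZl//; last exact: g_oc.
    have iCg : mu.-integrable `]s, t] (EFin \o (fun r => C * dl * g r)).
      by apply: integrableZ_fun => //; exact: g_oc.
    rewrite -RintegralD//.
    have iph i : mu.-integrable `]s, t] (EFin \o (fun r => phi (y s) i 0 * yd r i 0)).
      by apply: integrableZ_fun => //; exact: coord_oc.
    have [iS ES] := @Rintegral_sum _ _ _ mu `]s, t] n _ (measurable_itv _) iph.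
    rewrite (_ : dotv _ _ = \int[mu]_(r in `]s, t]) (\sum_i phi (y s) i 0 * yd r i 0)); last first.
      rewrite ES dotvE; apply: eq_bigr => i _; rewrite !mxE coord_sub// RintegralZl//.
      exact: coord_oc.
    apply: ae_le_Rintegral => //; first exact: integrableD_fun.
    apply: ae_imply ael _ => r H; rewrite /= in_itv/= => /andP[sr rt].
    have r0 : 0 <= r by rewrite (le_trans s0)// ltW.
    have rT : 0 <= r <= T by rewrite r0 (le_trans rt).
    have := H rT; rewrite !dotvE => Hr.
    have : \sum_i phi (y s) i 0 * yd r i 0 - \sum_i phi (y r) i 0 * yd r i 0 <= C * dl * g r.
      rewrite -sumrB /g mulr_sumr; apply: ler_sum => i _; rewrite -mulrBl.
      apply: le_trans (ler_norm _) _; rewrite normrM ler_wpM2r//.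
      apply: le_trans (_ : `|phi (y s) - phi (y r)| <= _).
        by have := mx_coord_le (phi (y s) - phi (y r)) i 0; rewrite !mxE.
      apply: le_trans (Hphi _ _ ys (yr r rT)) _; rewrite ler_wpM2l// distrC.
      apply: le_trans (arclen_norm _) _; first by rewrite s0 ltW.
      by rewrite lerD2r arclen_nondecreasing// r0.
    lra.
  have H2 := HPhi _ _ ys yt.
  have H3 : C * `|y t - y s| ^+ 2 <= C * dl ^+ 2.
    by rewrite ler_wpM2l// lerXn2r ?nnegrE//; exact: arclen_norm.
  rewrite /D; rewrite !expr2 in H2 H3 *; lra.
have key j : forall s t, 0 <= s -> s <= t -> t <= T ->
    D s t <= 2 * C * (arclen t - arclen s) ^+ 2 * 2^-1 ^+ j.
  elim: j => [|j IH] s t s0 st tT; first by rewrite expr0 mulr1; exact: base.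
  have mst : arclen s <= arclen t by rewrite arclen_nondecreasing// s0.
  (* The interval is cut where the arc length, not the time, is bisected; each half carries a
     quarter of the bound, so the sum carries half of it. *)
  have [|||r] := @IVT _ arclen s t ((arclen s + arclen t) / 2).
  - exact: st.
  - apply: continuous_subspaceW (arclen_cont T0).
    by apply: subset_itv; rewrite bnd_simp.
  - by rewrite (min_idPl mst) (max_idPr mst); apply/andP; split; lra.
  rewrite in_itv/= => /andP[sr rt] Er.
  have H1 := IH s r s0 sr (le_trans rt tT); have H2 := IH r t (le_trans s0 sr) rt tT.
  have DE : D s t = D s r + D r t by rewrite /D; ring.
  rewrite DE; apply: le_trans (lerD H1 H2) _; rewrite Er (exprSr _ j); set h := 2^-1 ^+ j.
  by rewrite le_eqVlt; apply/orP; left; apply/eqP; field.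
have := @halves_le _ (D 0 T) 0 (2 * C * (arclen T - arclen 0) ^+ 2).
have L0 : L 0 = 0 by rewrite /L set_itv1 Rintegral_set1.
rewrite {2}/D L0 subr0 subr_le0 -/(L T); apply => j.
by rewrite add0r; exact: key.
Qed.

End Dissipation.

(** * Extremals *)

Section ChainRule.
Context {R : realType}.

Lemma is_derive_epsP (u : R -> R) (s l : R) : is_derive s 1 u l ->
  forall e : R, 0 < e -> exists2 d : R, 0 < d & forall h : R, `|h| < d ->
     `|u (s + h) - u s - h * l| <= e * `|h|.
Proof.
move=> [D <-] e e0; have Du : differentiable u s by apply/derivable1_diffP.
have [d d0 Hd] := diff_eps Du e0; exists d => // h hd; have := Hd h hd.
by rewrite -{2}(mulr1 h) -[h * 1]/(h *: (1 : R)) !deriveE// linearZ.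
Qed.

Lemma dmx_eps n (Y : R -> 'cV[R]_n) Y' (t : R) : dmx Y Y' t ->
  forall e : R, 0 < e -> exists2 d : R, 0 < d & forall h : R, `|h| < d ->
     `|Y (t + h) - Y t - h *: Y'| <= e * `|h|.
Proof.
move=> dY e e0.
have [||d d0 Hd] := @finite_radius _ n (fun i d => forall h : R, `|h| < d ->
    `|Y (t + h) i 0 - Y t i 0 - h * Y' i 0| <= e * `|h|).
- by move=> i d d' dd H h hd; apply: H; exact: lt_le_trans dd.
- by move=> i; exact: is_derive_epsP (dY i 0) e e0.
exists d => // h hd; apply: cV_norm_le => [|i]; first by rewrite mulr_ge0// ltW.
by rewrite !mxE; exact: Hd.
Qed.

Lemma dmx_chain n q (f : 'cV[R]_n -> 'cV[R]_q) (Y : R -> 'cV[R]_n) Y' (t : R) :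
  differentiable f (Y t) -> dmx Y Y' t -> dmx (fun s => f (Y s)) ('D_Y' f (Y t)) t.
Proof.
move=> df dY i j; rewrite (ord1 j) {j}; apply: is_derive_eps => e e0.
have lin := diff_linear df; have [C C0 HC] := cV_linear_bound lin.
pose k := `|Y'| + 1; have k0 : 0 < k by rewrite ltr_wpDl.
pose e1 := e / 2 / k; have e10 : 0 < e1 by rewrite !divr_gt0.
have [d1 d10 H1] := diff_eps df e10.
pose e2 := Num.min 1 (e / 2 / (C + 1)).
have e20 : 0 < e2 by rewrite lt_min ltr01/= !divr_gt0// ltr_wpDl.
have [d2 d20 H2] := dmx_eps dY e20.
exists (Num.min d2 (d1 / k)) => [|h]; first by rewrite lt_min d20 divr_gt0.
rewrite lt_min ltr_pdivlMr// => /andP[h2 hk].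
have := H2 h h2; set K := Y (t + h) - Y t => HK.
have Kn : `|K| <= k * `|h|.
  have -> : K = (K - h *: Y') + h *: Y' by rewrite subrK.
  apply: le_trans (ler_normD _ _) _; rewrite normrZ mulrDl mul1r addrC (mulrC `|h|) lerD2l.
  by apply: le_trans HK _; rewrite ler_piMl// ge_min lexx.
have Kd : `|K| < d1 by apply: le_lt_trans Kn _; rewrite mulrC.
have := H1 K Kd; rewrite {1}/K (addrC (Y t)) subrK => F1.
have F2 : `|'D_(K - h *: Y') f (Y t)| <= e / 2 * `|h|.
  apply: le_trans (HC _) _; apply: le_trans (ler_wpM2l C0 HK) _.
  rewrite mulrA ler_wpM2r//; apply: le_trans (_ : (C + 1) * e2 <= _).
    by rewrite ler_wpM2r ?(ltW e20)// lerDl.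
  by rewrite mulrC -ler_pdivlMr ?ltr_wpDl// ge_min lexx orbT.
have F3 : e1 * `|K| <= e / 2 * `|h|.
  apply: le_trans (ler_wpM2l (ltW e10) Kn) _.
  by rewrite mulrA /e1 divfK// gt_eqF.
have lE : 'D_(K - h *: Y') f (Y t) = 'D_K f (Y t) - h *: 'D_Y' f (Y t).
  by rewrite !deriveE// linearB linearZ.
have := le_trans (mx_coord_le _ i 0) F1; have := le_trans (mx_coord_le _ i 0) F2.
rewrite lE !mxE => G2 G1.
have -> : f (Y (t + h)) i 0 - f (Y t) i 0 - h * 'D_Y' f (Y t) i 0 =
  (f (Y (t + h)) i 0 - f (Y t) i 0 - 'D_K f (Y t) i 0) + ('D_K f (Y t) i 0 - h * 'D_Y' f (Y t) i 0).
  by ring.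
apply: le_trans (ler_normD _ _) _.
apply: le_trans (lerD G1 G2) _; lra.
Qed.

End ChainRule.

(** * The nonlinear part of Pontryagin's system *)

Section Nonlinearity.
Context {R : realType}.
Variables (n : nat) (f : 'cV[R]_n -> 'cV[R]_n).
Let A := jacobian0 f.

Lemma jacobian0E v : differentiable f 0 -> 'D_v f 0 = A *m v.
Proof.
move=> df; rewrite (cV_linear_sum v (diff_linear df)); apply/colP => i.
rewrite summxE mxE; apply: eq_bigr => j _.
by rewrite [A i j]mxE !mxE deriveE// mulrC.
Qed.

(* [Df(y)^T p] *)
Definition Dtr (y p : 'cV[R]_n) : 'cV[R]_n := \col_j dotv ('D_(delta_mx j 0) f y) p.

Lemma dotv_Dtr y p v : differentiable f y -> dotv (Dtr y p) v = dotv p ('D_v f y).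
Proof.
move=> df; rewrite (cV_linear_sum v (diff_linear df)) dotvE.
rewrite (big_morph (dotv p) (fun u v => dotvDr p u v) (dotv0r p)).
by apply: eq_bigr => j _; rewrite dotvZr mxE mulrC dotvC.
Qed.

(** The remainder of Pontryagin's vector field after removing its linear part [ham] at 0. It
    contains [Df], so it has one derivative less than [f]. *)
Definition hamG (z : 'cV[R]_(n + n)) : 'cV[R]_(n + n) :=
  col_mx (f (usubmx z) - A *m usubmx z) (A^T *m dsubmx z - Dtr (usubmx z) (dsubmx z)).

Lemma CkOn_hamG k : CkOn k.+1 f setT -> CkOn k hamG setT.
Proof.
move=> Cf; have oT : open (setT : set 'cV[R]_(n + n)) by exact: openT.
have Cu l (h : 'cV[R]_n -> 'cV[R]_n) i : CkOn l h setT ->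
    CkOn l (fun z : 'cV[R]_(n + n) => h (usubmx z) i 0) setT.
  by move=> Ch; apply: CkOn_coord => //; exact: CkOn_usub.
have Cp i : CkOn k (fun z : 'cV[R]_(n + n) => dsubmx z i 0) setT.
  rewrite (_ : (fun z => _) = (fun z : 'cV[R]_(n + n) => z (rshift n i) 0)).
    exact: CkOn_proj.
  by apply/funext => z; rewrite mxE.
have Cy i : CkOn k (fun z : 'cV[R]_(n + n) => usubmx z i 0) setT.
  rewrite (_ : (fun z => _) = (fun z : 'cV[R]_(n + n) => z (lshift n i) 0)).
    exact: CkOn_proj.
  by apply/funext => z; rewrite mxE.
have Csum (a b : 'I_n -> 'cV[R]_(n + n) -> R) : (forall i, CkOn k (a i) setT) ->
    (forall i, CkOn k (b i) setT) -> CkOn k (fun z => \sum_i a i z * b i z) setT.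
  move=> Ca Cb; apply: CkOn_sum => // i.
  exact: (@CkOnZ _ _ R k (a i) (b i)).
have CN (a : 'cV[R]_(n + n) -> R) : CkOn k a setT -> CkOn k (fun z => - a z) setT.
  move=> Ca; rewrite (_ : (fun z => _) = (fun z => (fun=> -1 : R) z *: a z)).
    by apply: CkOnZ => //; exact: CkOn_cst.
  by apply/funext => z; rewrite scaleN1r.
apply: CkOn_coords => // i; rewrite /hamG; case: (split_ordP i) => j -> /=.
  rewrite (_ : (fun z => _) = (fun z => f (usubmx z) j 0 + - \sum_l A j l * usubmx z l 0)).
    apply: CkOnD => //; first exact/Cu/CkOn_pred.
    by apply: CN; apply: Csum => // l; exact: CkOn_cst.
  by apply/funext => z; rewrite col_mxEu !mxE; congr (_ - _); apply: eq_bigr => l _; rewrite mxE.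
rewrite (_ : (fun z => _) = (fun z => \sum_l A l j * dsubmx z l 0 +
    - \sum_l 'D_(delta_mx j 0) f (usubmx z) l 0 * dsubmx z l 0)).
  apply: CkOnD => //; first by apply: Csum => // l; exact: CkOn_cst.
  by apply: CN; apply: Csum => // l; apply: (Cu _ (fun y => 'D_(delta_mx j 0) f y)); exact: Cf.2.
apply/funext => z; rewrite col_mxEd !mxE dotvE; congr (_ - _).
by apply: eq_bigr => l _; rewrite !mxE.
Qed.

Lemma hamG0 : f 0 = 0 -> hamG 0 = 0.
Proof.
move=> f0; have D0 : Dtr 0 0 = 0 by apply/colP => i; rewrite !mxE dotv0r.
have u0 : usubmx (0 : 'cV[R]_(n + n)) = 0 by apply/colP => i; rewrite !mxE.
have d0 : dsubmx (0 : 'cV[R]_(n + n)) = 0 by apply/colP => i; rewrite !mxE.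
by rewrite /hamG u0 d0 f0 !mulmx0 D0 subrr col_mx0.
Qed.

(** The upper component is the Taylor remainder of [f] at 0; the lower one is [Df(0) - Df(y)],
    transposed and applied to [p], a product of two small quantities. *)
Lemma hamG_flat v : CkOn 1 f setT -> f 0 = 0 -> 'D_v hamG 0 = 0.
Proof.
move=> Cf f0; have df x : differentiable f x by case: Cf => + _; apply.
have [||_ ->] // := @diff_cV _ _ _ hamG (fun=> 0) 0.
  by move=> a u w; rewrite scaler0 addr0.
move=> e e0; have [d1 d10 H1] := diff_eps (df 0) e0.
have e1 : 0 < e / n.+1%:R by rewrite divr_gt0.
have [d2 d20 H2] := C1_derive_near0 e1 Cf.
exists (Num.min d1 d2) => [|h]; first by rewrite lt_min d10.
rewrite lt_min => /andP[hd1 hd2]; rewrite add0r hamG0// !subr0.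
apply: norm_col_mx.
  have := H1 (usubmx h) (le_lt_trans (norm_usubmx h) hd1).
  rewrite add0r f0 subr0 jacobian0E// => /le_trans; apply.
  by rewrite ler_wpM2l ?norm_usubmx// ltW.
rewrite -normrN opprB; apply: cV_norm_le => [|j]; first by rewrite mulr_ge0// ltW.
have -> : (Dtr (usubmx h) (dsubmx h) - A^T *m dsubmx h) j 0 =
    dotv ('D_(delta_mx j 0) f (usubmx h) - 'D_(delta_mx j 0) f 0) (dsubmx h).
  rewrite !mxE dotvDl dotvNl; congr (_ - _); rewrite dotvE; apply: eq_bigr => i _.
  by rewrite jacobian0E// -colE !mxE.
apply: le_trans (dotv_norm _ _) _.
have Hu := H2 (usubmx h) (ltW (le_lt_trans (norm_usubmx h) hd2)) j.
apply: (@le_trans _ _ (n%:R * (e / n.+1%:R) * `|h|)).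
  apply: ler_pM; rewrite ?mulr_ge0// ?norm_dsubmx//.
  by rewrite ler_wpM2l.
rewrite ler_wpM2r// mulrA ler_pdivrMr// mulrC ler_wpM2l ?(ltW e0)//.
by rewrite ler_nat.
Qed.

End Nonlinearity.

Section ScalarCalculus.
Context {R : realType}.

Lemma is_derive_addf (g h : R -> R) dg dh (t : R) :
  is_derive t 1 g dg -> is_derive t 1 h dh -> is_derive t 1 (fun s => g s + h s) (dg + dh).
Proof. exact: (@is_deriveD R R R). Qed.

Lemma is_derive_subf (g h : R -> R) dg dh (t : R) :
  is_derive t 1 g dg -> is_derive t 1 h dh -> is_derive t 1 (fun s => g s - h s) (dg - dh).
Proof. exact: (@is_deriveB R R R). Qed.

Lemma is_derive_scalef c (g : R -> R) dg (t : R) :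
  is_derive t 1 g dg -> is_derive t 1 (fun s => c * g s) (c * dg).
Proof.
move=> dg_; apply: is_derive_eq (is_derive_mulf (is_derive_cst c t 1) dg_) _.
by rewrite mul0r add0r.
Qed.

Lemma continuous_dotv n (u v : R -> 'cV[R]_n) : cmx u -> cmx v ->
  continuous (fun t => dotv (u t) (v t)).
Proof. by move=> cu cv; have H : cmx _ := cmxM (cmx_tr cu) cv; exact: (H 0 0). Qed.

Lemma continuous_addf (g h : R -> R) : continuous g -> continuous h ->
  continuous (fun t => g t + h t).
Proof. by move=> cg ch t; apply: cvgD; [exact: cg|exact: ch]. Qed.

Lemma continuous_subf (g h : R -> R) : continuous g -> continuous h ->
  continuous (fun t => g t - h t).
Proof. by move=> cg ch t; apply: cvgB; [exact: cg|exact: ch]. Qed.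

Lemma continuous_scalef c (g : R -> R) : continuous g -> continuous (fun t => c * g t).
Proof. by move=> cg t; apply: cvgM; [exact: cvg_cst|exact: cg]. Qed.

Lemma scalar_primitive (h : R -> R) : continuous h ->
  exists L : R -> R, [/\ continuous L, L 0 = 0 & forall t : R, 0 < t -> is_derive t 1 L (h t)].
Proof.
move=> ch; have [|H [cH H0 dH]] := @primitive0 _ 1 (fun t => const_mx (h t)).
  by move=> i j; rewrite (_ : (fun s => _) = h)//; apply/funext => s; rewrite mxE.
exists (fun t => H t 0 0); split; [exact: cH|by rewrite H0// mxE|].
by move=> t t0; have := dH t t0 0 0; rewrite mxE.
Qed.

Lemma exp_bound_diff (F F' : R -> R) (Q g : R) (s t : R) : 0 < g -> 0 <= Q -> 0 <= s -> s <= t ->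
  continuous F -> (forall r : R, 0 < r -> is_derive r 1 F (F' r)) ->
  (forall r, 0 < r -> `|F' r| <= Q * expR (- (g * r))) ->
  `|F t - F s| <= Q / g * expR (- (g * s)).
Proof.
move=> g0 Q0 s0 st cF dF bF.
pose G (r : R) := - (Q / g) * expR (- g * r).
have dG (r : R) : is_derive r 1 G (Q * expR (- (g * r))).
  apply: is_derive_eq (is_derive_expc _ _ r) _.
  by rewrite (mulNr g r); field; rewrite gt_eqF.
have := @derive_le_diff _ F F' G (fun r => Q * expR (- (g * r))) s t st cF (continuous_derive dG).
move=> H; apply: le_trans (H _ _ _) _.
- by move=> r /andP[sr _]; apply: dF; exact: le_lt_trans sr.
- by move=> r /andP[sr _]; apply: bF; exact: le_lt_trans sr.
rewrite /G !mulNr opprK gerDr oppr_le0 mulr_ge0 ?expR_ge0//.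
by rewrite divr_ge0// ltW.
Qed.

End ScalarCalculus.

Section Extremals.
Context {R : realType}.
Local Notation mu := (@lebesgue_measure R).
Variables (n m : nat) (f : 'cV[R]_n -> 'cV[R]_n) (B : 'M[R]_(n, m)) (beta : R).
Hypothesis beta0 : 0 < beta.
Let S := ctrlS B beta.
Variables (r g cf cT : R).
Hypothesis r0 : 0 < r.
Hypothesis g0 : 0 < g.
Hypothesis cf0 : 0 <= cf.
Hypothesis cT0 : 0 <= cT.
Let e := expw g.
Let we : weight e. Proof. exact: weight_expw (ltW g0). Qed.
Let e_ge0 t : 0 <= e t. Proof. exact: weight_ge0 we t. Qed.
Let e_le1 t : e t <= 1. Proof. exact: weight_le1 we t. Qed.
Hypothesis df : forall x, differentiable f x.
Hypothesis f0 : f 0 = 0.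
Hypothesis lf : liponball f r cf.
Hypothesis Tf : forall a b, `|a| <= r -> `|b| <= r ->
  `|f b - f a - 'D_(b - a) f a| <= cT * `|b - a| ^+ 2.

(* Pontryagin's system for [z = (y, p)]. *)
Definition extremal (y0 : 'cV[R]_n) (z : R -> 'cV[R]_(n + n)) :=
  [/\ cmx z, bd e z r, usubmx (z 0) = y0,
    forall t : R, 0 < t ->
      dmx (fun s => usubmx (z s)) (f (usubmx (z t)) - S *m dsubmx (z t)) t &
    forall t : R, 0 < t ->
      dmx (fun s => dsubmx (z s)) (- usubmx (z t) - Dtr f (usubmx (z t)) (dsubmx (z t))) t].

(** The minimum over [u] of [p.(f(y) + B u) + (|y|^2 + beta |u|^2) / 2], attained at
    [feedback p]. *)
Definition hamiltonian (y p : 'cV[R]_n) :=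
  dotv p (f y) - 2^-1 * dotv p (S *m p) + 2^-1 * dotv y y.

Definition runcost (y p : 'cV[R]_n) := 2^-1 * (dotv y y + dotv p (S *m p)).

Definition feedback (p : 'cV[R]_n) : 'cV[R]_m := - (beta^-1 *: (B^T *m p)).

Definition excost (z : R -> 'cV[R]_(n + n)) :=
  costJ beta (fun t => usubmx (z t)) (fun t => feedback (dsubmx (z t))).

Let cfC x : {for x, continuous f}.
Proof. exact: differentiable_continuous (df x). Qed.

Lemma B_feedback p : B *m feedback p = - (S *m p).
Proof. by rewrite /feedback mulmxN -scalemxAr mulmxA /S /ctrlS -scalemxAl. Qed.

Lemma sqnorm_feedback p : beta * sqnorm (feedback p) = dotv p (S *m p).
Proof.
rewrite ctrlS_quad -!dotv_sqnorm /feedback !dotvL opprK mulrA divff ?mul1r// gt_eqF//.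
Qed.

Lemma S_sym u v : dotv u (S *m v) = dotv v (S *m u).
Proof. by rewrite [LHS]dotvC dotv_mull ctrlS_sym. Qed.

Let cq := n%:R * (n%:R * `|S|).
Let cq0 : 0 <= cq. Proof. by rewrite !mulr_ge0. Qed.

Lemma S_norm u : `|dotv u (S *m u)| <= cq * `|u| ^+ 2.
Proof.
apply: le_trans (dotv_norm _ _) _.
apply: le_trans (ler_wpM2l _ (norm_mulmx S u)) _; first by rewrite mulr_ge0.
by rewrite le_eqVlt; apply/orP; left; apply/eqP; rewrite /cq expr2; ring.
Qed.

Section OneExtremal.
Variables (y0 : 'cV[R]_n) (z : R -> 'cV[R]_(n + n)).
Hypothesis ez : extremal y0 z.
Let Y t := usubmx (z t).
Let p t := dsubmx (z t).
Let Y' t := f (Y t) - S *m p t.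

Let cz : cmx z. Proof. by case: ez. Qed.
Let cY : cmx Y. Proof. exact: cmx_usub. Qed.
Let cp : cmx p. Proof. exact: cmx_dsub. Qed.
Let cfY : cmx (fun t => f (Y t)). Proof. exact: cmx_compG. Qed.
Let cSp : cmx (fun t => S *m p t). Proof. exact: cmx_mull. Qed.
Let bY : bd e Y r.
Proof. by move=> t; apply: le_trans (norm_usubmx _) _; case: ez => _ + _ _ _; apply. Qed.
Let bp : bd e p r.
Proof. by move=> t; apply: le_trans (norm_dsubmx _) _; case: ez => _ + _ _ _; apply. Qed.
Let Yr t : `|Y t| <= r. Proof. exact: (bd_norm we t (ltW r0) bY). Qed.
Let pr t : `|p t| <= r. Proof. exact: (bd_norm we t (ltW r0) bp). Qed.
Let fY_le t : `|f (Y t)| <= cf * `|Y t|.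
Proof.
have := lf (Yr t) (_ : `|0| <= r); rewrite normr0 f0 !subr0; apply; exact: ltW.
Qed.

Let sq_le (x : R) t : 0 <= x -> x <= r * e t -> x ^+ 2 <= r ^+ 2 * e t.
Proof.
move=> x0 xr; apply: le_trans (_ : (r * e t) ^+ 2 <= _).
  by rewrite lerXn2r// nnegrE mulr_ge0// ltW.
by rewrite exprMn ler_wpM2l ?sqr_ge0// expr2 ler_piMr.
Qed.

Let runcost_le t : `|runcost (Y t) (p t)| <= (n%:R + cq) * r ^+ 2 * e t.
Proof.
rewrite /runcost; have H1 := S_norm (p t); have H2 := sqnorm_norm (Y t).
have H3 := sqnorm_ge0 (Y t).
have H4 := ler_wpM2l cq0 (sq_le (normr_ge0 _) (bp t)).
have H5 := ler_wpM2l (ler0n R n) (sq_le (normr_ge0 _) (bY t)).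
have H6 := ctrlS_pos B beta0 (p t); rewrite -/S in H6.
have H7 := ler_norm (dotv (p t) (S *m p t)).
rewrite dotv_sqnorm ger0_norm; last by rewrite mulr_ge0 ?invr_ge0// addr_ge0.
apply: (@le_trans _ _ (sqnorm (Y t) + dotv (p t) (S *m p t))).
  by rewrite ler_piMl ?addr_ge0// invf_le1// ler1n.
rewrite -mulrA mulrDl; apply: lerD; first exact: le_trans H2 H5.
exact: le_trans H7 (le_trans H1 H4).
Qed.

Lemma hamiltonian_extremal : hamiltonian y0 (p 0) = 0.
Proof.
have [_ _ z0 dY dp] := ez; pose h t := hamiltonian (Y t) (p t).
have dh (t : R) : 0 < t -> is_derive t 1 h 0.
  move=> t0; have dYt := dY t t0; have dpt := dp t t0.
  have d1 := is_derive_dotv dpt (dmx_chain (df _) dYt).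
  have d2 := is_derive_scalef 2^-1 (is_derive_dotv dpt (dmxMl S dpt)).
  have d3 := is_derive_scalef 2^-1 (is_derive_dotv dYt dYt).
  apply: is_derive_eq (is_derive_addf (is_derive_subf d1 d2) d3) _.
  rewrite -/(Y t) -/(p t) -/(Y' t).
  rewrite -(dotv_Dtr _ _ (df _)) (S_sym (p t)); set q := - Y t - _.
  have -> : Dtr f (Y t) (p t) = - q - Y t by rewrite /q opprB opprK addrK.
  have E : dotv q (Y' t) = dotv q (f (Y t)) - dotv q (S *m p t) by rewrite /Y' dotvDr dotvNr.
  have E2 : dotv (- q - Y t) (Y' t) = - dotv q (Y' t) - dotv (Y t) (Y' t) by rewrite dotvDl !dotvNl.
  rewrite E2 E (dotvC (Y' t) (Y t)).
  by move: (dotv q (f (Y t))) (dotv q (S *m p t)) (dotv (Y t) (Y' t)) => a1 a2 a3; field.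
have ch : continuous h.
  apply: continuous_addf; last exact/continuous_scalef/continuous_dotv.
  apply: continuous_subf; first exact: continuous_dotv.
  exact/continuous_scalef/continuous_dotv.
have h0 : h 0 = hamiltonian y0 (p 0) by rewrite /h /Y z0.
have hc t : 0 <= t -> h t = h 0.
  by move=> t0; apply: derive0_cst => // x /andP[x0 _]; exact: dh.
pose C := n%:R * cf * r ^+ 2 + cq * r ^+ 2 + n%:R * r ^+ 2.
have hb t : 0 <= t -> `|h 0| <= C * expR (- (g * t)).
  move=> t0; rewrite -(hc t t0) -(expw_id _ t0) -/(e t).
  have H1 : `|dotv (p t) (f (Y t))| <= n%:R * cf * r ^+ 2 * e t.
    apply: le_trans (dotv_norm _ _) _.
    have -> : n%:R * cf * r ^+ 2 * e t = n%:R * (r * e t) * (cf * r) by rewrite expr2; ring.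
    apply: ler_pM; rewrite ?mulr_ge0//; first by rewrite ler_wpM2l.
    by apply: le_trans (fY_le t) _; rewrite ler_wpM2l.
  have H2 := S_norm (p t); have H3 := ler_wpM2l cq0 (sq_le (normr_ge0 _) (bp t)).
  have H4 := sqnorm_norm (Y t); have H5 := ler_wpM2l (ler0n R n) (sq_le (normr_ge0 _) (bY t)).
  have H6 := sqnorm_ge0 (Y t).
  rewrite /h /hamiltonian dotv_sqnorm.
  move: H1 H2; rewrite !ler_norml => /andP[a1 a2] /andP[b1 b2].
  rewrite /C !mulrDl; rewrite -!mulrA in H3 H5 a1 a2 b1 b2 *.
  by apply/andP; split; lra.
rewrite -h0; apply/eqP; rewrite -normr_le0 -oppr_ge0.
by apply: (@ge0_exp _ _ C _ g0) => t t0; rewrite lerN2; exact: hb.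
Qed.

Lemma extremal_admissible : admissible f B y0 Y (fun t => feedback (p t)).
Proof.
have [_ _ z0 dY dp] := ez.
have wY : isWderiv Y Y'.
  apply: (@isWderiv_exp _ _ _ _ g r (cf * r + n%:R * `|S| * r)) => //.
  - exact: cmxB.
  - apply: bdB; last exact: bd_mul.
    by move=> t; apply: le_trans (fY_le t) _; rewrite -mulrA ler_wpM2l.
split; first by exists Y'.
split.
  have E : (fun t => feedback (p t)) = (fun t => (- (beta^-1 *: B^T)) *m p t).
    by apply/funext => t; rewrite /feedback mulNmx scalemxAl.
  rewrite E; apply: (@isL2_exp _ _ _ g (n%:R * `|- (beta^-1 *: B^T)| * r)) => //.
    exact: cmx_mull.
  exact: bd_mul.
split; first exact: z0.
exists Y'; split=> //; apply: ae_all => t _.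
by rewrite B_feedback.
Qed.

(** The cost over the half-line becomes the limit of a primitive, with an explicit rate, so that
    costs of two extremals can be compared by differentiating in time. *)
Lemma excost_limit L : continuous L -> L 0 = 0 ->
  (forall t : R, 0 < t -> is_derive t 1 L (runcost (Y t) (p t))) ->
  forall t, 0 <= t -> `|excost z - L t| <= (n%:R + cq) * r ^+ 2 / g * expR (- (g * t)).
Proof.
move=> cL L0 dL; pose Q := (n%:R + cq) * r ^+ 2.
have Q0 : 0 <= Q by rewrite mulr_ge0 ?sqr_ge0// addr_ge0.
have bL (s t : R) : 0 <= s -> s <= t -> `|L t - L s| <= Q / g * expR (- (g * s)).
  move=> s0 st; apply: (exp_bound_diff g0 Q0 s0 st cL dL) => t' t'0.
  by rewrite -(expw_id _ (ltW t'0)); exact: runcost_le.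
have [l Hl] := exp_lim (divr_ge0 Q0 (ltW g0)) bL.
suff -> : excost z = l by [].
have cl : continuous (fun t => runcost (Y t) (p t)).
  by apply/continuous_scalef/continuous_addf; exact: continuous_dotv.
have [_ [iu _]] := extremal_admissible.
have iY : isL2 Y by have [[yd [? _]] _] := extremal_admissible.
have mI := @measurable_Iset R.
have [J1 J2] := (isL2_integrable iY, isL2_integrable iu).
have -> : excost z = \int[mu]_(t in (@Iset R)) runcost (Y t) (p t).
  rewrite /excost /costJ.
  have -> : fine (L2sq (fun t => usubmx (z t))) = \int[mu]_(t in (@Iset R)) sqnorm (Y t) by [].
  have -> : fine (L2sq (fun t => feedback (dsubmx (z t)))) = \int[mu]_(t in (@Iset R)) sqnorm (feedback (p t)) by [].
  rewrite -RintegralZl// -RintegralD//; last exact: integrableZ_fun.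
  rewrite -RintegralZl//; last by apply: integrableD_fun => //; exact: integrableZ_fun.
  by apply: eq_Rintegral => t _; rewrite sqnorm_feedback -dotv_sqnorm.
rewrite -[RHS]subr0 -[in RHS]L0; apply: Rintegral_ge0_continuous_FTC2y => //.
- move=> t _; rewrite /runcost dotv_sqnorm mulr_ge0 ?invr_ge0// addr_ge0 ?sqnorm_ge0//.
  exact: ctrlS_pos.
- exact: continuous_subspaceT.
- apply/cvgrPdist_lt => eps eps0; have [T T0 HT] := exp_small (Q / g) g0 eps0.
  apply: filterS (nbhs_pinfty_ge (num_real T)) => t Tt.
  apply: le_lt_trans (Hl t (le_trans T0 Tt)) _; apply: le_lt_trans HT.
  by rewrite ler_wpM2l ?divr_ge0 ?(ltW g0)// ler_expR lerN2 ler_pM2l.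
- by move=> t t0; have [] := dL t t0.
- by apply: cvg_at_right_filter; exact: cL.
- by move=> t; rewrite in_itv/= andbT => t0; rewrite derive1E; have [_ ->] := dL t t0.
Qed.

End OneExtremal.

(** Three contributions to the rate of the second-order defect: the square of the state difference,
    the form of [S] at the costate difference, and the Taylor remainder of [f] paired with a costate
    of size at most [r]. *)
Let Q := n%:R + cq + n%:R * r * cT.

Definition quadC := Q / g.

Lemma quadC_ge0 : 0 <= quadC.
Proof. by rewrite divr_ge0 ?(ltW g0)// !addr_ge0// !mulr_ge0// ltW. Qed.

(* The costate is the gradient of the cost: the first-order terms of the cost difference cancel
   against the derivative of [dotv p1 (y2 - y1)]. *)
Lemma excost_taylor y1 y2 z1 z2 D : extremal y1 z1 -> extremal y2 z2 -> 0 <= D ->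
  bd e (fun t => z2 t - z1 t) D ->
  `|excost z2 - excost z1 - dotv (dsubmx (z1 0)) (y2 - y1)| <= quadC * D ^+ 2.
Proof.
move=> e1 e2 D0 bD; have [c1 b1 i1 dY1 dp1] := e1; have [c2 b2 i2 dY2 dp2] := e2.
pose Y1 t := usubmx (z1 t); pose p1 t := dsubmx (z1 t).
pose Y2 t := usubmx (z2 t); pose p2 t := dsubmx (z2 t).
have cY1 : cmx Y1 by exact: cmx_usub. have cp1 : cmx p1 by exact: cmx_dsub.
have cY2 : cmx Y2 by exact: cmx_usub. have cp2 : cmx p2 by exact: cmx_dsub.
have crun (Y p : R -> 'cV[R]_n) : cmx Y -> cmx p -> continuous (fun t => runcost (Y t) (p t)).
  by move=> cY cp; apply/continuous_scalef/continuous_addf; apply: continuous_dotv => //; exact: cmx_mull.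
have [L1 [cL1 L10 dL1]] := scalar_primitive (crun _ _ cY1 cp1).
have [L2 [cL2 L20 dL2]] := scalar_primitive (crun _ _ cY2 cp2).
have lim1 := excost_limit e1 cL1 L10 dL1; have lim2 := excost_limit e2 cL2 L20 dL2.
pose dy t := Y2 t - Y1 t; pose dp t := p2 t - p1 t.
have bdy t : `|dy t| <= D * e t.
  apply: le_trans (bD t); rewrite /dy /Y1 /Y2 -linearB; exact: norm_usubmx.
have bdp t : `|dp t| <= D * e t.
  apply: le_trans (bD t); rewrite /dp /p1 /p2 -linearB; exact: norm_dsubmx.
have Y1r t : `|Y1 t| <= r.
  by apply: le_trans (norm_usubmx _) _; exact: (bd_norm we t (ltW r0) b1).
have Y2r t : `|Y2 t| <= r.
  by apply: le_trans (norm_usubmx _) _; exact: (bd_norm we t (ltW r0) b2).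
have p1r t : `|p1 t| <= r.
  by apply: le_trans (norm_dsubmx _) _; exact: (bd_norm we t (ltW r0) b1).
pose F t := L2 t - L1 t + dotv (p1 t) (dy t).
pose F' t := 2^-1 * (dotv (dy t) (dy t) + dotv (dp t) (S *m dp t)) +
  dotv (p1 t) (f (Y2 t) - f (Y1 t) - 'D_(dy t) f (Y1 t)).
have dF (t : R) : 0 < t -> is_derive t 1 F (F' t).
  move=> t0.
  have := is_derive_addf (is_derive_subf (dL2 t t0) (dL1 t t0))
    (is_derive_dotv (dp1 t t0) (dmxB (dY2 t t0) (dY1 t t0))).
  rewrite -/(Y1 t) -/(p1 t) -/(Y2 t) -/(p2 t) => H; apply: is_derive_eq H _.
  rewrite /F' !dotvDr !dotvNr -(dotv_Dtr _ _ (df _)) -/(dy t).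
  set q := Dtr _ _ _.
  rewrite /runcost /dy /dp !(mulmxDr, mulmxN, dotvDl, dotvDr, dotvNl, dotvNr).
  rewrite (S_sym (p2 t) (p1 t)) (dotvC (Y2 t) (Y1 t)).
  move: (dotv (Y1 t) (Y1 t)) (dotv (Y1 t) (Y2 t)) (dotv (Y2 t) (Y2 t)) => a1 a2 a3.
  move: (dotv (p1 t) (S *m p1 t)) (dotv (p1 t) (S *m p2 t)) (dotv (p2 t) (S *m p2 t)) => a4 a5 a6.
  move: (dotv q (Y1 t)) (dotv q (Y2 t)) => a7 a8.
  move: (dotv (p1 t) (f (Y1 t))) (dotv (p1 t) (f (Y2 t))) => a9 a10.
  by field.
have cF : continuous F.
  apply: continuous_addf; first exact: continuous_subf.
  by apply: continuous_dotv => //; exact: cmxB.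
have QD0 : 0 <= Q * D ^+ 2 by rewrite mulr_ge0 ?sqr_ge0// !addr_ge0// !mulr_ge0// ltW.
have sq_le (x : R) t : 0 <= x -> x <= D * e t -> x ^+ 2 <= D ^+ 2 * e t.
  move=> x0 xr; apply: le_trans (_ : (D * e t) ^+ 2 <= _).
    by rewrite lerXn2r// nnegrE mulr_ge0.
  by rewrite exprMn ler_wpM2l ?sqr_ge0// expr2 ler_piMr.
have bF t : 0 < t -> `|F' t| <= Q * D ^+ 2 * expR (- (g * t)).
  move=> t0; rewrite -(expw_id _ (ltW t0)) -/(e t).
  have H1 : `|dotv (dp t) (S *m dp t)| <= cq * (D ^+ 2 * e t).
    by apply: le_trans (S_norm _) _; rewrite ler_wpM2l// sq_le.
  have H2 : `|dotv (dy t) (dy t)| <= n%:R * (D ^+ 2 * e t).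
    rewrite dotv_sqnorm ger0_norm ?sqnorm_ge0//.
    by apply: le_trans (sqnorm_norm _) _; rewrite ler_wpM2l// sq_le.
  have H3 : `|dotv (p1 t) (f (Y2 t) - f (Y1 t) - 'D_(dy t) f (Y1 t))| <= n%:R * r * cT * (D ^+ 2 * e t).
    apply: le_trans (dotv_norm _ _) _; rewrite -[leRHS]mulrA.
    apply: ler_pM; rewrite ?mulr_ge0//; first by rewrite ler_wpM2l.
    apply: le_trans (Tf (Y1r t) (Y2r t)) _; rewrite ler_wpM2l// sq_le//; exact: bdy.
  apply: le_trans (ler_normD _ _) _; rewrite -mulrA mulrDl; apply: lerD => //.
  rewrite normrM ger0_norm ?invr_ge0//; apply: (@le_trans _ _ `|dotv (dy t) (dy t) + dotv (dp t) (S *m dp t)|).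
    by rewrite ler_piMl// invf_le1// ler1n.
  by apply: le_trans (ler_normD _ _) _; rewrite mulrDl lerD.
(* Collects what is left at time [t]: the tails of both costs and the boundary pairing of costate
   and state difference, all decaying like [exp (- g t)]. *)
pose C := 2 * ((n%:R + cq) * r ^+ 2 / g) + n%:R * r * D.
rewrite -subr_ge0; apply: (@ge0_exp _ _ C _ g0) => t t0.
have G1 := lim1 t t0; have G2 := lim2 t t0.
have G3 : `|dotv (p1 t) (dy t)| <= n%:R * r * D * expR (- (g * t)).
  apply: le_trans (dotv_norm _ _) _; rewrite -[leRHS]mulrA -(expw_id _ t0).
  by apply: ler_pM; rewrite ?mulr_ge0//; rewrite ler_wpM2l.
have := exp_bound_diff g0 QD0 (lexx 0) t0 cF dF bF; rewrite mulr0 oppr0 expR0 mulr1 => G4.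
have F0 : F 0 = dotv (p1 0) (y2 - y1) by rewrite /F L20 L10 subrr add0r /dy /Y1 /Y2 i1 i2.
have qE : quadC * D ^+ 2 = Q * D ^+ 2 / g by rewrite /quadC mulrAC.
rewrite qE -/(p1 0) -F0; rewrite lerNl opprB.
have -> : excost z2 - excost z1 - F 0 =
  (F t - F 0) + (excost z2 - L2 t) - (excost z1 - L1 t) - dotv (p1 t) (dy t) by rewrite /F; ring.
set X := (_ + _ - _ - _).
have : `|X| <= `|F t - F 0| + `|excost z2 - L2 t| + `|excost z1 - L1 t| + `|dotv (p1 t) (dy t)|.
  apply: le_trans (ler_normB _ _) _; rewrite lerD2r.
  by apply: le_trans (ler_normB _ _) _; rewrite lerD2r; exact: ler_normD.
rewrite /C; move: G1 G2 G3 G4; rewrite mulrDl; lra.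
Qed.

End Extremals.

(** * The candidate value function and its gradient *)

Section LocalValue.
Context {R : realType}.
Variables (n m : nat) (f : 'cV[R]_n -> 'cV[R]_n) (B : 'M[R]_(n, m)) (beta : R).
Let A := jacobian0 f.

Lemma ham_field (z : 'cV[R]_(n + n)) : ham A B beta *m z + hamG f z =
  col_mx (f (usubmx z) - ctrlS B beta *m dsubmx z) (- usubmx z - Dtr f (usubmx z) (dsubmx z)).
Proof.
rewrite -{1}(vsubmxK z) /ham mul_block_col /hamG add_col_mx -/A; congr col_mx.
  by rewrite mulNmx addrC addrA subrK.
by rewrite !mulNmx mul1mx addrA subrK.
Qed.

Lemma dmx_usub p q (z : R -> 'cV[R]_(p + q)) z' (t : R) :
  dmx z z' t -> dmx (fun s => usubmx (z s)) (usubmx z') t.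
Proof.
move=> dz i j; rewrite mxE (_ : (fun s => _) = fun s => z s (lshift q i) j); first exact: dz.
by apply/funext => s; rewrite mxE.
Qed.

Lemma dmx_dsub p q (z : R -> 'cV[R]_(p + q)) z' (t : R) :
  dmx z z' t -> dmx (fun s => dsubmx (z s)) (dsubmx z') t.
Proof.
move=> dz i j; rewrite mxE (_ : (fun s => _) = fun s => z s (rshift p i) j); first exact: dz.
by apply/funext => s; rewrite mxE.
Qed.

Lemma local_value k : 0 < beta -> CkOn k.+2 f setT -> f 0 = 0 ->
  (exists F : 'M[R]_(m, n), exp_stable (A + B *m F)) ->
  exists d C cf : R, exists (W : 'cV[R]_n -> R) (psi : 'cV[R]_n -> 'cV[R]_n),
  [/\ 0 < d, 0 <= C, 0 <= cf & liponball f d cf] /\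
  [/\ W 0 = 0, psi 0 = 0, CkOn k psi (openball d) &
      forall a, `|a| < d -> hamiltonian f B beta a (psi a) = 0] /\
  [/\ forall a b, `|a| < d -> `|b| < d ->
        `|W b - W a - dotv (psi a) (b - a)| <= C * `|b - a| ^+ 2,
      forall a b, `|a| < d -> `|b| < d -> `|psi a - psi b| <= C * `|a - b| &
      forall a, `|a| < d ->
        exists y u, admissible f B a y u /\ costJ beta y u = W a].
Proof.
move=> beta0 Cf f0 [F stF].
have [P [Ps RP hP]] := riccati_exists beta0 (exp_stable_hurwitz stF).
have [M [w [M0 w0 AM]]] := hurwitz_decays hP.
have so := ham_solop Ps RP w0 AM.
set g := w / 2 in so; have g0 : 0 < g by rewrite divr_gt0.
set e := expw g in so; have we : weight e by exact: weight_expw (ltW g0).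
set K := hamK _ _ _ _ _ in so; have K0 : 0 < K by exact: solop_K so.
have C1f : CkOn 1 f setT by apply: CkOn_le Cf.
have df x : differentiable f x by case: C1f => + _; apply.
have CG := CkOn_hamG Cf; have G0 := hamG0 f0; have DG0 v := hamG_flat v C1f f0.
have cG x : {for x, continuous (hamG f)} by exact: (CkOn_cont CG I).
(* This Lipschitz constant for the nonlinearity makes the contraction factor [K * c] equal to
   [1/2]. *)
pose c := (2 * K)^-1; have c0 : 0 < c by rewrite invr_gt0 mulr_gt0.
have Kc : K * c <= 2^-1 by rewrite /c invfM mulrCA divff ?mulr1// gt_eqF.
have [r1 r10 lG1] := C1_flat c0 (CkOn_le (ltn0Sn k) CG) DG0.
have [r2 [cf [r20 cf0 lf2]]] := C1_loclip C1f.
have [r3 [cT [r30 cT0 Tf3 _]]] := C2_taylor (CkOn_le (isT : (2 <= k.+2)%N) Cf).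
pose r := Num.min r1 (Num.min r2 r3).
have r0 : 0 < r by rewrite !lt_min r10 r20.
have rr1 : r <= r1 by rewrite ge_min lexx.
have rr2 : r <= r2 by rewrite !ge_min lexx orbT.
have rr3 : r <= r3 by rewrite !ge_min lexx !orbT.
have lG := liponball_le rr1 lG1; have lf := liponball_le rr2 lf2.
have Tf a b : `|a| <= r -> `|b| <= r -> `|f b - f a - 'D_(b - a) f a| <= cT * `|b - a| ^+ 2.
  by move=> ar br; apply: Tf3; exact: le_trans rr3.
pose d1 := r / (2 * K); have d10 : 0 < d1 by rewrite divr_gt0// mulr_gt0.
have ex y0 : exists z, `|y0| < d1 -> issol e (hamPsi A B beta P) (hamS A B beta w) (hamG f) r y0 z.
  have [yd|yd] := ltP `|y0| d1; last by exists (fun=> 0).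
  have [|z sz] := fixed_point we so cG G0 lG r0 (ltW c0) Kc (y0 := y0); last by exists z.
  move: yd; rewrite /d1 ltr_pdivlMr ?mulr_gt0// => yd; lra.
have [zeta Hz] := choice ex.
have [d2 d20 Hd2] := solution_Ck we so CG G0 DG0 r0 c0 Kc lG d10 Hz.
pose d := Num.min r (Num.min d1 d2).
have dr : d <= r by rewrite ge_min lexx.
have dd1 : d <= d1 by rewrite !ge_min lexx orbT.
have dd2 : d <= d2 by rewrite !ge_min lexx !orbT.
have d0 : 0 < d by rewrite lt_min r0 lt_min d10.
have sol a : `|a| < d -> issol e (hamPsi A B beta P) (hamS A B beta w) (hamG f) r a (zeta a).
  by move=> ad; apply: Hz; exact: lt_le_trans dd1.
have ext a : `|a| < d -> extremal f B beta r g a (zeta a).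
  move=> ad; have [cz bz Ez] := sol a ad.
  have [z0 dz] := ham_ode Ps RP w0 AM (sol a ad) (cmx_compG cG cz) (bd_G we G0 lG r0 (ltW c0) bz).
  split=> // t t0; have := dz t t0; rewrite ham_field => dzt.
    by have := dmx_usub dzt; rewrite col_mxKu.
  by have := dmx_dsub dzt; rewrite col_mxKd.
have lip a b : `|a| < d -> `|b| < d -> bd e (fun t => zeta a t - zeta b t) (2 * K * `|a - b|).
  move=> ad bd_ t; have := issol_lip we so cG G0 lG r0 (ltW c0) Kc (sol a ad) (sol b bd_) t.
  by rewrite mulrA.
(* The choice of [zeta] does not by itself fix its value at 0; uniqueness forces the trivial
   solution, whence [W 0 = 0] and [psi 0 = 0]. *)
have z0 : zeta 0 = fun=> 0.
  have n0 : `|0 : 'cV[R]_n| < d by rewrite normr0.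
  apply: (issol_unique we so cG G0 lG r0 (ltW c0) Kc (sol 0 n0)); split.
  - exact: (@cmx_cst _ _ _ (0 : 'cV[R]_(n + n))).
  - by move=> t; rewrite normr0 mulr_ge0 ?(ltW r0)// weight_ge0.
  - move=> t; have [_ /(_ t)] := solop_init so 0; rewrite normr0 mulr0 mul0r normr_le0 => /eqP->.
    rewrite add0r; apply/esym/eqP; rewrite -normr_le0 G0.
    have [||_ /(_ t)] := @solop_bd _ _ _ _ _ _ _ so (fun=> 0) 0.
    + exact: (@cmx_cst _ _ _ (0 : 'cV[R]_(n + n))).
    + by move=> s; rewrite normr0 mul0r.
    + by rewrite mulr0 mul0r.
pose W a := excost B beta (zeta a); pose psi a := dsubmx (zeta a 0).
(* A single constant for later use: the first summand is the quadratic remainder of [W], the second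
   the Lipschitz constant of [psi]. *)
pose C := quadC B beta r g cT * (2 * K) ^+ 2 + 2 * K.
have qC0 : 0 <= quadC B beta r g cT by exact: quadC_ge0.
have K20 : 0 <= 2 * K by rewrite mulr_ge0// ltW.
have C0 : 0 <= C by rewrite addr_ge0// mulr_ge0// sqr_ge0.
exists d, C, cf, W, psi; split; first by split=> //; exact: liponball_le lf.
split; split.
- rewrite /W z0 /excost /costJ.
  have L2z p : fine (L2sq (fun=> 0 : 'cV[R]_p)) = 0.
    rewrite /L2sq (eq_integral (fun=> 0%E)) ?integral0// => t _.
    by rewrite -dotv_sqnorm dotv0r.
  have -> : (fun t : R => usubmx ((fun=> 0 : 'cV[R]_(n + n)) t)) = (fun=> 0).
    by apply/funext => t; apply/colP => i; rewrite !mxE.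
  have -> : (fun t : R => feedback B beta (dsubmx ((fun=> 0 : 'cV[R]_(n + n)) t))) = (fun=> 0).
    apply/funext => t; rewrite /feedback (_ : dsubmx 0 = 0) ?mulmx0 ?scaler0 ?oppr0//.
    by apply/colP => i; rewrite !mxE.
  by rewrite !L2z mulr0 addr0 mulr0.
- by rewrite /psi z0; apply/colP => i; rewrite !mxE.
- apply: CkOn_coords => [|i]; first exact: open_openball.
  rewrite (_ : (fun x => _) = fun x => zeta x 0 (rshift n i) 0).
    apply: CkOn_coord; first exact: open_openball.
    by apply: CkOn_sub (Hd2 0) => x /= xd; exact: lt_le_trans dd2.
  by apply/funext => x; rewrite mxE.
- by move=> a ad; exact: (hamiltonian_extremal r0 g0 cf0 df f0 lf (ext a ad)).
- move=> a b ad bd_.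
  have D0 : 0 <= 2 * K * `|b - a| by rewrite mulr_ge0.
  apply: le_trans (excost_taylor beta0 r0 g0 cf0 cT0 df f0 lf Tf (ext a ad) (ext b bd_) D0 (lip b a bd_ ad)) _.
  by rewrite exprMn mulrA ler_wpM2r ?sqr_ge0// lerDl.
- move=> a b ad bd_; rewrite /psi -linearB.
  apply: le_trans (norm_dsubmx _) _; apply: le_trans (lip a b ad bd_ 0) _.
  by rewrite /e expw_le0// mulr1 ler_wpM2r// lerDr mulr_ge0// sqr_ge0.
- move=> a ad; exists (fun t => usubmx (zeta a t)), (fun t => feedback B beta (dsubmx (zeta a t))).
  by split=> //; exact: (extremal_admissible r0 g0 cf0 df f0 lf (ext a ad)).
Qed.

End LocalValue.

(** * Verification *)

Section Verification.
Context {R : realType}.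
Local Notation mu := (@lebesgue_measure R).

(** Were [sqnorm (y t)] above [eps] throughout, its integral over [[0, N]] would exceed the whole
    [L^2] norm squared; [N] is chosen for that. *)
Lemma L2_small p (y : R -> 'cV[R]_p) eps : isL2 y -> 0 < eps ->
  exists2 T, 0 <= T & sqnorm (y T) <= eps.
Proof.
move=> iy eps0; apply: contrapT => H.
have lo t : 0 <= t -> eps <= sqnorm (y t).
  by move=> t0; rewrite leNgt; apply/negP => /ltW ty; apply: H; exists t.
pose N := fine (L2sq y) / eps + 1.
have N0 : 0 < N by rewrite ltr_wpDl// divr_ge0 ?L2sq_ge0// ltW.
have muN : fine (mu `[0, N]) = N.
  by rewrite lebesgue_measure_itv /= lte_fin N0 -EFinB /= subr0.
have : eps * N <= fine (L2sq y).
  apply: le_trans (sqnorm_segment_le N iy (lexx 0)).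
  rewrite -{1}muN -(Rintegral_cst mu)//; apply: le_Rintegral => //.
  - exact: integrable_cst_segment.
  - exact: sqnorm_integrable_segment.
  - by move=> t; rewrite /= in_itv/= => /andP[t0 _]; exact: lo.
by rewrite /N mulrDr mulrCA divff ?gt_eqF// !mulr1; lra.
Qed.

(** A continuity argument at the supremum of the times up to which the bound holds: the improved
    bound [rho' < rho] there leaves room to go on. *)
Lemma trapped p (y yd : R -> 'cV[R]_p) (rho rho' : R) : isL2 yd ->
  (forall t, 0 <= t -> y t = y 0 + vint yd t) -> rho' < rho -> `|y 0| <= rho ->
  (forall T, 0 <= T -> (forall t, 0 <= t <= T -> `|y t| <= rho) -> `|y T| <= rho') ->
  forall t, 0 <= t -> `|y t| <= rho.
Proof.
move=> iyd yE rr y0r P T T0.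
pose S := [set t : R | 0 <= t <= T /\ forall s, 0 <= s <= t -> `|y s| <= rho].
have S0 : S 0.
  by split=> [|s /andP[s0 s0']]; rewrite ?lexx//; have -> : s = 0 by lra.
have hS : has_sup S by split; [exists 0|exists T => t [/andP[]]].
pose t1 := sup S.
have t10 : 0 <= t1 by apply: ub_le_sup; [case: hS|].
have t1T : t1 <= T by apply: ge_sup; [exists 0|move=> t [/andP[]]].
have below s : 0 <= s < t1 -> `|y s| <= rho.
  move=> /andP[s0 st]; have [|t [_ Ht] st'] := @sup_adherent _ S (t1 - s) _ hS; first by rewrite subr_gt0.
  by apply: Ht; rewrite s0 ltW//; move: st'; rewrite -/t1 opprB addrC subrK.
have at1 : `|y t1| <= rho.
  have [E|/eqP tn] := eqVneq t1 0; first by rewrite E.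
  have t1p : 0 < t1 by rewrite lt_neqAle t10 eq_sym; apply/andP; split=> //; exact/eqP.
  rewrite leNgt; apply/negP => H.
  have H0 : 0 < `|y t1| - rho by rewrite subr_gt0.
  have [d d0 Hd] := state_at iyd yE t10 H0.
  pose s := Num.max 0 (t1 - d / 2).
  have s0 : 0 <= s by rewrite le_max lexx.
  have st : s < t1 by rewrite gt_max t1p/=; lra.
  have sd : `|s - t1| < d.
    rewrite distrC ger0_norm ?subr_ge0 ?(ltW st)//.
    have : t1 - d / 2 <= s by rewrite le_max lexx orbT.
    lra.
  have := Hd s s0 sd; have := below s; rewrite s0 st => /(_ isT) h1 h2.
  have := ler_distD (y s) (y t1) 0; rewrite !subr0 distrC; lra.
have upto s : 0 <= s <= t1 -> `|y s| <= rho.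
  move=> /andP[s0]; rewrite le_eqVlt => /predU1P[->//|st].
  by apply: below; rewrite s0.
have [E|/eqP tn] := eqVneq t1 T; first by rewrite -E.
have t1l : t1 < T by rewrite lt_neqAle t1T andbT; apply/eqP.
have rr0 : 0 < rho - rho' by rewrite subr_gt0.
have [d d0 Hd] := state_at iyd yE t10 rr0.
pose t2 := Num.min T (t1 + d / 2).
have t12 : t1 < t2 by rewrite lt_min t1l/=; lra.
have : S t2.
  split; first by rewrite (le_trans t10 (ltW t12)) ge_min lexx.
  move=> s /andP[s0 st]; have [st1|st1] := leP s t1; first by apply: upto; rewrite s0.
  have sd : `|s - t1| < d.
    rewrite ger0_norm ?subr_ge0 ?(ltW st1)//.
    have : t2 <= t1 + d / 2 by rewrite ge_min lexx orbT.
    lra.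
  have h1 := Hd s s0 sd; have h2 := P t1 t10 upto.
  have := ler_distD (y t1) (y s) 0; rewrite !subr0; lra.
by move=> St2; have := ub_le_sup hS.2 St2; rewrite leNgt -/t1 t12.
Qed.

Variables (n m : nat) (f : 'cV[R]_n -> 'cV[R]_n) (B : 'M[R]_(n, m)) (beta : R).
Hypothesis beta0 : 0 < beta.
Let S := ctrlS B beta.

(** This is [beta |B^T p / beta - u|^2 >= 0], expanded. *)
Lemma ctrl_young (p : 'cV[R]_n) (u : 'cV[R]_m) :
  2 * dotv p (B *m u) <= dotv p (S *m p) + beta * sqnorm u.
Proof.
rewrite ctrlS_quad (dotvC p) dotv_mull; move: (B^T *m p) => q.
have := mulr_ge0 (ltW beta0) (sqnorm_ge0 (beta^-1 *: q - u)).
rewrite -!dotv_sqnorm !dotvL (dotvC q u).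
move: (dotv u q) (dotv q q) (dotv u u) => a b c.
suff -> : beta * (beta^-1 * (beta^-1 * b) - beta^-1 * a - (beta^-1 * a - c)) =
  beta^-1 * b - 2 * a + beta * c by lra.
by field; rewrite gt_eqF.
Qed.

(** Applied twice: with the squared norm, to confine a trajectory, and with [- W], to compare costs.
    The factor 2 undoes the one half in [costJ]. *)
Lemma dissipation_cost (y : R -> 'cV[R]_n) (u : R -> 'cV[R]_m) y0 T
    (Phi : 'cV[R]_n -> R) (phi : 'cV[R]_n -> 'cV[R]_n) (rho C c : R) :
  admissible f B y0 y u -> 0 <= T -> 0 <= C -> 0 <= c ->
  (forall t, 0 <= t <= T -> `|y t| <= rho) ->
  (forall a b, `|a| <= rho -> `|b| <= rho ->
    Phi b - Phi a <= dotv (phi a) (b - a) + C * `|b - a| ^+ 2) ->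
  (forall a b, `|a| <= rho -> `|b| <= rho -> `|phi a - phi b| <= C * `|a - b|) ->
  (forall x v, `|x| <= rho ->
    dotv (phi x) (f x + B *m v) <= c * (sqnorm x + beta * sqnorm v)) ->
  Phi (y T) - Phi y0 <= 2 * c * costJ beta y u.
Proof.
move=> [_ [iu [yy0 [yd [[iy [iyd yE]] ae]]]]] T0 C0 c0 yr HPhi Hphi Hc.
have iys := sqnorm_integrable_segment T iy (lexx 0).
have ius := sqnorm_integrable_segment T iu (lexx 0).
have ibu : mu.-integrable `[0, T] (EFin \o (fun t => beta * sqnorm (u t))) by exact: integrableZ_fun.
have isum : mu.-integrable `[0, T] (EFin \o (fun t => sqnorm (y t) + beta * sqnorm (u t))).
  exact: integrableD_fun.
have il : mu.-integrable `[0, T] (EFin \o (fun t => c * (sqnorm (y t) + beta * sqnorm (u t)))).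
  exact: integrableZ_fun.
rewrite -yy0; apply: le_trans (dissipation iyd yE T0 C0 yr HPhi Hphi il _) _.
  apply: ae_imply ae _ => t Ht t0T; have /andP[t0 _] := t0T.
  by rewrite Ht ?IsetE//; apply: Hc; exact: yr.
rewrite RintegralZl// RintegralD// RintegralZl// /costJ.
have h1 := sqnorm_segment_le T iy (lexx 0); have h2 := sqnorm_segment_le T iu (lexx 0).
rewrite -mulrA mulrCA; rewrite (mulrA 2) divff ?mul1r//.
by rewrite ler_wpM2l// lerD// ler_wpM2l// ltW.
Qed.

End Verification.

Section ValueFunction.
Context {R : realType}.
Variables (n m : nat) (f : 'cV[R]_n -> 'cV[R]_n) (B : 'M[R]_(n, m)) (beta : R).
Hypothesis beta0 : 0 < beta.
Let S := ctrlS B beta.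

Lemma enorm_lt (y : 'cV[R]_n) d : 0 < d -> (enorm y < d) = (sqnorm y < d ^+ 2).
Proof.
move=> d0; rewrite -{1}(ger0_norm (ltW d0)) -sqrtr_sqr /enorm ltr_sqrt//.
by rewrite exprn_gt0.
Qed.

Lemma norm_enorm (y : 'cV[R]_n) : `|y| <= enorm y.
Proof. by rewrite -[leLHS]normr_id -sqrtr_sqr ler_wsqrtr// norm_sqnorm. Qed.

Lemma open_enorm d : 0 < d -> open [set y : 'cV[R]_n | enorm y < d].
Proof.
move=> d0; have -> : [set y : 'cV[R]_n | enorm y < d] = sqnorm (p:=n) @^-1` [set r | r < d ^+ 2].
  by apply/seteqP; split=> y /=; rewrite enorm_lt.
apply: open_comp; last exact: open_lt.
move=> y _; have oT : open (setT : set 'cV[R]_n) by exact: openT.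
have H : CkOn 0 (fun y : 'cV[R]_n => \sum_i y i 0 *: (y i 0 : R)) setT.
  by apply: CkOn_sum => // i; apply: CkOnZ => //; exact: CkOn_proj.
exact: (H y I).
Qed.

Variables (d C cf : R) (W : 'cV[R]_n -> R) (psi : 'cV[R]_n -> 'cV[R]_n).
Hypotheses (d0 : 0 < d) (C0 : 0 <= C) (cf0 : 0 <= cf) (lf : liponball f d cf) (f0 : f 0 = 0).
Hypotheses (W0 : W 0 = 0) (psi0 : psi 0 = 0).
Hypothesis hjb : forall a, `|a| < d -> hamiltonian f B beta a (psi a) = 0.
Hypothesis Wt : forall a b, `|a| < d -> `|b| < d ->
  `|W b - W a - dotv (psi a) (b - a)| <= C * `|b - a| ^+ 2.
Hypothesis psi_lip : forall a b, `|a| < d -> `|b| < d -> `|psi a - psi b| <= C * `|a - b|.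

Let W_le a : `|a| < d -> W a <= C * `|a| ^+ 2.
Proof.
move=> ad; have := Wt (_ : `|0| < d) ad; rewrite normr0 W0 psi0 dotv0l !subr0 => /(_ d0).
by apply: le_trans; exact: ler_norm.
Qed.

Lemma verification : exists2 delta, 0 < delta <= d &
  forall y0 y u, enorm y0 < delta -> admissible f B y0 y u -> W y0 <= costJ beta y u.
Proof.
have [rho rho0 rhod] : exists2 rho, 0 < rho & rho < d.
  by exists (d / 2); [rewrite divr_gt0|rewrite ltr_pdivrMr// ltr_pMr// ltr1n].
have [cS cS0 HS] := quad_bound S.
(* The rate in [2 x.(f x + B v) <= c (|x|^2 + beta |v|^2)]: [f] contributes through its Lipschitz
   constant, the control through Young's inequality. *)
pose c := 1 + 2 * n%:R * cf + cS.
have nc0 : 0 <= 2 * n%:R * cf by rewrite !mulr_ge0.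
have c0 : 0 < c by rewrite /c; lra.
(* A cost of at most [J0] raises [|y|^2] by at most [rho^2 / 4]; starting below [rho^2 / 4] it stays
   below [rho^2 / 2], which is less than the square of [3 rho / 4]. *)
pose J0 := rho ^+ 2 / (8 * c).
have J00 : 0 < J0 by rewrite divr_gt0 ?exprn_gt0// mulr_gt0.
pose delta := Num.min (rho / 2) (Num.min 1 (J0 / (C + 1))).
have C1 : 0 < C + 1 by rewrite ltr_wpDl.
have q2 : 0 < J0 / (C + 1) by exact: divr_gt0.
have de0 : 0 < delta by rewrite !lt_min ltr01 q2 divr_gt0.
have de1 : delta <= rho / 2 by rewrite ge_min lexx.
have de2 : delta <= 1 by rewrite !ge_min lexx !orbT.
have de3 : delta <= J0 / (C + 1) by rewrite !ge_min lexx !orbT.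
exists delta; first by rewrite de0/=; lra.
move=> y0 y u y0d adm.
have sy0 : sqnorm y0 < delta ^+ 2 by rewrite -enorm_lt.
have y0r : `|y0| < rho by apply: le_lt_trans (norm_enorm y0) _; lra.
(* A competitor of cost above [J0] loses at once, since [delta] was chosen so that
   [W y0 <= C |y0|^2 <= J0]. Only cheap ones have to be followed in time. *)
have [JJ|JJ] := ltP J0 (costJ beta y u).
  apply: le_trans (ltW JJ); apply: le_trans (W_le (lt_trans y0r rhod)) _.
  apply: (@le_trans _ _ ((C + 1) * delta)); last by rewrite mulrC -ler_pdivlMr.
  apply: ler_pM; [exact: C0|exact: sqr_ge0| |].
    by rewrite lerDl.
  apply: le_trans (norm_sqnorm _) _; apply: le_trans (ltW sy0) _.
  by rewrite expr2 ler_piMr// ltW.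
have iy : isL2 y by case: adm => -[yd [? _]] _.
have [_ [_ [yy0 [yd [[_ [iyd yE]] _]]]]] := adm.
have stay : forall t, 0 <= t -> `|y t| <= rho.
  apply: (@trapped _ _ _ _ rho (3 / 4 * rho) iyd yE) => [||T T0 yT]; first lra.
    by rewrite yy0 ltW.
  have H := @dissipation_cost _ _ _ f B beta beta0 y u y0 T (@sqnorm R n) (fun x => 2 *: x)
    rho (n%:R + 2) c adm T0.
  have {}H : sqnorm (y T) - sqnorm y0 <= 2 * c * costJ beta y u.
    apply: H => //.
    - exact: ltW.
    - move=> a b _ _; have := sqnorm_norm (b - a).
      rewrite -!dotv_sqnorm dotvZl !dotvL (dotvC b a) mulrDl.
      have := sqr_ge0 `|b - a|; move: (`|b - a| ^+ 2) => q; lra.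
    - by move=> a b _ _; rewrite -scalerBr normrZ ger0_norm// ler_wpM2r// lerDr.
    - move=> x v xr; rewrite dotvZl dotvDr mulrDr.
      have h1 := ctrl_young B beta0 x v; have h2 := le_trans (ler_norm _) (HS x).
      have h3 : dotv x (f x) <= n%:R * cf * sqnorm x.
        apply: le_trans (ler_norm _) _; apply: le_trans (dotv_norm _ _) _.
        have fx : `|f x| <= cf * `|x|.
          have := lf (ltW (le_lt_trans xr rhod)) (_ : `|0| <= d); rewrite normr0 f0 !subr0.
          by apply; exact: ltW.
        apply: le_trans (ler_wpM2l _ fx) _; first by rewrite mulr_ge0.
        rewrite mulrACA -expr2.
        by rewrite ler_wpM2l ?mulr_ge0// norm_sqnorm.
      have h4 : 0 <= beta * sqnorm v by rewrite mulr_ge0 ?sqnorm_ge0// ltW.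
      have h5 : 0 <= (2 * n%:R * cf + cS) * (beta * sqnorm v) by rewrite mulr_ge0// addr_ge0// ltW.
      have h6 := sqnorm_ge0 x.
      rewrite -/S in h1; rewrite /c.
      move: h1 h2 h3 h4 h5 h6; move: (dotv x (f x)) (dotv x (B *m v)) (dotv x (S *m x)) => a1 a2 a3.
      move: (sqnorm x) (beta * sqnorm v) => a4 a5; move: (n%:R : R) => N h1 h2 h3 h4 h5 h6.
      rewrite (_ : _ * (a4 + a5) = a4 + a5 + 2 * (N * cf * a4) + cS * a4 + (2 * N * cf + cS) * a5); last by ring.
      lra.
  have h1 : 2 * c * costJ beta y u <= rho ^+ 2 / 4.
    apply: le_trans (ler_wpM2l _ JJ) _; first by rewrite mulr_ge0// ltW.
    by rewrite /J0 le_eqVlt; apply/orP; left; apply/eqP; field; rewrite gt_eqF.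
  have h2 : delta ^+ 2 <= rho ^+ 2 / 4.
    apply: (@le_trans _ _ ((rho / 2) ^+ 2)).
      by rewrite lerXn2r// nnegrE ltW// divr_gt0.
    by rewrite le_eqVlt; apply/orP; left; apply/eqP; field.
  have h3 := norm_sqnorm (y T).
  rewrite -ler_sqr ?nnegrE//; last by rewrite mulr_ge0// ltW.
  have -> : (3 / 4 * rho) ^+ 2 = 9 / 16 * rho ^+ 2 by field.
  have := sqr_ge0 rho; move: (rho ^+ 2) h1 h2 h3 => q h1 h2 h3 q0; lra.
apply/ler_addgt0Pr => eps eps0.
have e10 : 0 < eps / (C + 1) by rewrite divr_gt0.
have [T T0 HT] := L2_small iy e10.
have H := @dissipation_cost _ _ _ f B beta beta0 y u y0 T (fun x => - W x) (fun x => - psi x)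
  rho C 2^-1 adm T0 C0.
have {}H : - W (y T) - - W y0 <= 2 * 2^-1 * costJ beta y u.
  apply: H => //.
  - by move=> t /andP[t0 _]; exact: stay.
  - move=> a b ar br; have := Wt (le_lt_trans ar rhod) (le_lt_trans br rhod).
    by rewrite ler_norml dotvNl => /andP[]; lra.
  - move=> a b ar br; rewrite -opprD normrN.
    exact: psi_lip (le_lt_trans ar rhod) (le_lt_trans br rhod).
  (* Young's inequality at [- v] bounds [- psi.(B v)]; the form of [S] at [psi] cancels against the
     Hamilton-Jacobi equation, leaving exactly the running cost. *)
  - move=> x v xr; have := hjb (le_lt_trans xr rhod); rewrite /hamiltonian dotv_sqnorm -/S.
    have := ctrl_young B beta0 (psi x) (- v).
    rewrite mulmxN dotvNr -!dotv_sqnorm !dotvL opprK -/S; lra.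
have yTr := le_lt_trans (stay T T0) rhod.
have : W (y T) <= eps.
  apply: le_trans (W_le yTr) _; apply: (@le_trans _ _ ((C + 1) * (eps / (C + 1)))).
    apply: ler_pM; [exact: C0|exact: sqr_ge0| |].
      by rewrite lerDl.
    exact: le_trans (norm_sqnorm _) HT.
  by rewrite mulrCA divff ?mulr1// gt_eqF.
by move: H; rewrite divff// mul1r; lra.
Qed.

Hypothesis Wadm : forall a, `|a| < d ->
  exists y u, admissible f B a y u /\ costJ beta y u = W a.

(** The lower bound [W y0] is attained by the extremal, which is therefore a minimizer and
    identifies the infimum. *)
Lemma value_minimizer : exists2 delta, 0 < delta <= d &
  forall y0, enorm y0 < delta -> (exists y u, isMinimizer f B beta y0 y u) /\
    valueFun f B beta y0 = W y0.
Proof.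
have [delta /andP[de0 ded] ver] := verification; exists delta; first by rewrite de0.
move=> y0 y0d; have y0d' : `|y0| < d.
  by apply: le_lt_trans (norm_enorm y0) _; exact: lt_le_trans ded.
have [y [u [adm J]]] := Wadm y0d'; split.
  by exists y, u; split=> // y' u' adm'; rewrite J; exact: ver y0d adm'.
apply/eqP; rewrite eq_le; apply/andP; split.
  apply: ge_inf; last by exists y, u; rewrite J.
  by exists (W y0) => _ [y' [u' [adm' ->]]]; exact: ver y0d adm'.
apply: lb_le_inf; first by exists (W y0), y, u; rewrite J.
by move=> _ [y' [u' [adm' ->]]]; exact: ver y0d adm'.
Qed.

Lemma value_Ck k : CkOn k psi (openball d) -> CkOn k.+1 W (openball d).
Proof.
move=> Cpsi.
have dW x : openball d x -> differentiable W x /\ forall v, 'D_v W x = dotv (psi x) v.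
  move=> xd; apply: diff_cV => [a u v|e e0]; first by rewrite dotvDr dotvZr.
  exists (Num.min (d - `|x|) (e / (C + 1))) => [|h].
    by rewrite lt_min subr_gt0 xd divr_gt0// ltr_wpDl.
  rewrite lt_min => /andP[h1 h2].
  have xhd : `|x + h| < d by apply: le_lt_trans (ler_normD _ _) _; rewrite -ltrBrDl.
  have := Wt xd xhd; rewrite (addrC x h) addrK => /le_trans; apply.
  rewrite expr2 mulrA ler_wpM2r//; apply: (@le_trans _ _ ((C + 1) * `|h|)).
    by rewrite ler_wpM2r// lerDl.
  by rewrite mulrC -ler_pdivlMr ?ltr_wpDl// ltW.
split=> [x /dW[]//|v].
apply: (CkOn_eq (g := fun x => dotv (psi x) v)); first exact: open_openball.
  by move=> x /dW[_ ->].
rewrite (_ : (fun x => _) = fun x => \sum_i v i 0 *: (psi x i 0 : R)).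
  apply: CkOn_sum => [|i]; first exact: open_openball.
  apply: CkOnZ; [exact: open_openball|exact: CkOn_cst|].
  by apply: CkOn_coord => //; exact: open_openball.
by apply/funext => x; rewrite dotvE; apply: eq_bigr => i _; rewrite mulrC.
Qed.

End ValueFunction.

Theorem mainTheorem18 (R : realType) (n m : nat)
    (f : 'cV[R]_n -> 'cV[R]_n) (B : 'M[R]_(n, m)) (beta : R) (k : nat) :
  0 < beta ->
  CkOn 1 f setT ->
  f 0 = 0 ->
  DLipschitzOnCompacts f ->
  (exists Fhat : 'M[R]_(m, n), exp_stable (jacobian0 f + B *m Fhat)) ->
  (1 <= k)%N ->
  FrechetCk (@inW R n) (@Wnorm R n) (@isL2 R n) (@L2norm R n) k.+1
    (nemytskii f) ->
  exists delta : R, 0 < delta /\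
    (forall y0 : 'cV[R]_n, enorm y0 < delta ->
       exists (y : R -> 'cV[R]_n) (u : R -> 'cV[R]_m),
         isMinimizer f B beta y0 y u) /\
    CkOn k (valueFun f B beta) [set y0 | enorm y0 < delta].
Proof.
(* Once [k] is replaced by [k + 1], [f] is of class [C^(k+2)], which gives [psi] of class [C^k] and
   [W] of class [C^(k+1)], the required order. *)
move=> beta0 _ f0 _ stab; case: k => // k _ /FrechetCk_CkOn Cf.
have [d [C [cf [W [psi [[d0 C0 cf0 lf] [[W0 psi0 Cpsi hjb] [Wt psi_lip Wadm]]]]]]]] :=
  local_value beta0 Cf f0 stab.
have [delta /andP[de0 ded] H] :=
  value_minimizer beta0 d0 C0 cf0 lf f0 W0 psi0 hjb Wt psi_lip Wadm.
exists delta; split=> //; split=> [y0 /H[]//|].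
apply: (CkOn_eq (g := W)); first exact: open_enorm.
  by move=> y0 /H[_ ->].
apply: CkOn_sub (value_Ck C0 Wt Cpsi) => y0 /= y0d.
by apply: le_lt_trans (norm_enorm y0) _; exact: lt_le_trans ded.
Qed.
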